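(* Let $j\in\mathbb N$, $m=2j+1$, and $-j+\frac14<s<m$. Define $$\beta=\begin{cases}\min\{\frac1{12m},\frac{m-s}{3m}\},& s\ge0,\\ \min\{\frac{j-3/4}{32m},\frac{s+1/2}{2m}\},& -\frac12<s<0,\\ \frac1{32m}\big[s-(-j+\frac14)\big],& -j+\frac14<s\le-\frac12.\end{cases}$$ If $b,b',\alpha',\alpha$ satisfy $$\tfrac12-\beta\le b'\le b<\tfrac12<\alpha'\le\alpha\le\tfrac12+\beta,$$ then $$\|\partial_x(fg)\|_{Y^{s,-b}(\mathbb R^2)}\le c_{s,b,\alpha}\,\|f\|_{X^{s,b',\alpha'}(\mathbb R^2)}\|g\|_{X^{s,b',\alpha'}(\mathbb R^2)}$$ and $$\|\partial_x(fg)\|_{Y^{s,-b}}\le\|\partial_x(fg)\|_{X^{s,-b}}+c_{s,b}\,\|f\|_{X^{s,b'}}\|g\|_{X^{s,b'}}.$$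
   Context: $\widehat u(\xi,\tau)=\int\int e^{-i(\xi x+\tau t)}u(x,t)\,dx\,dt$ is the space-time Fourier transform. For real $s,b,\alpha$, $$\|u\|_{X^{s,b}}^2=\int_{\mathbb R}\int_{\mathbb R}(1+|\xi|)^{2s}(1+|\tau-\xi^m|)^{2b}|\widehat u(\xi,\tau)|^2d\xi d\tau,$$ $$\|u\|_{X^{s,b,\alpha}(\mathbb R^2)}^2=\|u\|_{X^{s,b}}^2+\int_{\mathbb R}\int_{-1}^1(1+|\tau|)^{2\alpha}|\widehat u(\xi,\tau)|^2d\xi d\tau,$$ $$\|u\|_{Y^{s,b}}^2=\int_{\mathbb R}\int_{\mathbb R}(1+|\tau|)^{\frac{2s}m}(1+|\tau-\xi^m|)^{2b}|\widehat u(\xi,\tau)|^2d\xi d\tau .$$ The estimates are for all $f,g$ for which the right-hand sides are finite. The Fourier transform of $\partial_x(fg)$ is understood as $i\xi$ times (up to the usual normalizing constant) the convolution $\widehat f*\widehat g$.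
   Formalization: In the first estimate the constant c_{s,b,α} is allowed to depend on α' as well (not on b'); a constant uniform in α' over (1/2, α] is impossible, since the estimate fails at α' = 1/2. *)

(* Defs.v *)
From HB Require Import structures.
From mathcomp Require Import all_boot all_order all_algebra.
From mathcomp Require Import complex.
From mathcomp Require Import all_classical all_reals all_analysis.

Set Implicit Arguments.
Unset Strict Implicit.
Unset Printing Implicit Defensive.

Import Order.TTheory GRing.Theory Num.Theory.
Import numFieldNormedType.Exports.

Local Open Scope classical_set_scope.
Local Open Scope ring_scope.
Local Open Scope complex_scope.

Notation leb2 R := ((@lebesgue_measure R) \x (@lebesgue_measure R))%E.

(* Borel measurability; every Lebesgue class has a Borel representative. *)
Definition cmeasurable {R : realType} (U : R * R -> R[i]) : Prop :=
  measurable_fun [set: R * R] (fun p => complex.Re (U p)) /\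
  measurable_fun [set: R * R] (fun p => complex.Im (U p)).

Definition cintegrable {R : realType} (U : R * R -> R[i]) : Prop :=
  (leb2 R).-integrable [set: R * R] (fun p => (complex.Re (U p))%:E) /\
  (leb2 R).-integrable [set: R * R] (fun p => (complex.Im (U p))%:E).

Definition cint {R : realType} (U : R * R -> R[i]) : R[i] :=
  Rintegral (leb2 R) [set: R * R] (fun p => complex.Re (U p)) +i*
  Rintegral (leb2 R) [set: R * R] (fun p => complex.Im (U p)).

(* The multi-index of a partial derivative is a word over {d/dx, d/dt}:
   [false] stands for d/dx and [true] for d/dt. *)
Definition slice {R : realType} (d : bool) (phi : R * R -> R) (p : R * R) :
    R -> R :=
  if d then fun t => phi (p.1, t) else fun x => phi (x, p.2).

Definition base {R : realType} (d : bool) (p : R * R) : R :=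
  if d then p.2 else p.1.

Definition partial {R : realType} (d : bool) (phi : R * R -> R) : R * R -> R :=
  fun p => derive1 (slice d phi p) (base d p).

Definition partials {R : realType} (w : seq bool) (phi : R * R -> R) :
  R * R -> R := foldr partial phi w.

Definition cpartials {R : realType} (w : seq bool) (phi : R * R -> R[i]) :
    R * R -> R[i] :=
  fun p => partials w (fun q => complex.Re (phi q)) p +i*
           partials w (fun q => complex.Im (phi q)) p.

Definition smooth {R : realType} (phi : R * R -> R) : Prop :=
  forall (w : seq bool) (d : bool) (p : R * R),
    derivable (slice d (partials w phi) p) (base d p) 1.

(* Existence of all iterated partials in every order, together with their
   boundedness below, forces phi to be C^infinity. *)
Definition schwartz {R : realType} (phi : R * R -> R[i]) : Prop :=
  [/\ smooth (fun p => complex.Re (phi p)),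
      smooth (fun p => complex.Im (phi p)) &
      forall (w : seq bool) (k : nat), exists M : R, forall p : R * R,
        (1 + `|p.1| + `|p.2|) ^+ k * Normc.normc (cpartials w phi p) <= M].

(* Only the values on Schwartz functions are meaningful.  In [td_bounded], M is
   an upper bound of the N-th Schwartz norm of phi. *)
Record tempered_distribution (R : realType) := TemperedDistribution {
  td_fun :> (R * R -> R[i]) -> R[i] ;
  td_linear : forall (a : R[i]) (phi psi : R * R -> R[i]),
    schwartz phi -> schwartz psi ->
    td_fun (fun p => a * phi p + psi p) = a * td_fun phi + td_fun psi ;
  td_bounded : exists (C : R) (N : nat), forall (phi : R * R -> R[i]) (M : R),
    schwartz phi ->
    (forall (w : seq bool) (p : R * R), (size w <= N)%N ->
       (1 + `|p.1| + `|p.2|) ^+ N * Normc.normc (cpartials w phi p) <= M) ->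
    Normc.normc (td_fun phi) <= C * M }.

Definition expi {R : realType} (theta : R) : R[i] := cos theta +i* sin theta.

Definition fourier {R : realType} (phi : R * R -> R[i]) : R * R -> R[i] :=
  fun z => cint (fun p => expi (- (z.1 * p.1 + z.2 * p.2)) * phi p).

(* The Fourier transform of the distribution u, i.e. phi |-> u (fourier phi),
   is the function U. *)
Definition has_fourier {R : realType} (u : tempered_distribution R)
    (U : R * R -> R[i]) : Prop :=
  cmeasurable U /\
  forall phi : R * R -> R[i], schwartz phi ->
    cintegrable (fun p => U p * phi p) /\
    u (fourier phi) = cint (fun p => U p * phi p).

(* The norms of u as functions of its Fourier transform U; z = (xi, tau). *)
Definition normX {R : realType} (m : nat) (s b : R) (U : R * R -> R[i]) :
    \bar R :=
  sqrte (\int[leb2 R]_z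
    (((1 + `|z.1|) `^ (2 * s) * (1 + `|z.2 - z.1 ^+ m|) `^ (2 * b)
      * Normc.normc (U z) ^+ 2)%:E))%E.

Definition normXa {R : realType} (m : nat) (s b alpha : R)
    (U : R * R -> R[i]) : \bar R :=
  sqrte (normX m s b U ^+ 2 +
    \int[leb2 R]_(z in [set z : R * R | (-1 <= z.1 <= 1)%R])
      (((1 + `|z.2|) `^ (2 * alpha) * Normc.normc (U z) ^+ 2)%:E))%E.

Definition normY {R : realType} (m : nat) (s b : R) (U : R * R -> R[i]) :
    \bar R :=
  sqrte (\int[leb2 R]_z
    (((1 + `|z.2|) `^ (2 * s / m%:R) * (1 + `|z.2 - z.1 ^+ m|) `^ (2 * b)
      * Normc.normc (U z) ^+ 2)%:E))%E.

(* The convolution integral of U and V converges absolutely almost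
   everywhere. *)
Definition conv_defined {R : realType} (U V : R * R -> R[i]) : Prop :=
  {ae (leb2 R), forall z, cintegrable (fun q => U q * V (z - q))}.

(* Fourier transform of d/dx (fg), where U and V are those of f and g; with
   the kernel e^{-i(xi x + tau t)} the normalizing constant is (2 pi)^-2. *)
Definition dx_prod_hat {R : realType} (U V : R * R -> R[i]) : R * R -> R[i] :=
  fun z => z.1 *i * ((2 * pi) ^- 2)%:C * cint (fun q => U q * V (z - q)).

Definition beta {R : realType} (j m : nat) (s : R) : R :=
  if 0 <= s then
    Num.min (1 / (12 * m%:R)) ((m%:R - s) / (3 * m%:R))
  else if - (1 / 2) < s then
    Num.min ((j%:R - 3 / 4) / (32 * m%:R)) ((s + 1 / 2) / (2 * m%:R))
  else 1 / (32 * m%:R) * (s - (- j%:R + 1 / 4)).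

(* Main.v *)
Require Import Defs.
From HB Require Import structures.
From mathcomp Require Import all_boot all_order all_algebra.
From mathcomp Require Import complex.
From mathcomp Require Import all_classical all_reals all_analysis.
From mathcomp Require Import measurable_realfun ring lra.

(** On the Fourier side the product becomes a convolution, and with
    [xi0 = - (xi1 + xi2)] and [tau0 = - (tau1 + tau2)] both inequalities bound
    trilinear forms over triples of frequencies with sum zero.  Put
    [sg q = 1 + |tau - xi ^ m|].  Since

      (tau0 - xi0 ^ m) + (tau1 - xi1 ^ m) + (tau2 - xi2 ^ m)
        = - (xi0 ^ m + xi1 ^ m + xi2 ^ m),

    one of the three [sg] is at least a third of the resonance function, which is
    of the order of [|xi0 xi1 xi2| P ^ (m - 3)] from below, [P] being the largest of
    the [|xi|] ([resonance_ge]).  This gain pays for the derivative and for the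
    negative regularity, down to [s > - j + 1/4].

    The norms decrease when [b'] decreases, and so does the one on the left when
    [b] increases, so it is enough to treat the weights with [b = b' = 1/2 - beta]
    ([beta_facts] collects what is used of [beta]).  These miss the integrable range
    of exponents by [2 beta], a loss that is compensated everywhere by a small
    power of the frequencies.

    Two mechanisms carry the proof.

    - [bilinear_bound] reduces an estimate to a pointwise one: the square of the
      multiplier divided by the weights has to be dominated by a sum of kernels
      each of which, with one of the three frequencies fixed, has bounded integral
      over the plane ([schur]).  It follows by duality, AM-GM and Tonelli.

    - Four families of such kernels suffice.  The main one, [kder], contains the
      Jacobian [xi1 ^ (m - 1) - xi2 ^ (m - 1)] of the resonance, and [kaff] replaces
      it where this Jacobian degenerates; [klow] and [ktime] serve when the time
      frequency is far above or far below the curve [tau = xi ^ m].  The total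
      kernel [total_kernel] is their sum over all choices of the fixed frequency.

    The pointwise estimates are a case analysis on the sizes of the frequencies,
    in which every case reduces to an inequality between monomials, proved by
    taking logarithms.  [high_high_bound] treats the case where [xi1] and [xi2] are
    not small.  If one of them is small, the norm with the low-frequency term gives
    the additional decay needed in [low_gain_bound].

    The [Y] weight is at most the [X] weight plus its [excess].  For the excess
    no low-frequency term is needed: near the curve it vanishes up to the modulation
    ([excess_near_pos], [excess_near_neg]), and this replaces the
    additional decay ([low_near_bound]); far from the curve the modulation of the
    output is of the order of [tau0] or [xi0 ^ m] ([far_pos], [far_neg]).
    [mult_excess] combines these, and gives the second inequality; together with
    [mult_low_decay] it gives the first. *)

Set Implicit Arguments.
Unset Strict Implicit.
Unset Printing Implicit Defensive.

Import Order.TTheory GRing.Theory Num.Theory.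
Import numFieldNormedType.Exports.

Local Open Scope classical_set_scope.
Local Open Scope ring_scope.


(** * Translation and reflection of planar Lebesgue measure *)

Section translation.
Context {R : realType}.
Local Notation mu := (@lebesgue_measure R).
Local Notation mu2 := (leb2 R).
Local Open Scope ereal_scope.

Lemma lebesgue_measure_addr (a : R) (A : set R) : measurable A ->
  pushforward mu ((fun x => x + a)%R : _ -> measurableTypeR R) A = mu A.
Proof.
have ma : measurable_fun setT
    ((fun x => x + a)%R : measurableTypeR R -> measurableTypeR R).
  by apply: measurable_funD => //; exact: measurable_id.
pose mm := isMeasurableFun.Build _ _ _ _ _ ma.
pose phi : {mfun _ >-> _} := HB.pack
  ((fun x => x + a)%R : measurableTypeR R -> measurableTypeR R) mm.
move=> mA; apply/esym.
apply: (@lebesgue_measure_unique _ (pushforward mu phi)) => //= _ [[u v]] _ <-.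
rewrite /pushforward.
have -> : (fun x => x + a)%R @^-1` `]u, v] = `](u - a)%R, (v - a)%R]%classic.
  by apply/seteqP; split => x /=; rewrite !in_itv/= ltrBlDr lerBrDr.
rewrite /= !lebesgue_measure_itv/=.
rewrite !lte_fin ltrD2r; case: ifPn => // _.
by rewrite -!EFinD; congr EFin; ring.
Qed.

Lemma integral_shift (f : R -> \bar R) (a : R) :
  measurable_fun setT f -> (forall x, 0 <= f x) ->
  \int[mu]_x f (x + a)%R = \int[mu]_x f x.
Proof.
move=> mf f0.
have ma : measurable_fun setT
    ((fun x => x + a)%R : measurableTypeR R -> measurableTypeR R).
  by apply: measurable_funD => //; exact: measurable_id.
have := @ge0_integral_pushforward _ _ _ _ _ _ ma mu setT f measurableT mf
  (fun y _ => f0 y).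
rewrite preimage_setT => <-.
apply: eq_measure_integral => A mA _; exact: lebesgue_measure_addr.
Qed.

Lemma integral_reflect (f : R -> \bar R) :
  measurable_fun setT f -> (forall x, 0 <= f x) ->
  \int[mu]_x f (- x)%R = \int[mu]_x f x.
Proof.
move=> mf f0.
have ma : measurable_fun setT (-%R : measurableTypeR R -> measurableTypeR R).
  exact: oppr_measurable.
have := @ge0_integral_pushforward _ _ _ _ _ _ ma mu setT f measurableT mf
  (fun y _ => f0 y).
rewrite preimage_setT => <-.
apply: eq_measure_integral => A mA _; exact: lebesgue_measureN.
Qed.

Lemma integral2_shift (f : R * R -> \bar R) (a : R * R) :
  measurable_fun setT f -> (forall x, 0 <= f x) ->
  \int[mu2]_p f (p + a)%R = \int[mu2]_p f p.
Proof.
move=> mf f0.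
have ms : measurable_fun setT (fun p : measurableTypeR R * measurableTypeR R =>
    (p.1 + a.1, p.2 + a.2)%R : measurableTypeR R * measurableTypeR R).
  apply: measurable_fun_pair.
    by apply: measurable_funD => //; exact: measurable_fst.
  by apply: measurable_funD => //; exact: measurable_snd.
have mg := measurableT_comp mf ms.
rewrite (@fubini_tonelli1 _ _ _ _ _ mu mu f mf f0).
rewrite (_ : (fun p => f (p + a)%R) = fun p => f (p.1 + a.1, p.2 + a.2)%R) //.
rewrite (@fubini_tonelli1 _ _ _ _ _ mu mu _ mg (fun _ => f0 _)).
rewrite -[RHS](integral_shift a.1); last 2 first.
  exact: measurable_fun_fubini_tonelli_F.
  by move=> x; apply: integral_ge0.
apply: eq_integral => x _ ; rewrite /fubini_F/=.
rewrite (integral_shift (f := fun y => f ((x + a.1)%R, y)))//.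
by apply: (measurableT_comp mf); exact: measurable_pair1.
Qed.

Lemma integral2_reflect (f : R * R -> \bar R) :
  measurable_fun setT f -> (forall x, 0 <= f x) ->
  \int[mu2]_p f (- p)%R = \int[mu2]_p f p.
Proof.
move=> mf f0.
have ms : measurable_fun setT (fun p : measurableTypeR R * measurableTypeR R =>
    (- p.1, - p.2)%R : measurableTypeR R * measurableTypeR R).
  apply: measurable_fun_pair.
    by apply: measurable_funN; exact: measurable_fst.
  by apply: measurable_funN; exact: measurable_snd.
have mg := measurableT_comp mf ms.
rewrite (@fubini_tonelli1 _ _ _ _ _ mu mu f mf f0).
rewrite (_ : (fun p => f (- p)%R) = fun p => f (- p.1, - p.2)%R) //.
rewrite (@fubini_tonelli1 _ _ _ _ _ mu mu _ mg (fun _ => f0 _)).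
rewrite -[RHS]integral_reflect; last 2 first.
  exact: measurable_fun_fubini_tonelli_F.
  by move=> x; apply: integral_ge0.
apply: eq_integral => x _ ; rewrite /fubini_F/=.
rewrite (integral_reflect (f := fun y => f ((- x)%R, y)))//.
by apply: (measurableT_comp mf); exact: measurable_pair1.
Qed.
End translation.

(** * The Schur condition and Tonelli's theorem in the plane *)

Section schur.
Context {R : realType}.
Local Notation mu := (@lebesgue_measure R).
Local Notation mu2 := (leb2 R).
Local Open Scope ereal_scope.

(** The hypothesis of Schur's test, imposed on one side only: [Psi a] has mass
    at most [C] for every fixed frequency [a].  A trilinear form over triples of
    frequencies with sum zero needs such a bound for each choice of the fixed
    one, see [bilinear_bound]. *)
Definition schur (C : R) (Psi : R * R -> R * R -> R) : Prop :=
  [/\ measurable_fun [set: (R * R) * (R * R)] (fun x => Psi x.1 x.2),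
      forall a p, (0 <= Psi a p)%R &
      forall a, \int[mu2]_p (Psi a p)%:E <= C%:E].

Lemma measurable_sub2 :
  measurable_fun [set: (R * R) * (R * R)] (fun x => (x.1 - x.2)%R).
Proof.
have mf d (T : measurableType d) (f g : T -> R) : measurable_fun setT f ->
    measurable_fun setT g -> measurable_fun setT (fun x => (f x - g x)%R).
  exact: measurable_funB.
apply: (@measurable_fun_pair _ _ _ _ _ _ (fun x : (R * R) * (R * R) => (x.1.1 - x.2.1)%R)
  (fun x => (x.1.2 - x.2.2)%R)); apply: mf.
- by apply: measurableT_comp => //; exact: measurable_fst.
- by apply: measurableT_comp => //; exact: measurable_snd.
- by apply: measurableT_comp => //; exact: measurable_fst.
- by apply: measurableT_comp => //; exact: measurable_snd.
Qed.

Lemma measurable_opp2 : measurable_fun [set: R * R] (fun x => (- x)%R).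
Proof.
apply: (@measurable_fun_pair _ _ _ _ _ _ (fun x : R * R => (- x.1)%R)
  (fun x => (- x.2)%R)); exact: measurable_funN.
Qed.

(** Each of the three terms of the majorant of [X ^+ 2] is a product of two
    factors that integrate separately; AM-GM with a weight per term turns
    [2 * X] into a sum of integrable quantities.  The weights are chosen in
    [trilinear_bound]. *)
Lemma two_sum_sqr_le (X H U V P0 P1 P2 l0 l1 l2 : R) :
  (0 <= H -> 0 <= U -> 0 <= V -> 0 <= P0 -> 0 <= P1 -> 0 <= P2 ->
  0 < l0 -> 0 < l1 -> 0 < l2 -> 0 <= X ->
  X ^+ 2 <= H * U * V * (P0 + P1 + P2) ->
  2 * X <= l0 * (P0 * H) + l0^-1 * (U * V) + (l1 * (H * V) + l1^-1 * (P1 * U))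
     + (l2 * (H * U) + l2^-1 * (P2 * V)))%R.
Proof.
move=> H0 U0 V0 p0 p1 p2 l00 l10 l20 X0 XH.
have sq (l x y : R) : (0 < l -> (4 * (x * y) <= (l * x + l^-1 * y) ^+ 2))%R.
  move=> lp; have e : (l * l^-1 = 1)%R by rewrite mulfV// gt_eqF.
  have -> : ((l * x + l^-1 * y) ^+ 2 = (l * x - l^-1 * y) ^+ 2
     + 4 * (l * l^-1) * (x * y))%R by ring.
  by rewrite e mulr1 lerDr sqr_ge0.
have nn (l x y : R) : (0 < l -> 0 <= x -> 0 <= y -> 0 <= l * x + l^-1 * y)%R.
  by move=> lp x0 y0; rewrite addr_ge0// mulr_ge0// ?invr_ge0 ltW.
have s0 := sq _ (P0 * H)%R (U * V)%R l00.
have s1 := sq _ (H * V)%R (P1 * U)%R l10.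
have s2 := sq _ (H * U)%R (P2 * V)%R l20.
have n0 := nn _ _ _ l00 (mulr_ge0 p0 H0) (mulr_ge0 U0 V0).
have n1 := nn _ _ _ l10 (mulr_ge0 H0 V0) (mulr_ge0 p1 U0).
have n2 := nn _ _ _ l20 (mulr_ge0 H0 U0) (mulr_ge0 p2 V0).
move: s0 s1 s2 n0 n1 n2.
set t0 := (l0 * _ + _)%R; set t1 := (l1 * _ + _)%R; set t2 := (l2 * _ + _)%R.
move=> s0 s1 s2 n0 n1 n2.
have t_ge0 : (0 <= t0 + t1 + t2)%R by apply: addr_ge0 => //; exact: addr_ge0.
rewrite -(@ler_sqr _ (2 * X)%R) ?nnegrE ?mulr_ge0//.
have c0 := mulr_ge0 n0 n1; have c1 := mulr_ge0 n0 n2; have c2 := mulr_ge0 n1 n2.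
nra.
Qed.


Definition box (n : nat) : set (R * R) :=
  `[(- n%:R)%R, n%:R%R]%classic `*` `[(- n%:R)%R, n%:R%R]%classic.

Lemma measurable_box n : measurable (box n).
Proof. by apply: measurableX; exact: measurable_itv. Qed.

Lemma leb2_box_fin n : leb2 R (box n) < +oo.
Proof.
rewrite /box product_measure1E; [|exact: measurable_itv..].
rewrite /= lebesgue_measure_itv/=.
by case: ifPn => _; rewrite ?mule0//= -EFinB -EFinM ltry.
Qed.

Lemma bigcup_box : \bigcup_n (box n) = setT.
Proof.
rewrite -subTset => -[x y] _; exists (Num.truncn (`|x| + `|y|)%R).+1 => //.
have : ((`|x| + `|y|) < (Num.truncn (`|x| + `|y|)).+1%:R :> R)%R by exact: Num.Theory.truncnS_gt.
move: (_.+1) => n; have := normr_ge0 x; have := normr_ge0 y => y0 x0 h.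
split => /=; rewrite in_itv/= -ler_norml; lra.
Qed.

Lemma leb2_sigma_finite : sigma_finite setT (leb2 R).
Proof.
exists box; first by rewrite bigcup_box.
by move=> n; split; [exact: measurable_box | exact: leb2_box_fin].
Qed.

(** The product of two copies of Lebesgue measure carries only a measure
    structure; Tonelli's theorem for pairs of planar points needs it to be
    sigma-finite, which the boxes witness. *)
Definition leb2_sfin : {sigma_finite_measure set (measurableTypeR R * measurableTypeR R)%type -> \bar R} :=
  HB.pack (leb2 R) (Measure_isSigmaFinite.Build _ _ _ (leb2 R) leb2_sigma_finite).

Notation T4 := ((R * R) * (R * R))%type.
Let mu4 := (leb2_sfin \x leb2_sfin).

(** The triple of frequencies behind a convolution at [z] is [(- z, q, z - q)];
    the next lemmas concern a kernel whose fixed frequency is each of these in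
    turn, as a function of the pair [(z, q)]. *)
Lemma measurable_reflect_l (Psi : R * R -> R * R -> R) :
  measurable_fun [set: T4] (fun x => Psi x.1 x.2) ->
  measurable_fun [set: T4] (fun x => Psi (- x.1)%R x.2).
Proof.
move=> m; apply: (measurableT_comp m (g := fun x : T4 => ((- x.1)%R, x.2))).
apply: measurable_fun_pair; last exact: measurable_snd.
by apply: (measurableT_comp measurable_opp2); exact: measurable_fst.
Qed.

Lemma measurable_shear_r (Psi : R * R -> R * R -> R) :
  measurable_fun [set: T4] (fun x => Psi x.1 x.2) ->
  measurable_fun [set: T4] (fun x => Psi x.2 (x.1 - x.2)%R).
Proof.
move=> m; apply: (measurableT_comp m (g := fun x : T4 => (x.2, (x.1 - x.2)%R))).
by apply: measurable_fun_pair; [exact: measurable_snd | exact: measurable_sub2].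
Qed.

Lemma measurable_shear_l (Psi : R * R -> R * R -> R) :
  measurable_fun [set: T4] (fun x => Psi x.1 x.2) ->
  measurable_fun [set: T4] (fun x => Psi (x.1 - x.2)%R x.2).
Proof.
move=> m; apply: (measurableT_comp m (g := fun x : T4 => ((x.1 - x.2)%R, x.2))).
by apply: measurable_fun_pair; [exact: measurable_sub2 | exact: measurable_snd].
Qed.

Lemma tonelli_zq (f : T4 -> \bar R) :
  measurable_fun setT f -> (forall x, 0 <= f x) ->
  \int[mu4]_x f x = \int[mu2]_z \int[mu2]_q f (z, q).
Proof.
move=> mf f0; exact: (@fubini_tonelli1 _ _ _ _ _ leb2_sfin leb2_sfin f mf f0).
Qed.

Lemma tonelli_qz (f : T4 -> \bar R) :
  measurable_fun setT f -> (forall x, 0 <= f x) ->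
  \int[mu4]_x f x = \int[mu2]_q \int[mu2]_z f (z, q).
Proof.
move=> mf f0; exact: (@fubini_tonelli2 _ _ _ _ _ leb2_sfin leb2_sfin f mf f0).
Qed.

Lemma measurable_integral_q (f : T4 -> \bar R) :
  measurable_fun setT f -> (forall x, 0 <= f x) ->
  measurable_fun [set: R * R] (fun z => \int[mu2]_q f (z, q)).
Proof. by move=> mf f0; exact: (@measurable_fun_fubini_tonelli_F _ _ _ _ _ leb2_sfin f mf f0). Qed.

Lemma integral_weighted_le (C B : R) (Phi : R * R -> R * R -> R) (g : R * R -> R) :
  (0 <= C)%R ->
  measurable_fun [set: T4] (fun x => Phi x.1 x.2) -> (forall z q, (0 <= Phi z q)%R) ->
  (forall z, \int[mu2]_q (Phi z q)%:E <= C%:E) ->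
  measurable_fun [set: R * R] g -> (forall z, (0 <= g z)%R) ->
  \int[mu2]_z (g z)%:E <= B%:E ->
  \int[mu4]_x (Phi x.1 x.2 * g x.1)%:E <= (C * B)%:E.
Proof.
move=> C0 mP P0 PC mg g0 gB.
have mE : measurable_fun [set: T4] (fun x => (Phi x.1 x.2 * g x.1)%:E).
  apply/measurable_EFinP; apply: measurable_funM => //.
  by apply: (measurableT_comp mg); exact: measurable_fst.
have E0 (x : T4) : 0 <= (Phi x.1 x.2 * g x.1)%:E by rewrite lee_fin mulr_ge0.
rewrite (tonelli_zq mE E0).
apply: (@le_trans _ _ (\int[mu2]_z (C%:E * (g z)%:E))).
  apply: ge0_le_integral => //.
  - by move=> z _; apply: integral_ge0 => q _; exact: E0.
  - exact: (measurable_integral_q mE).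
  - by apply/measurable_EFinP; apply: measurable_funM.
  - move=> z _; rewrite /=.
    under eq_integral do rewrite mulrC EFinM.
    rewrite ge0_integralZl_EFin//.
    + by rewrite muleC lee_wpmul2r// lee_fin.
    + by move=> q _; rewrite lee_fin.
    + apply/measurable_EFinP.
      exact: (measurableT_comp mP (measurable_pair1 z)).
rewrite ge0_integralZl_EFin//.
- by rewrite EFinM lee_wpmul2l// lee_fin.
- by move=> z _; rewrite lee_fin.
- exact/measurable_EFinP.
Qed.

Lemma integral_weighted_le2 (C B : R) (Phi : R * R -> R * R -> R) (g : R * R -> R) :
  (0 <= C)%R ->
  measurable_fun [set: T4] (fun x => Phi x.1 x.2) -> (forall z q, (0 <= Phi z q)%R) ->
  (forall q, \int[mu2]_z (Phi z q)%:E <= C%:E) ->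
  measurable_fun [set: R * R] g -> (forall z, (0 <= g z)%R) ->
  \int[mu2]_z (g z)%:E <= B%:E ->
  \int[mu4]_x (Phi x.1 x.2 * g x.2)%:E <= (C * B)%:E.
Proof.
move=> C0 mP P0 PC mg g0 gB.
have mPs : measurable_fun [set: T4] (fun x => Phi x.2 x.1).
  apply: (measurableT_comp mP (g := fun x : T4 => (x.2, x.1))).
  by apply: measurable_fun_pair; [exact: measurable_snd | exact: measurable_fst].
have mE : measurable_fun [set: T4] (fun x => (Phi x.1 x.2 * g x.2)%:E).
  apply/measurable_EFinP; apply: measurable_funM => //.
  by apply: (measurableT_comp mg); exact: measurable_snd.
have mE' : measurable_fun [set: T4] (fun x => (Phi x.2 x.1 * g x.1)%:E).
  apply/measurable_EFinP; apply: measurable_funM => //.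
  by apply: (measurableT_comp mg); exact: measurable_fst.
apply: le_trans (integral_weighted_le C0 mPs _ PC mg g0 gB) => //.
rewrite tonelli_qz//; first rewrite [leRHS]tonelli_zq//.
  by move=> x; rewrite lee_fin mulr_ge0.
by move=> x; rewrite lee_fin mulr_ge0.
Qed.

End schur.

(** * A bilinear convolution bound from pointwise kernel estimates *)

Section mass.
Context d (T : measurableType d) {R : realType} (m : {measure set T -> \bar R}).

Definition mass_le (f : T -> R) (c : R) : Prop :=
  [/\ measurable_fun setT f, forall x, 0 <= f x &
      (\int[m]_x (f x)%:E <= c%:E)%E].

Lemma mass_leD (f g : T -> R) (c e : R) :
  mass_le f c -> mass_le g e -> mass_le (fun x => f x + g x) (c + e).
Proof.
move=> [mf f0 fc] [mg g0 ge]; split; first exact: measurable_funD.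
  by move=> x; rewrite addr_ge0.
under eq_integral do rewrite EFinD.
rewrite ge0_integralD//; last 4 first.
- by move=> x _; rewrite lee_fin.
- exact/measurable_EFinP.
- by move=> x _; rewrite lee_fin.
- exact/measurable_EFinP.
by rewrite EFinD leeD.
Qed.

Lemma mass_leZ (f : T -> R) (c l : R) : 0 <= l ->
  mass_le f c -> mass_le (fun x => l * f x) (l * c).
Proof.
move=> l0 [mf f0 fc]; split; first exact: measurable_funM.
  by move=> x; rewrite mulr_ge0.
under eq_integral do rewrite EFinM.
rewrite ge0_integralZl_EFin//.
- by rewrite EFinM lee_wpmul2l// lee_fin.
- by move=> x _; rewrite lee_fin.
- exact/measurable_EFinP.
Qed.

Lemma mass_le_dom (f g : T -> R) (c : R) : measurable_fun setT f -> (forall x, 0 <= f x <= g x) ->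
  mass_le g c -> mass_le f c.
Proof.
move=> mf fg [mg g0 gc]; split => //; first by move=> x; case/andP: (fg x).
apply: le_trans gc; apply: ge0_le_integral => //.
- by move=> x _; rewrite lee_fin; case/andP: (fg x).
- exact/measurable_EFinP.
- exact/measurable_EFinP.
- by move=> x _; rewrite lee_fin; case/andP: (fg x).
Qed.

End mass.

Section trilinear.
Context {R : realType}.
Local Notation mu2 := (leb2 R).
Local Open Scope ereal_scope.
Notation T4 := ((R * R) * (R * R))%type.
Let mu4 := (@leb2_sfin R \x @leb2_sfin R).

Lemma integral2_sub (f : R * R -> \bar R) (z : R * R) :
  measurable_fun setT f -> (forall x, 0 <= f x) ->
  \int[mu2]_q f (z - q)%R = \int[mu2]_q f q.
Proof.
move=> mf f0; rewrite -[RHS](integral2_reflect mf f0).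
rewrite -[RHS](integral2_shift (- z)%R) //.
- by apply: eq_integral => q _; congr f; rewrite opprD opprK addrC.
- exact: (measurableT_comp mf measurable_opp2).
Qed.

Lemma integral2_subr (f : R * R -> \bar R) (z : R * R) :
  measurable_fun setT f -> (forall x, 0 <= f x) ->
  \int[mu2]_q f (q - z)%R = \int[mu2]_q f q.
Proof. by move=> mf f0; exact: integral2_shift. Qed.

Section bound.
Variables (C a b : R) (Psi0 Psi1 Psi2 : R * R -> R * R -> R).
Variables (k F G W : R * R -> R).
Hypotheses (C0 : (0 < C)%R) (a0 : (0 < a)%R) (b0 : (0 < b)%R).
Hypotheses (s0 : schur C Psi0) (s1 : schur C Psi1) (s2 : schur C Psi2).
Hypotheses (mk : measurable_fun setT k) (mF : measurable_fun setT F)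
  (mG : measurable_fun setT G) (mW : measurable_fun setT W).
Hypotheses (k0 : forall z, (0 <= k z)%R) (F0 : forall z, (0 <= F z)%R)
  (G0 : forall z, (0 <= G z)%R) (W0 : forall z, (0 <= W z)%R).
Hypothesis kW : forall z q, (k z ^+ 2 <= W q * W (z - q) *
  (Psi0 (- z) q + Psi1 q (z - q) + Psi2 (z - q) q))%R.
Hypothesis Fa : \int[mu2]_z (W z * F z ^+ 2)%:E <= a%:E.
Hypothesis Gb : \int[mu2]_z (W z * G z ^+ 2)%:E <= b%:E.

Let U z := (W z * F z ^+ 2)%R.
Let V z := (W z * G z ^+ 2)%R.
Let mU : measurable_fun setT U.
Proof. by apply: measurable_funM => //; exact: measurable_funX. Qed.
Let mV : measurable_fun setT V.
Proof. by apply: measurable_funM => //; exact: measurable_funX. Qed.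
Let U0 z : (0 <= U z)%R. Proof. by rewrite mulr_ge0// sqr_ge0. Qed.
Let V0 z : (0 <= V z)%R. Proof. by rewrite mulr_ge0// sqr_ge0. Qed.

Let mfst (f : R * R -> R) : measurable_fun setT f ->
  measurable_fun [set: T4] (fun x => f x.1).
Proof. by move=> mf; apply: (measurableT_comp mf); exact: measurable_fst. Qed.
Let msnd (f : R * R -> R) : measurable_fun setT f ->
  measurable_fun [set: T4] (fun x => f x.2).
Proof. by move=> mf; apply: (measurableT_comp mf); exact: measurable_snd. Qed.
Let msub (f : R * R -> R) : measurable_fun setT f ->
  measurable_fun [set: T4] (fun x => f (x.1 - x.2)%R).
Proof. by move=> mf; apply: (measurableT_comp mf); exact: measurable_sub2. Qed.

Let form_kernel z q := (k z * F q * G (z - q))%R.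

Lemma measurable_form_kernel :
  measurable_fun [set: T4] (fun x => form_kernel x.1 x.2).
Proof.
apply: measurable_funM; last exact: msub.
by apply: measurable_funM; [exact: mfst | exact: msnd].
Qed.

Lemma form_kernel_ge0 z q : (0 <= form_kernel z q)%R.
Proof. by rewrite mulr_ge0// mulr_ge0. Qed.

(** Duality against a fixed [h]: each of the six terms produced by
    [two_sum_sqr_le] is the mass of a function on pairs of planar points, and is
    computed by integrating first in the variable that the Schur condition or
    translation invariance controls. *)
Section fixed_h.
Variables (h : R * R -> R) (A : R).
Hypotheses (mh : measurable_fun setT h) (h0 : forall z, (0 <= h z)%R)
  (hA : \int[mu2]_z (h z ^+ 2)%:E <= A%:E).
Let H z := (h z ^+ 2)%R.
Let mH : measurable_fun setT H. Proof. exact: measurable_funX. Qed.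
Let H0 z : (0 <= H z)%R. Proof. exact: sqr_ge0. Qed.

Let massPH : mass_le mu4 (fun x => Psi0 (- x.1)%R x.2 * H x.1)%R (C * A).
Proof.
case: s0 => mP P0 PC; have mP' := measurable_reflect_l mP.
split; first by apply: measurable_funM => //; exact: mfst.
  by move=> x; rewrite mulr_ge0.
by apply: (integral_weighted_le (Phi := fun z q => Psi0 (- z)%R q) (ltW C0)).
Qed.

Let massUV : mass_le mu4 (fun x => U x.2 * V (x.1 - x.2)%R)%R (b * a).
Proof.
split; first by apply: measurable_funM; [exact: msnd | exact: msub].
  by move=> x; rewrite mulr_ge0.
under eq_integral do rewrite mulrC.
apply: (integral_weighted_le2 (Phi := fun z q => V (z - q)%R) (ltW b0)) => //.
- exact: msub.
- move=> q; rewrite (integral2_subr (f := fun p => (V p)%:E))//.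
  exact/measurable_EFinP.
Qed.

Let massHV : mass_le mu4 (fun x => H x.1 * V (x.1 - x.2)%R)%R (b * A).
Proof.
split; first by apply: measurable_funM; [exact: mfst | exact: msub].
  by move=> x; rewrite mulr_ge0.
under eq_integral do rewrite mulrC.
apply: (integral_weighted_le (Phi := fun z q => V (z - q)%R) (ltW b0)) => //.
- exact: msub.
- move=> q; rewrite (integral2_sub (f := fun p => (V p)%:E))//.
  exact/measurable_EFinP.
Qed.

Let massPU : mass_le mu4 (fun x => Psi1 x.2 (x.1 - x.2)%R * U x.2)%R (C * a).
Proof.
case: s1 => mP P0 PC; have mP' := measurable_shear_r mP.
split; first by apply: measurable_funM => //; exact: msnd.
  by move=> x; rewrite mulr_ge0.
apply: (integral_weighted_le2 (Phi := fun z q => Psi1 q (z - q)%R) (ltW C0) mP') => //.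
move=> q; rewrite (integral2_subr (f := fun p => (Psi1 q p)%:E))//.
- apply/measurable_EFinP; exact: (measurableT_comp mP (measurable_pair1 q)).
- by move=> p; rewrite lee_fin.
Qed.

Let massHU : mass_le mu4 (fun x => H x.1 * U x.2)%R (a * A).
Proof.
split; first by apply: measurable_funM; [exact: mfst | exact: msnd].
  by move=> x; rewrite mulr_ge0.
under eq_integral do rewrite mulrC.
apply: (integral_weighted_le (Phi := fun z q => U q) (ltW a0)) => //.
exact: msnd.
Qed.

Let massPV : mass_le mu4
  (fun x => Psi2 (x.1 - x.2)%R x.2 * V (x.1 - x.2)%R)%R (C * b).
Proof.
case: s2 => mP P0 PC; have mP' := measurable_shear_l mP.
have mE : measurable_fun [set: T4]
    (fun x => Psi2 (x.1 - x.2)%R x.2 * V (x.1 - x.2)%R)%R.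
  by apply: measurable_funM => //; exact: msub.
have mE' : measurable_fun [set: T4] (fun x => Psi2 x.1 x.2 * V x.1)%R.
  by apply: measurable_funM => //; exact: mfst.
split => //; first by move=> x; rewrite mulr_ge0.
apply: le_trans (integral_weighted_le (ltW C0) mP P0 PC mV V0 Gb).
rewrite (tonelli_qz (f := fun x => (Psi2 (x.1 - x.2)%R x.2 * V (x.1 - x.2)%R)%:E));
  [|exact/measurable_EFinP|by move=> x; rewrite lee_fin mulr_ge0].
rewrite (tonelli_qz (f := fun x => (Psi2 x.1 x.2 * V x.1)%:E));
  [|exact/measurable_EFinP|by move=> x; rewrite lee_fin mulr_ge0].
rewrite le_eqVlt; apply/orP; left; apply/eqP.
apply: eq_integral => q _ /=.
rewrite (integral2_subr (f := fun p => (Psi2 p q * V p)%:E))//.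
- by apply/measurable_EFinP; exact: (measurableT_comp mE' (measurable_pair2 q)).
- by move=> p; rewrite lee_fin mulr_ge0.
Qed.

Lemma trilinear_bound :
  \int[mu2]_z ((h z)%:E * \int[mu2]_q (form_kernel z q)%:E)
    <= (A / 2 + 9 / 2 * C * a * b)%:E.
Proof.
have [[_ p0 _] [_ p1 _]] := (s0, s1); have [_ p2 _] := s2.
pose X (x : T4) := (h x.1 * form_kernel x.1 x.2)%R.
have mX : measurable_fun setT X.
  by apply: measurable_funM; [exact: mfst | exact: measurable_form_kernel].
have X0 x : (0 <= X x)%R by rewrite mulr_ge0// form_kernel_ge0.
have -> : \int[mu2]_z ((h z)%:E * \int[mu2]_q (form_kernel z q)%:E) =
    \int[mu4]_x (X x)%:E.
  rewrite (tonelli_zq (f := fun x => (X x)%:E));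
    [|exact/measurable_EFinP|by move=> x; rewrite lee_fin].
  apply: eq_integral => z _; rewrite -ge0_integralZl_EFin//.
  - by move=> q _; rewrite lee_fin form_kernel_ge0.
  - apply/measurable_EFinP.
    exact: (measurableT_comp measurable_form_kernel (measurable_pair1 z)).
(* With these weights the terms in H add up to the mass A of h ^+ 2 and the
   other three to 9 * C * a * b, so that A can be absorbed on the left. *)
pose l0 := ((3 * C)^-1)%R; pose l1 := ((3 * b)^-1)%R; pose l2 := ((3 * a)^-1)%R.
have l00 : (0 < l0)%R by rewrite invr_gt0 mulr_gt0.
have l10 : (0 < l1)%R by rewrite invr_gt0 mulr_gt0.
have l20 : (0 < l2)%R by rewrite invr_gt0 mulr_gt0.
have ge (l : R) : (0 < l -> 0 <= l^-1)%R by move=> ?; rewrite invr_ge0 ltW.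
have M := mass_leD (mass_leD
  (mass_leD (mass_leZ (ltW l00) massPH) (mass_leZ (ge _ l00) massUV))
  (mass_leD (mass_leZ (ltW l10) massHV) (mass_leZ (ge _ l10) massPU)))
  (mass_leD (mass_leZ (ltW l20) massHU) (mass_leZ (ge _ l20) massPV)).
have M2 : mass_le mu4 (fun x => 2 * X x)%R (A + 9 * C * a * b)%R.
  rewrite (_ : (A + 9 * C * a * b)%R =
    (l0 * (C * A) + l0^-1 * (b * a) + (l1 * (b * A) + l1^-1 * (C * a)) +
     (l2 * (a * A) + l2^-1 * (C * b)))%R); last first.
    rewrite /l0 /l1 /l2 !invrK; field.
    by rewrite !gt_eqF.
  apply: (mass_le_dom _ _ M).
  - exact: measurable_funM.
  - move=> x; rewrite mulr_ge0//=.
    apply: two_sum_sqr_le => //.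
    rewrite /X /form_kernel /H /U /V !exprMn.
    have := kW x.1 x.2; have := h0 x.1.
    move: (Psi0 _ _) (Psi1 _ _) (Psi2 _ _) => P0 P1 P2 _ kk.
    have := ler_wpM2l (_ : (0 <= h x.1 ^+ 2 * (F x.2 ^+ 2) * (G (x.1 - x.2)%R ^+ 2))%R) kk.
    rewrite mulr_ge0 ?mulr_ge0 ?sqr_ge0// => /(_ isT).
    by move=> hh; apply: le_trans (le_trans _ hh) _;
      rewrite le_eqVlt; apply/orP; left; apply/eqP; ring.
case: (mass_leZ (_ : (0 <= 2^-1)%R) M2) => [|_ _]; first by rewrite invr_ge0.
under eq_integral do rewrite mulrA mulVf ?mul1r ?pnatr_eq0//.
by rewrite mulrDr; congr (_ <= _); congr EFin; field.
Qed.
End fixed_h.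

Let S z := \int[mu2]_q (form_kernel z q)%:E.
Let mS : measurable_fun setT S.
Proof.
apply: (measurable_integral_q (f := fun x => (form_kernel x.1 x.2)%:E)).
- by apply/measurable_EFinP; exact: measurable_form_kernel.
- by move=> x; rewrite lee_fin form_kernel_ge0.
Qed.
Let S0 z : 0 <= S z.
Proof. by apply: integral_ge0 => q _; rewrite lee_fin form_kernel_ge0. Qed.

(** The duality argument is applied with [h] equal to the convolution itself.
    Truncating it in size and in space makes its square integrable, which the
    absorption of [A] requires; monotone convergence removes the truncation. *)
Let h (n : nat) (z : R * R) : R :=
  (fine (mine (S z) n%:R%:E) * \1_(box n) z)%R.

Let mine_ge0 n z : 0 <= mine (S z) n%:R%:E.
Proof. by rewrite le_min S0 lee_fin ler0n. Qed.

Let mine_fin n z : mine (S z) n%:R%:E \is a fin_num.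
Proof. by rewrite ge0_fin_numE// gt_min ltry orbT. Qed.

Let mh n : measurable_fun setT (h n).
Proof.
apply: measurable_funM.
  apply: measurableT_comp; first exact: fine_measurable.
  by apply: measurable_mine.
exact: measurable_indic (measurable_box n).
Qed.

Let hge0 n z : (0 <= h n z)%R.
Proof. by rewrite mulr_ge0// fine_ge0. Qed.

Let h_le n z : (h n z)%:E <= S z.
Proof.
rewrite /h EFinM fineK//; apply: (@le_trans _ _ (mine (S z) n%:R%:E)).
  by rewrite indicE; case: (_ \in _); rewrite ?mulr1n ?mulr0n ?mule1 ?mule0.
by rewrite ge_min lexx.
Qed.

Let h_sqr_le n z : (h n z ^+ 2 <= n%:R ^+ 2 * \1_(box n) z)%R.
Proof.
rewrite /h indicE; case: (_ \in _); rewrite ?mulr1 ?mulr0 ?expr0n//=.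
rewrite ler_sqr ?nnegrE ?fine_ge0//.
by rewrite -lee_fin fineK// ge_min lexx orbT.
Qed.

Let h_mass n : \int[mu2]_z (h n z ^+ 2)%:E <= (9 * C * a * b)%:E.
Proof.
have fin : \int[mu2]_z (h n z ^+ 2)%:E \is a fin_num.
  rewrite ge0_fin_numE; last by apply: integral_ge0 => z _; rewrite lee_fin sqr_ge0.
  apply: (@le_lt_trans _ _ (\int[mu2]_z ((n%:R ^+ 2)%:E * (\1_(box n) z)%:E))).
    apply: ge0_le_integral => //.
    - by move=> z _; rewrite lee_fin sqr_ge0.
    - by apply/measurable_EFinP; apply: measurable_funX; exact: mh.
    - apply/measurable_EFinP; apply: measurable_funM => //.
      exact: measurable_indic (measurable_box n).
    - by move=> z _; rewrite lee_fin.
  rewrite ge0_integralZl_EFin//.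
  - rewrite integral_indic//; last exact: measurable_box.
    by rewrite setIT lte_mul_pinfty// ?lee_fin ?sqr_ge0// leb2_box_fin.
  - apply/measurable_EFinP; exact: measurable_indic (measurable_box n).
have le1 : \int[mu2]_z (h n z ^+ 2)%:E <= \int[mu2]_z ((h n z)%:E * S z).
  apply: ge0_le_integral => //.
  - by move=> z _; rewrite lee_fin sqr_ge0.
  - by apply/measurable_EFinP; apply: measurable_funX; exact: mh.
  - by apply: emeasurable_funM => //; apply/measurable_EFinP; exact: mh.
  - by move=> z _; rewrite expr2 EFinM; apply: lee_wpmul2l; rewrite ?lee_fin.
have [A AE] : exists A : R, \int[mu2]_z (h n z ^+ 2)%:E = A%:E.
  by exists (fine (\int[mu2]_z (h n z ^+ 2)%:E)); rewrite fineK.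
have := trilinear_bound (mh n) (hge0 n) (_ : \int[mu2]_z (h n z ^+ 2)%:E <= A%:E).
rewrite AE => /(_ (lexx _)) le2; rewrite AE in le1.
have := le_trans le1 le2; rewrite !lee_fin; lra.
Qed.

Let h_cvg z : (h n z ^+ 2)%:E @[n --> \oo] --> S z ^+ 2.
Proof.
have inbox : \forall n \near \oo, h n z = fine (mine (S z) n%:R%:E).
  have : (\bigcup_n box n) z by rewrite bigcup_box.
  move=> [l _ [/=]]; rewrite !in_itv/= => lz1 lz2.
  near=> n; rewrite /h indicE mem_set ?mulr1//.
  have kn : (l%:R <= n%:R :> R)%R by rewrite ler_nat; near: n; exact: nbhs_infty_ge.
  by split => /=; rewrite in_itv/=; lra.
case E : (S z) (S0 z) => [r| |] // r0.
- apply: cvg_near_cst; near=> n.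
  have -> : h n z = r; last by rewrite expe2 -EFinM -expr2.
  rewrite (near inbox n)// E /mine lte_fin.
  case: ltP => //= nr.
  have : (r < n%:R)%R; last by rewrite ltNge nr.
  by near: n; exact: nbhs_infty_gtr.
- rewrite expe2 mulyy; apply/cvgeyPge => M.
  near=> n; rewrite (near inbox n)// E min_r ?leey//= lee_fin.
  have Mn : (M <= n%:R)%R by near: n; exact: nbhs_infty_ger.
  have n1 : (1 <= n%:R :> R)%R by near: n; exact: nbhs_infty_ger.
  by nra.
Unshelve. all: by end_near. Qed.

(** The left-hand side is the limit of the masses of the truncations
    [h n ^+ 2], and [trilinear_bound] bounds each of these masses by half of
    itself plus half of the right-hand side.  The three kernels correspond to the
    choice of the frequency held fixed. *)
Lemma bilinear_bound :
  \int[mu2]_z (\int[mu2]_q (form_kernel z q)%:E) ^+ 2 <= (9 * C * a * b)%:E.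
Proof.
have nd z : nondecreasing_seq (fun n => (h n z ^+ 2)%:E).
  apply/nondecreasing_seqP => n; rewrite lee_fin ler_sqr ?nnegrE//.
  rewrite /h ler_pM// ?fine_ge0//.
    rewrite fine_le// le_min !ge_min lexx/=; apply/orP; right.
    by rewrite lee_fin ler_nat.
  rewrite !indicE; case: (boolP (z \in box n)) => [|_]; last by rewrite ler0n.
  rewrite inE => -[/= z1 z2].
  rewrite mem_set// /box; split => /=; move: z1 z2; rewrite !in_itv/= -natr1; lra.
rewrite (_ : \int[mu2]_z _ = \int[mu2]_z (limn (fun n => (h n z ^+ 2)%:E))); last first.
  by apply: eq_integral => z _; apply/esym/cvg_lim => //; exact: h_cvg.
have mh2 n : measurable_fun setT (fun z => (h n z ^+ 2)%:E).
  by apply/measurable_EFinP; apply: measurable_funX; exact: mh.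
have h20 n z : 0 <= (h n z ^+ 2)%:E by rewrite lee_fin sqr_ge0.
rewrite monotone_convergence//.
apply: lime_le; last by near=> n; exact: h_mass.
apply: ereal_nondecreasing_is_cvgn; apply/nondecreasing_seqP => n.
apply: ge0_le_integral => //; first exact: mh2.
  exact: mh2.
by move=> z _; exact: nd.
Unshelve. all: by end_near. Qed.

End bound.
End trilinear.

(** * One-dimensional integrals *)

Section one_dim.
Context {R : realType}.
Local Notation mu := (@lebesgue_measure R).

Lemma integral_itv_primitive (f F : R -> R) (a b : R) : a < b ->
  continuous f -> (forall x, a <= x <= b -> is_derive x (1 : R) F (f x)) ->
  (\int[mu]_(x in `[a, b]) (f x)%:E = (F b - F a)%:E)%E.
Proof.
move=> ab cf dF.
have cF x : a <= x <= b -> {for x, continuous F}.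
  move=> xab; apply/differentiable_continuous/derivable1_diffP.
  by have [] := dF _ xab.
rewrite (@continuous_FTC2 _ f F) ?EFinB//.
- exact: continuous_subspaceT.
- split.
  + move=> x; rewrite in_itv/= => /andP[ax xb].
    have xab : a <= x <= b by rewrite !ltW.
    by have [] := dF x xab.
  + apply: cvg_at_right_filter; apply: cF; rewrite lexx ltW//.
  + apply: cvg_at_left_filter; apply: cF; rewrite lexx ltW//.
- move=> x; rewrite in_itv/= => /andP[ax xb].
  rewrite derive1E; have xab : a <= x <= b by rewrite !ltW.
  by have [_ ->] := dF x xab.
Qed.

Lemma integralR_le_split (f : R -> R) (c K : R) :
  measurable_fun setT f -> (forall x, 0 <= f x) ->
  (forall n : R, 0 < n -> (\int[mu]_(x in `[(c - n)%R, c]) (f x)%:E <= K%:E)%E) ->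
  (forall n : R, 0 < n -> (\int[mu]_(x in `[c, (c + n)%R]) (f x)%:E <= K%:E)%E) ->
  (\int[mu]_x (f x)%:E <= (2 * K)%:E)%E.
Proof.
move=> mf f0 hl hr.
pose D (n : nat) : set (measurableTypeR R) := `[c - n.+1%:R, c + n.+1%:R]%classic.
have mE : measurable_fun setT (fun x => (f x)%:E) by exact/measurable_EFinP.
have DT : \bigcup_n D n = setT.
  rewrite -subTset => x _; exists (Num.truncn `|x - c|) => //.
  have : `|x - c| < (Num.truncn `|x - c|).+1%:R by exact: Num.Theory.truncnS_gt.
  rewrite /D /= in_itv/= ltr_norml => /andP[]; lra.
have nd : nondecreasing_seq D.
  apply/nondecreasing_seqP => n; rewrite subsetEset => x; rewrite /D /= !in_itv/=.
  move/andP=> []; rewrite -[n.+2%:R]natr1; lra.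
have cv : (\int[mu]_(x in D i) (f x)%:E @[i --> \oo] -->
    \int[mu]_(x in \bigcup_i D i) (f x)%:E)%E.
  apply: ge0_nondecreasing_set_cvg_integral => //.
  - by move=> n; exact: measurable_itv.
  - by move=> n; exact: measurable_funTS.
  - by move=> n x _; rewrite lee_fin.
rewrite -DT; apply: (cvge_to_le cv).
near=> n; have n0 : 0 < n.+1%:R :> R by [].
have -> : D n = `[c - n.+1%:R, c] `|` `]c, c + n.+1%:R].
  apply/seteqP; split => x; rewrite /D /= !in_itv/=.
    move=> /andP[h1 h2]; case: (leP x c) => h3; [left|right]; lra.
  by case => /andP[h1 h2]; lra.
rewrite ge0_integral_setU//=.
- rewrite mulrDl mul1r EFinD; apply: leeD; first exact: hl.
  apply: le_trans (hr _ n0); apply: ge0_subset_integral => //.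
  + exact: measurable_funTS.
  + by move=> x _; rewrite lee_fin.
  + by move=> x /=; rewrite !in_itv/= => /andP[/ltW -> ->].
- exact: measurable_funTS.
- by move=> x _; rewrite lee_fin.
- apply/disj_set2P; rewrite -subset0 => x [] /=; rewrite !in_itv/= => /andP[_ h2] /andP[h3 _]; move: h3; rewrite ltNge h2.
Unshelve. all: by end_near. Qed.

Lemma integralR_even_le (f g F : R -> R) (K : R) :
  continuous f -> (forall x, 0 <= f x) -> (forall x, f (- x) = f x) ->
  continuous g -> (forall x, 0 <= x -> f x = g x) ->
  (forall x : R, 0 <= x -> is_derive x (1 : R) F (g x)) ->
  (forall x, 0 <= x -> F x - F 0 <= K) ->
  (\int[mu]_x (f x)%:E <= (2 * K)%:E)%E.
Proof.
move=> cf f0 fe cg fg dF FK.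
have half n : 0 < n -> (\int[mu]_(x in `[0%R, n]) (f x)%:E <= K%:E)%E.
  move=> n0.
  have -> : (\int[mu]_(x in `[0%R, n]) (f x)%:E =
      \int[mu]_(x in `[0%R, n]) (g x)%:E)%E.
    by apply: eq_integral => x; rewrite inE/= in_itv/= => /andP[x0 _]; rewrite fg.
  have dF' x : 0 <= x <= n -> is_derive x (1 : R) F (g x).
    by move=> /andP[x0 _]; exact: dF.
  by rewrite (integral_itv_primitive n0 cg dF') lee_fin FK// ltW.
apply: (@integralR_le_split f 0).
- exact: continuous_measurable_fun.
- by [].
- move=> n n0; rewrite sub0r.
  have := @integration_by_substitution_oppr _ f 0 n (ltW n0).
  rewrite oppr0 => ->; last exact: continuous_subspaceT.
  rewrite (_ : (\int[mu]_(x in _) _ = \int[mu]_(x in `[0%R, n]) (f x)%:E)%E).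
    exact: half.
  by apply: eq_integral => x _ /=; rewrite fe.
- by move=> n n0; rewrite add0r; exact: half.
Qed.

Lemma continuous_powR_gt0 (f : R -> R) (p : R) :
  continuous f -> (forall x, 0 < f x) -> continuous (fun x => f x `^ p).
Proof.
move=> cf f0 x.
apply: (@continuous_comp _ _ _ f (fun y => y `^ p)); first exact: cf.
apply/differentiable_continuous/derivable1_diffP.
by apply: derivable_powR; rewrite in_itv/= f0.
Qed.

(** The bracket in terms of which all the weights are written. *)
Definition br (x : R) : R := 1 + `|x|.

Lemma br_ge1 x : 1 <= br x. Proof. by rewrite lerDl. Qed.
Lemma br_gt0 x : 0 < br x. Proof. exact: lt_le_trans (br_ge1 x). Qed.
Lemma brN x : br (- x) = br x. Proof. by rewrite /br normrN. Qed.

Lemma continuous_br : continuous br.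
Proof.
move=> x; apply: cvgD; first exact: cvg_cst.
exact: norm_continuous.
Qed.

(** The standard integrable profile; its integral blows up as [e] tends to 0,
    which is why the estimates need room in the exponents. *)
Definition gam (e x : R) : R := br x `^ (-1 - e).

Lemma continuous_gam e : continuous (gam e).
Proof. by apply: continuous_powR_gt0; [exact: continuous_br|exact: br_gt0]. Qed.

Lemma gam_ge0 e x : 0 <= gam e x. Proof. exact: powR_ge0. Qed.
Lemma gamN e x : gam e (- x) = gam e x. Proof. by rewrite /gam brN. Qed.

Lemma integral_gam_le e : 0 < e -> (\int[mu]_x (gam e x)%:E <= (2 * e^-1)%:E)%E.
Proof.
move=> e0.
apply: (@integralR_even_le _ (gam e) (fun x => - e^-1 * (1 + x) `^ (- e))).
- exact: continuous_gam.
- exact: gam_ge0.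
- exact: gamN.
- exact: continuous_gam.
- by [].
- move=> x x0.
  have d1 : is_derive x (1:R) (fun y : R => 1 + y) 1.
    apply: (is_derive_eq (is_deriveD (is_derive_cst (1 : R) x (1 : R))
      (is_derive_id x (1 : R)))).
    exact: add0r.
  have d2 : is_derive (1 + x) (1:R) (fun y : R => y `^ (- e))
     (- e * (1 + x) `^ (- e - 1)).
    by apply: is_derive1_powR; lra.
  have d3 := @is_derive1_comp _ _ _ _ _ _ d2 d1.
  have d4 := is_deriveZ (- e^-1) d3.
  apply: is_derive_eq.
  rewrite /gam /br ger0_norm// mulr1 [_ *: _]mulrA mulrNN mulVf ?gt_eqF// mul1r.
  by congr (_ `^ _); ring.
- move=> x x0; rewrite addr0 powR1 mulNr mulr1 opprK.
  have e1 : 0 <= e^-1 by rewrite invr_ge0 ltW.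
  have := mulr_ge0 e1 (powR_ge0 (1 + x) (- e)); lra.
Qed.

(** Change of variables [y = mu' x] when the derivative keeps a constant sign on
    each side of [c]: [mu'] is monotone there, and each half-line contributes at
    most the mass of [g]. *)
Lemma integral_change_le (g mu' f : R -> R) (c K : R) :
  continuous g -> (forall x, 0 <= g x) -> (\int[mu]_x (g x)%:E <= K%:E)%E ->
  continuous f -> (forall x : R, is_derive x (1 : R) mu' (f x)) ->
  (forall x y, c <= x -> c <= y -> 0 <= f x * f y) ->
  (forall x y, x <= c -> y <= c -> 0 <= f x * f y) ->
  (\int[mu]_x (`|f x| * g (mu' x))%:E <= (2 * K)%:E)%E.
Proof.
move=> cg g0 gK cf dmu sr sl.
have ig : mu.-integrable setT (EFin \o g).
  apply/integrableP; split.
    by apply/measurable_EFinP; exact: continuous_measurable_fun.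
  under eq_integral do rewrite /= ger0_norm//.
  by apply: le_lt_trans gK _; rewrite ltry.
pose G (x : R) := (\int[mu]_(t in `]-oo, x]) (g t))%R.
have dG (x : R) : is_derive x (1:R) G (g x).
  have ig' : mu.-integrable `]-oo, x + 1] (EFin \o g).
    by apply: (integrableS _ _ _ ig).
  have [] := @continuous_FTC1 _ g (BInfty _ true) x (x + 1) _ ig' _ _.
  - by rewrite ltrDl.
  - by rewrite ltNyr.
  - exact: cg.
  - by move=> d1 d2; split; [exact: d1|rewrite -derive1E; exact: d2].
have G0 x : 0 <= G x by apply: Rintegral_ge0.
have GK x : G x <= K.
  rewrite -lee_fin /G /Rintegral fineK.
    apply: le_trans gK; apply: ge0_subset_integral => //.
    - by apply/measurable_EFinP; exact: continuous_measurable_fun.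
    - by move=> y _; rewrite lee_fin.
  apply: integrable_fin_num => //.
  by apply: (integrableS _ _ _ ig).
have cmu : continuous mu'.
  move=> x; apply/differentiable_continuous/derivable1_diffP.
  by have [] := dmu x.
have ch : continuous (fun x => `|f x| * g (mu' x)).
  move=> x; apply: cvgM.
    by apply: (continuous_comp (cf x)); exact: norm_continuous.
  by apply: (continuous_comp (cmu x)); exact: cg.
have piece a b : a < b -> (forall x y, a <= x <= b -> a <= y <= b -> 0 <= f x * f y) ->
    (\int[mu]_(x in `[a, b]) (`|f x| * g (mu' x))%:E <= K%:E)%E.
  move=> ab s.
  (* A sign s' with |f| = s' * f on the whole interval, so that s' * G (mu' x)
     is a primitive. *)
  have [s' s'1 sE] : exists2 s' : R, `|s'| = 1 &
      forall x, a <= x <= b -> `|f x| = s' * f x.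
    have [[x [xab fx]]|nx] := pselect (exists x, a <= x <= b /\ f x != 0).
      exists (Num.sg (f x)); first by rewrite normr_sg fx.
      move=> y yab; have := s _ _ xab yab.
      have := fx; rewrite neq_lt => /orP[fx0|fx0].
        by rewrite ltr0_sg// mulN1r nmulr_rge0// => /ler0_norm.
      by rewrite gtr0_sg// mul1r pmulr_rge0// => /ger0_norm.
    exists 1; first by rewrite normr1.
    move=> x xab; have [->|fx] := eqVneq (f x) 0; first by rewrite normr0 mulr0.
    by exfalso; apply: nx; exists x.
  have -> : (\int[mu]_(x in `[a, b]) (`|f x| * g (mu' x))%:E =
      \int[mu]_(x in `[a, b]) (s' * (f x * g (mu' x)))%:E)%E.
    apply: eq_integral => x; rewrite inE/= in_itv/= => xab.
    by rewrite sE// mulrA.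
  have cq : continuous (fun x => s' * (f x * g (mu' x))).
    move=> x; apply: cvgM; first exact: cvg_cst.
    apply: cvgM; first exact: cf.
    by apply: (continuous_comp (cmu x)); exact: cg.
  have dq x : a <= x <= b ->
      is_derive x (1 : R) (fun x => s' * G (mu' x)) (s' * (f x * g (mu' x))).
    move=> _; have d1 := @is_derive1_comp _ _ _ _ _ _ (dG (mu' x)) (dmu x).
    have d2 := is_deriveZ s' d1.
    by apply: is_derive_eq; rewrite [_ *: _]mulrA mulrA mulrAC.
  rewrite (integral_itv_primitive ab cq dq) lee_fin -mulrBr.
  apply: le_trans (ler_norm _) _; rewrite normrM s'1 mul1r ler_norml.
  have := G0 (mu' a); have := G0 (mu' b); have := GK (mu' a); have := GK (mu' b).
  lra.
apply: (@integralR_le_split _ c).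
- exact: continuous_measurable_fun.
- by move=> x; rewrite mulr_ge0.
- move=> n n0; apply: piece; first by rewrite ltrBlDr ltrDl.
  by move=> x y /andP[_ xc] /andP[_ yc]; exact: sl.
- move=> n n0; apply: piece; first by rewrite ltrDl.
  by move=> x y /andP[xc _] /andP[yc _]; exact: sr.
Qed.

(** A profile of bounded mass that is comparable with
    [L `^ (- p) * br x `^ (p - 1)] for [br x <= L] and decays faster beyond.  The
    extra factor makes it the derivative of
    [x |-> (1 + L `^ (- p) * br x `^ p)^-1], up to a constant, so its mass does
    not depend on [L]. *)
Definition plateau (p L x : R) : R :=
  L `^ (- p) * br x `^ (p - 1) * (1 + L `^ (- p) * br x `^ p) ^- 2.

Lemma plateau_den_gt0 p L x : 0 < 1 + L `^ (- p) * br x `^ p.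
Proof. by rewrite ltr_wpDr// mulr_ge0// powR_ge0. Qed.

Lemma plateau_ge0 p L x : 0 <= plateau p L x.
Proof.
rewrite /plateau !mulr_ge0 ?powR_ge0// invr_ge0 sqr_ge0//.
Qed.

Lemma continuous_plateau p L : continuous (plateau p L).
Proof.
have cb q : continuous (fun x => br x `^ q).
  by apply: continuous_powR_gt0; [exact: continuous_br|exact: br_gt0].
move=> x; apply: cvgM.
  by apply: cvgM; [exact: cvg_cst|exact: cb].
apply: cvgV; first by rewrite expf_neq0// gt_eqF// plateau_den_gt0.
apply: (@continuous_comp _ _ _ (fun x => 1 + L `^ (- p) * br x `^ p) (fun y => y ^+ 2)).
  by apply: cvgD; [exact: cvg_cst|apply: cvgM; [exact: cvg_cst|exact: cb]].
exact: exprn_continuous.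
Qed.

Lemma integral_plateau_le p L : 0 < p ->
  (\int[mu]_x (plateau p L x)%:E <= (2 * p^-1)%:E)%E.
Proof.
move=> p0.
apply: (@integralR_even_le _ (plateau p L)
  (fun x => - p^-1 * (1 + L `^ (- p) * (1 + x) `^ p)^-1)).
- exact: continuous_plateau.
- exact: plateau_ge0.
- by move=> x; rewrite /plateau brN.
- exact: continuous_plateau.
- by [].
- move=> x x0.
  have d1 : is_derive x (1:R) (fun y : R => 1 + y) 1.
    apply: (is_derive_eq (is_deriveD (is_derive_cst (1 : R) x (1 : R))
      (is_derive_id x (1 : R)))).
    exact: add0r.
  have d2 : is_derive (1 + x) (1:R) (fun y : R => y `^ p) (p * (1 + x) `^ (p - 1)).
    by apply: is_derive1_powR; lra.
  have d3 : is_derive x (1 : R) (fun x => 1 + L `^ (- p) * (1 + x) `^ p) _ :=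
    is_deriveD (is_derive_cst (1 : R) x (1 : R))
    (is_deriveZ (L `^ (- p)) (@is_derive1_comp _ _ _ _ _ _ d2 d1)).
  have nz : 1 + L `^ (- p) * (1 + x) `^ p != 0.
    by rewrite gt_eqF// ltr_wpDr// mulr_ge0// powR_ge0.
  have d4 := is_deriveZ (- p^-1) (@is_deriveV _
    (fun x => 1 + L `^ (- p) * (1 + x) `^ p) _ _ _ nz d3).
  apply: (is_derive_eq d4).
  rewrite /plateau /br (ger0_norm x0).
  rewrite -![_ *: _]/(_ * _) add0r mulr1.
  rewrite !mulNr mulrN opprK -exprVn; field.
  by rewrite nz gt_eqF.
- move=> x x0; have i0 y : 0 <= (1 + L `^ (- p) * (1 + y) `^ p)^-1 <= 1.
    rewrite invr_ge0 ?invf_le1 ?ltr_wpDr ?mulr_ge0 ?powR_ge0// lerDl.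
    by rewrite mulr_ge0 ?powR_ge0// addr_ge0// mulr_ge0 ?powR_ge0.
  have /andP[h1 _] := i0 x; have /andP[_ h2] := i0 0.
  have p1 : 0 <= p^-1 by rewrite invr_ge0 ltW.
  have := mulr_ge0 p1 h1; have := ler_wpM2l p1 h2; lra.
Qed.

(** An affine change of variables, written with [A] outside so that the bound
    does not depend on the scale. *)
Lemma integral_rescale_le (g : R -> R) (K A a b : R) :
  continuous g -> (forall x, 0 <= g x) -> (\int[mu]_x (g x)%:E <= K%:E)%E ->
  0 < A -> 1 <= `|a| ->
  (\int[mu]_x (A * g (A * (a * x + b)))%:E <= (2 * K)%:E)%E.
Proof.
move=> cg g0 gK A0 a1.
have d (x : R) : is_derive x (1 : R) (fun x => A * (a * x + b)) (A * a).
  have d1 := is_deriveZ A (is_deriveD (is_deriveZ a (is_derive_id x (1 : R)))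
    (is_derive_cst b x (1 : R))).
  by apply: (is_derive_eq d1); rewrite -![_ *: _]/(_ * _) mulr1 addr0.
have cm : continuous (fun x : R => A * (a * x + b)).
  move=> x; apply/differentiable_continuous/derivable1_diffP; by have [] := d x.
have cc : continuous (fun _ : R => A * a) by move=> x; exact: cvg_cst.
have := @integral_change_le g _ (fun _ => A * a) 0 K cg g0 gK cc d.
move=> /(_ (fun _ _ _ _ => sqr_ge0 (A * a)) (fun _ _ _ _ => sqr_ge0 (A * a))).
apply: le_trans; apply: ge0_le_integral => //.
- by move=> x _; rewrite lee_fin mulr_ge0// ltW.
- apply/measurable_EFinP; apply: continuous_measurable_fun => x.
  apply: cvgM; first exact: cvg_cst.
  by apply: (continuous_comp (cm x)); exact: cg.
- apply/measurable_EFinP; apply: continuous_measurable_fun => x.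
  apply: cvgM; first exact: cvg_cst.
  by apply: (continuous_comp (cm x)); exact: cg.
- move=> x _; rewrite lee_fin ler_wpM2r// normrM (gtr0_norm A0).
  by rewrite ler_peMr// ltW.
Qed.

End one_dim.

(** * Kernels satisfying the Schur condition *)

Ltac meas := repeat match goal with
  | |- measurable_fun _ (fun x => _ + _) => apply: measurable_funD
  | |- measurable_fun _ (fun x => _ * _) => apply: measurable_funM
  | |- measurable_fun _ (fun x => - _) => apply: measurable_funN
  | |- measurable_fun _ (fun x => _ ^+ _) => apply: measurable_funX
  | |- measurable_fun _ (fun x => gam _ _) =>
      apply: (measurableT_comp (continuous_measurable_fun (@continuous_gam _ _)))
  | |- measurable_fun _ (fun x => br _) =>
      apply: (measurableT_comp (continuous_measurable_fun (@continuous_br _)))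
  | |- measurable_fun _ (fun x => powR _ _) =>
      apply: (measurableT_comp (measurable_powR _))
  | |- measurable_fun _ (fun x => `|_|) =>
      apply: (measurableT_comp (@normr_measurable _ setT))
  | |- measurable_fun _ (fun x => x.1.1) =>
      apply: (measurableT_comp measurable_fst measurable_fst)
  | |- measurable_fun _ (fun x => x.1.2) =>
      apply: (measurableT_comp measurable_snd measurable_fst)
  | |- measurable_fun _ (fun x => x.2.1) =>
      apply: (measurableT_comp measurable_fst measurable_snd)
  | |- measurable_fun _ (fun x => x.2.2) =>
      apply: (measurableT_comp measurable_snd measurable_snd)
  | |- measurable_fun _ (fun x => x) => exact: measurable_id
  | |- measurable_fun _ (fun x => x.1) => exact: measurable_fst
  | |- measurable_fun _ (fun x => x.2) => exact: measurable_snd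
  | |- measurable_fun _ (fun x => _) => exact: measurable_cst
  end.

Section kernels.
Context {R : realType}.
Local Notation mu := (@lebesgue_measure R).
Local Notation mu2 := (leb2 R).
Notation T4 := ((R * R) * (R * R))%type.

(** The distance, in the time frequency, from the point to the dispersion
    curve. *)
Definition md (m : nat) (q : R * R) : R := q.2 - q.1 ^+ m.

Lemma schurD (C D : R) (P Q : R * R -> R * R -> R) :
  schur C P -> schur D Q -> schur (C + D) (fun a p => P a p + Q a p).
Proof.
move=> [mP P0 PC] [mQ Q0 QD]; split.
- exact: measurable_funD.
- by move=> a p; rewrite addr_ge0.
- move=> a.
  have mP' : mass_le mu2 (P a) C.
    by split => //; exact: (measurableT_comp mP (measurable_pair1 a)).
  have mQ' : mass_le mu2 (Q a) D.
    by split => //; exact: (measurableT_comp mQ (measurable_pair1 a)).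
  by have [] := mass_leD mP' mQ'.
Qed.

Lemma schurZ (C l : R) (P : R * R -> R * R -> R) : 0 <= l ->
  schur C P -> schur (l * C) (fun a p => l * P a p).
Proof.
move=> l0 [mP P0 PC]; split.
- exact: measurable_funM.
- by move=> a p; rewrite mulr_ge0.
- move=> a.
  have mP' : mass_le mu2 (P a) C.
    by split => //; exact: (measurableT_comp mP (measurable_pair1 a)).
  by have [] := mass_leZ l0 mP'.
Qed.

(** Three frequencies [a], [p] and [o = - (a + p)] have sum zero; with [a] fixed
    the two others play the same role. *)
Lemma schur_mirror (C : R) (P : R * R -> R * R -> R) :
  schur C P -> schur C (fun a p => P a (- (a + p))).
Proof.
move=> [mP P0 PC]; split => //.
- apply: (measurableT_comp mP (g := fun x : T4 => (x.1, - (x.1 + x.2)))).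
  apply: measurable_fun_pair; first exact: measurable_fst.
  rewrite (_ : (fun _ => _) = (fun x : T4 => - x.1 - x.2)); last first.
    by apply/funext => x; rewrite opprD.
  apply: (measurableT_comp (@measurable_sub2 R) (g := fun x : T4 => (- x.1, x.2))).
  apply: measurable_fun_pair; last exact: measurable_snd.
  by apply: (measurableT_comp (@measurable_opp2 R)); exact: measurable_fst.
- move=> a; under eq_integral do rewrite opprD.
  rewrite (integral2_sub (f := fun p => (P a p)%:E))//.
  + by apply/measurable_EFinP; exact: (measurableT_comp mP (measurable_pair1 a)).
  + by move=> p; rewrite lee_fin.
Qed.

(** The change of variables [(x, y) |-> (x, y - x ^+ m)] preserves the measure,
    so a kernel that is a profile in the frequency times a profile in the
    modulation has the product of the masses. *)
Lemma schur_prod (m : nat) (r g : R * R -> R -> R) (C1 C2 : R) :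
  0 <= C2 ->
  measurable_fun [set: T4] (fun x => r x.1 x.2.1) ->
  measurable_fun [set: T4] (fun x => g x.1 (md m x.2)) ->
  (forall a, continuous (r a)) -> (forall a, continuous (g a)) ->
  (forall a x, 0 <= r a x) -> (forall a x, 0 <= g a x) ->
  (forall a, \int[mu]_x (r a x)%:E <= C1%:E)%E ->
  (forall a, \int[mu]_x (g a x)%:E <= C2%:E)%E ->
  schur (C1 * C2) (fun a p => r a p.1 * g a (md m p)).
Proof.
move=> C20 mr mg cr cg r0 g0 rC gC.
have mP : measurable_fun [set: T4] (fun x => r x.1 x.2.1 * g x.1 (md m x.2)).
  exact: measurable_funM.
split => //; first by move=> a p; rewrite mulr_ge0.
move=> a.
have mra := continuous_measurable_fun (cr a).
have mga := continuous_measurable_fun (cg a).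
have mPa : measurable_fun [set: R * R] (fun p => (r a p.1 * g a (md m p))%:E).
  apply/measurable_EFinP.
  exact: (measurableT_comp mP (measurable_pair1 a)).
have P0 (p : R * R) : (0 <= (r a p.1 * g a (md m p))%:E)%E by rewrite lee_fin mulr_ge0.
rewrite (@fubini_tonelli1 _ _ _ _ _ mu mu _ mPa P0).
apply: (@le_trans _ _ (\int[mu]_x (C2%:E * (r a x)%:E))%E); last first.
  rewrite ge0_integralZl_EFin//.
  - by rewrite mulrC EFinM lee_wpmul2l// lee_fin.
  - by move=> x _; rewrite lee_fin.
  - exact/measurable_EFinP.
apply: ge0_le_integral => //.
- by move=> x _; apply: integral_ge0 => y _; exact: P0.
- exact: (measurable_fun_fubini_tonelli_F (m2 := mu) _ mPa).
- by apply/measurable_EFinP; apply: measurable_funM.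
- move=> x _; rewrite /fubini_F/=.
  under eq_integral do rewrite EFinM.
  rewrite ge0_integralZl_EFin//; last 2 first.
  + by move=> y _; rewrite lee_fin.
  + apply/measurable_EFinP; apply: (measurableT_comp mga).
    rewrite /md/=; apply: measurable_funD; first exact: measurable_id.
    exact: measurable_cst.
  rewrite muleC lee_wpmul2r ?lee_fin//.
  rewrite /md/= (integral_shift (f := fun y => (g a y)%:E))//.
    exact/measurable_EFinP.
  by move=> y; rewrite lee_fin.
Qed.

Lemma is_derive_powS (n : nat) (b x : R) :
  is_derive x (1 : R) (fun x => (b + x) ^+ n.+1) (n.+1%:R * (b + x) ^+ n).
Proof.
have := is_deriveX n.+1
  (is_deriveD (is_derive_cst b x (1 : R)) (is_derive_id x (1 : R))).
rewrite exprfctE => d; apply: (is_derive_eq d).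
by rewrite -![_ *: _]/(_ * _) add0r mulr1.
Qed.

Lemma continuous_of_is_derive (f df : R -> R) :
  (forall x : R, is_derive x (1 : R) f (df x)) -> continuous f.
Proof.
move=> d x; apply/differentiable_continuous/derivable1_diffP; by have [] := d x.
Qed.

Lemma continuous_powD (n : nat) (b : R) : continuous (fun x : R => (b + x) ^+ n).
Proof.
move=> x; apply: (@continuous_comp _ _ _ (fun x => b + x) (fun y => y ^+ n)).
  by apply: cvgD; [exact: cvg_cst|exact: cvg_id].
exact: exprn_continuous.
Qed.

(** The two factors [gam] are profiles in the sum of the modulations of the
    free frequencies [p] and [o], and in the modulation of [p].  For a fixed
    modulation of [p] the first argument is a function of [p.1] whose derivative is, up to a
    constant, the difference of powers in front: that difference is the
    smoothing gained from dispersion. *)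
Definition kder (e : R) (J : nat) (a p : R * R) : R :=
  `|p.1 ^+ (2 * J) - (a.1 + p.1) ^+ (2 * J)| *
  gam e (a.2 + p.1 ^+ (2 * J).+1 - (a.1 + p.1) ^+ (2 * J).+1) *
  gam e (md (2 * J).+1 p).

Lemma schur_kder e J : 0 < e -> schur (4 * e^-1 * (2 * e^-1)) (kder e J).
Proof.
move=> e0; have e1 : 0 <= e^-1 by rewrite invr_ge0 ltW.
pose r (a : R * R) (x : R) := `|x ^+ (2 * J) - (a.1 + x) ^+ (2 * J)| *
  gam e (a.2 + x ^+ (2 * J).+1 - (a.1 + x) ^+ (2 * J).+1).
have cr1 (a : R * R) : continuous (fun x : R => x ^+ (2 * J) - (a.1 + x) ^+ (2 * J)).
  by move=> x; apply: cvgB; [exact: exprn_continuous|exact: continuous_powD].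
have dmu (a : R * R) (x : R) : is_derive x (1 : R)
    (fun x => a.2 + x ^+ (2 * J).+1 - (a.1 + x) ^+ (2 * J).+1)
    ((2 * J).+1%:R * (x ^+ (2 * J) - (a.1 + x) ^+ (2 * J))).
  have d0 := @is_derive_powS (2 * J) 0 x.
  have d1 : is_derive x (1 : R) (fun x : R => x ^+ (2 * J).+1)
      ((2 * J).+1%:R * x ^+ (2 * J)).
    rewrite -[x in _ * x ^+ _]add0r; move: d0; congr (is_derive _ _ _ _).
    by apply/funext => y; rewrite add0r.
  have d := is_deriveB (is_deriveD (is_derive_cst a.2 x (1 : R)) d1)
    (@is_derive_powS (2 * J) a.1 x).
  by apply: (is_derive_eq d); rewrite add0r mulrBr.
have cmu a := continuous_of_is_derive (dmu a).
have cr a : continuous (r a).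
  move=> x; apply: cvgM.
    by apply: (continuous_comp (cr1 a x)); exact: norm_continuous.
  by apply: (continuous_comp (cmu a x)); exact: continuous_gam.
have r0 a x : 0 <= r a x by rewrite mulr_ge0// gam_ge0.
rewrite (_ : kder e J = fun a p => r a p.1 * gam e (md (2 * J).+1 p)); last first.
  by apply/funext => a; apply/funext => p.
apply: (@schur_prod (2 * J).+1 r (fun _ => gam e)) => //.
- by rewrite mulr_ge0.
- by rewrite /r; meas.
- by rewrite /md; meas.
- by move=> _; exact: continuous_gam.
- by move=> _; exact: gam_ge0.
- move=> a; set b := a.1.
  have mono (x y : R) : x ^+ 2 <= y ^+ 2 -> x ^+ (2 * J) <= y ^+ (2 * J).
    by move=> xy; rewrite !exprM lerXn2r// nnegrE sqr_ge0.
  (* For b != 0 the derivative vanishes only where p.1 = o.1, at - b / 2. *)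
  have up (x : R) : 0 <= b * (b + 2 * x) -> x ^+ (2 * J) <= (b + x) ^+ (2 * J).
    by move=> h; apply: mono; nra.
  have dn (x : R) : b * (b + 2 * x) <= 0 -> (b + x) ^+ (2 * J) <= x ^+ (2 * J).
    by move=> h; apply: mono; nra.
  have cf : continuous (fun x : R => (2 * J).+1%:R * (x ^+ (2 * J) - (b + x) ^+ (2 * J))).
    by move=> x; apply: cvgM; [exact: cvg_cst|exact: cr1].
  have sP (x y : R) : x ^+ (2 * J) <= (b + x) ^+ (2 * J) ->
      y ^+ (2 * J) <= (b + y) ^+ (2 * J) ->
      0 <= ((2 * J).+1%:R * (x ^+ (2 * J) - (b + x) ^+ (2 * J))) *
           ((2 * J).+1%:R * (y ^+ (2 * J) - (b + y) ^+ (2 * J))).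
    by move=> hx hy; apply: mulr_le0; rewrite pmulr_rle0// subr_le0.
  have sN (x y : R) : (b + x) ^+ (2 * J) <= x ^+ (2 * J) ->
      (b + y) ^+ (2 * J) <= y ^+ (2 * J) ->
      0 <= ((2 * J).+1%:R * (x ^+ (2 * J) - (b + x) ^+ (2 * J))) *
           ((2 * J).+1%:R * (y ^+ (2 * J) - (b + y) ^+ (2 * J))).
    by move=> hx hy; apply: mulr_ge0; rewrite pmulr_rge0// subr_ge0.
  have := @integral_change_le _ (gam e) _ _ (- (b / 2)) _ (@continuous_gam _ e)
    (gam_ge0 e) (integral_gam_le e0) cf (dmu a).
  have sr (x y : R) : - (b / 2) <= x -> - (b / 2) <= y ->
      0 <= ((2 * J).+1%:R * (x ^+ (2 * J) - (b + x) ^+ (2 * J))) *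
           ((2 * J).+1%:R * (y ^+ (2 * J) - (b + y) ^+ (2 * J))).
    move=> hx hy; have [b0|b0] := leP 0 b.
      by apply: sP; apply: up; apply: mulr_ge0; lra.
    by apply: sN; apply: dn; apply: mulr_le0_ge0; lra.
  have sl (x y : R) : x <= - (b / 2) -> y <= - (b / 2) ->
      0 <= ((2 * J).+1%:R * (x ^+ (2 * J) - (b + x) ^+ (2 * J))) *
           ((2 * J).+1%:R * (y ^+ (2 * J) - (b + y) ^+ (2 * J))).
    move=> hx hy; have [b0|b0] := leP 0 b.
      by apply: sN; apply: dn; apply: mulr_ge0_le0; lra.
    by apply: sP; apply: up; apply: mulr_le0; lra.
  move=> /(_ sr sl); rewrite (_ : 2 * (2 * e^-1) = 4 * e^-1); last by ring.
  apply: le_trans; apply: ge0_le_integral => //.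
  + by move=> x _; rewrite lee_fin.
  + by apply/measurable_EFinP; exact: continuous_measurable_fun.
  + apply/measurable_EFinP; apply: continuous_measurable_fun => x; apply: cvgM.
      by apply: (continuous_comp (cf x)); exact: norm_continuous.
    by apply: (continuous_comp (cmu a x)); exact: continuous_gam.
  + move=> x _; rewrite lee_fin ler_wpM2r ?gam_ge0// normrM.
    by rewrite ler_peMl// ger0_norm// ler1n.
- by move=> _; exact: integral_gam_le.
Qed.

(** A localization of [p.1] to an interval of length [br a.1 `^ (- c)].  With
    [u = 2] and [v = 1] it is centred at [p.1 = o.1], where the derivative used
    by [kder] vanishes; with [c = -1], [u = 1], [v = 0] it is a mere cut-off to
    [|p.1|] of the size of [br a.1]. *)
Definition kaff (m : nat) (e c u v : R) (a p : R * R) : R :=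
  br a.1 `^ c * gam (1 / 2) (br a.1 `^ c * (u * p.1 + v * a.1)) * gam e (md m p).

Lemma schur_kaff m e c u v : 0 < e -> 1 <= `|u| ->
  schur (8 * (2 * e^-1)) (kaff m e c u v).
Proof.
move=> e0 u1; have e1 : 0 <= e^-1 by rewrite invr_ge0 ltW.
pose r (a : R * R) (x : R) :=
  br a.1 `^ c * gam (1 / 2) (br a.1 `^ c * (u * x + v * a.1)).
rewrite (_ : kaff m e c u v = fun a p => r a p.1 * gam e (md m p)); last first.
  by apply/funext => a; apply/funext => p.
apply: (@schur_prod _ r (fun _ => gam e)).
- by rewrite mulr_ge0.
- by rewrite /r; meas.
- by rewrite /md; meas.
- move=> a x; apply: cvgM; first exact: cvg_cst.
  apply: (@continuous_comp _ _ _ (fun x => br a.1 `^ c * (u * x + v * a.1)));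
    last exact: continuous_gam.
  apply: cvgM; first exact: cvg_cst.
  apply: cvgD; last exact: cvg_cst.
  by apply: cvgM; [exact: cvg_cst|exact: cvg_id].
- by move=> _; exact: continuous_gam.
- by move=> a x; apply: mulr_ge0; [exact: powR_ge0|exact: gam_ge0].
- by move=> _; exact: gam_ge0.
- move=> a.
  have h : (0 < 1 / 2 :> R) by lra.
  rewrite (_ : 8 = 2 * (2 * (1 / 2)^-1)); last by rewrite div1r invrK; ring.
  have A0 : 0 < br a.1 `^ c by rewrite powR_gt0// br_gt0.
  exact: (integral_rescale_le _ (@continuous_gam _ _) (gam_ge0 _)
    (integral_gam_le h) A0 u1).
- by move=> _; exact: integral_gam_le.
Qed.

(** Used when the time frequency [a.2] dominates: one of the free space
    frequencies is integrated with the profile [gam (1 / 2)], and the modulation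
    ranges up to the size of [a.2].  The case [v = 1] localizes [o.1]. *)
Definition klow (m : nat) (q v : R) (a p : R * R) : R :=
  gam (1 / 2) (p.1 + v * a.1) * plateau q (br a.2) (md m p).

Lemma schur_klow m q v : 0 < q -> schur (4 * (2 * q^-1)) (klow m q v).
Proof.
move=> q0; have q1 : 0 <= q^-1 by rewrite invr_ge0 ltW.
apply: (@schur_prod _ (fun a x => gam (1 / 2) (x + v * a.1))
  (fun a => plateau q (br a.2))).
- by rewrite mulr_ge0.
- by meas.
- rewrite /md.
  rewrite (_ : (fun x => _) = (fun x : T4 => br x.1.2 `^ (- q) *
     br (x.2.2 - x.2.1 ^+ m) `^ (q - 1) *
     (1 + br x.1.2 `^ (- q) * br (x.2.2 - x.2.1 ^+ m) `^ q) `^ (- 2%:R))).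
    by meas.
  by apply/funext => x; rewrite /plateau powR_invn// ltW// plateau_den_gt0.
- move=> a x; apply: (@continuous_comp _ _ _ (fun x : R => x + v * a.1)).
    by apply: cvgD; [exact: cvg_id|exact: cvg_cst].
  exact: continuous_gam.
- by move=> a; exact: continuous_plateau.
- by move=> a x; exact: gam_ge0.
- by move=> a x; exact: plateau_ge0.
- move=> a; rewrite (integral_shift (f := fun y => (gam (1 / 2) y)%:E)).
  + have h : (0 < 1 / 2 :> R) by lra.
    apply: le_trans (integral_gam_le h) _.
    by rewrite lee_fin div1r invrK; lra.
  + by apply/measurable_EFinP; apply: continuous_measurable_fun; exact: continuous_gam.
  + by move=> x; rewrite lee_fin gam_ge0.
- by move=> a; exact: integral_plateau_le.
Qed.

(** Here the free variables are [p.1], through the modulation, and the time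
    frequency of [o = - (a + p)], whose absolute value is that of [a.2 + p.2];
    the power in front is the Jacobian of the modulation. *)
Definition ktime (e : R) (J : nat) (a p : R * R) : R :=
  p.1 ^+ (2 * J) * gam e (md (2 * J).+1 p) * gam e (a.2 + p.2).

Lemma schur_ktime e J : 0 < e -> schur (4 * e^-1 * (2 * e^-1)) (ktime e J).
Proof.
move=> e0; have e1 : 0 <= e^-1 by rewrite invr_ge0 ltW.
have even0 (x : R) : 0 <= x ^+ (2 * J) by rewrite exprM exprn_ge0// sqr_ge0.
have mP : measurable_fun [set: T4] (fun x => ktime e J x.1 x.2).
  by rewrite /ktime /md; meas.
have P0 a p : 0 <= ktime e J a p by rewrite /ktime !mulr_ge0// gam_ge0.
split => // a.
have mPa : measurable_fun [set: R * R] (fun p => (ktime e J a p)%:E).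
  by apply/measurable_EFinP; exact: (measurableT_comp mP (measurable_pair1 a)).
have Pa0 p : (0 <= (ktime e J a p)%:E)%E by rewrite lee_fin.
rewrite (@fubini_tonelli2 _ _ _ _ _ mu mu _ mPa Pa0).
apply: (@le_trans _ _ (\int[mu]_x ((4 * e^-1)%:E * (gam e (a.2 + x))%:E))%E); last first.
  have mg : measurable_fun setT (fun x => (gam e (a.2 + x))%:E).
    apply/measurable_EFinP; apply: (measurableT_comp
      (continuous_measurable_fun (@continuous_gam _ e))).
    by apply: measurable_funD; [exact: measurable_cst | exact: measurable_id].
  have g0 (x : R) : setT x -> (0 <= (gam e (a.2 + x))%:E)%E by rewrite lee_fin gam_ge0.
  have k0 : 0 <= 4 * e^-1 by rewrite mulr_ge0.
  have -> : (\int[mu]_x ((4 * e^-1)%:E * (gam e (a.2 + x))%:E) =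
      (4 * e^-1)%:E * \int[mu]_x (gam e (a.2 + x))%:E)%E.
    exact: ge0_integralZl_EFin.
  rewrite [leRHS]EFinM; apply: lee_wpmul2l; first by rewrite lee_fin.
  under eq_integral do rewrite addrC.
  rewrite (integral_shift (f := fun y => (gam e y)%:E)).
  + exact: integral_gam_le.
  + by apply/measurable_EFinP; apply: continuous_measurable_fun; exact: continuous_gam.
  + by move=> x; rewrite lee_fin gam_ge0.
apply: ge0_le_integral => //.
- by move=> x _; apply: integral_ge0 => y _; exact: Pa0.
- exact: (measurable_fun_fubini_tonelli_G (m1 := mu) _ mPa).
- apply/measurable_EFinP; apply: measurable_funM; first exact: measurable_cst.
  apply: (measurableT_comp (continuous_measurable_fun (@continuous_gam _ e))).
  by apply: measurable_funD; [exact: measurable_cst | exact: measurable_id].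
- move=> y _; rewrite /fubini_G/=.
  have dmu (x : R) : is_derive x (1 : R) (fun x => y - x ^+ (2 * J).+1)
      (- ((2 * J).+1%:R * x ^+ (2 * J))).
    have d0 := @is_derive_powS (2 * J) 0 x.
    have d1 : is_derive x (1 : R) (fun x : R => x ^+ (2 * J).+1)
        ((2 * J).+1%:R * x ^+ (2 * J)).
      rewrite -[x in _ * x ^+ _]add0r; move: d0; congr (is_derive _ _ _ _).
      by apply/funext => z; rewrite add0r.
    have d := is_deriveB (is_derive_cst y x (1 : R)) d1.
    by apply: (is_derive_eq d); rewrite sub0r.
  have cf : continuous (fun x : R => - ((2 * J).+1%:R * x ^+ (2 * J))).
    move=> x; apply: cvgN; apply: cvgM; [exact: cvg_cst|exact: exprn_continuous].
  have := @integral_change_le _ (gam e) _ _ 0 _ (@continuous_gam _ e)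
    (gam_ge0 e) (integral_gam_le e0) cf dmu.
  have s (x z : R) : 0 <= (- ((2 * J).+1%:R * x ^+ (2 * J))) *
      (- ((2 * J).+1%:R * z ^+ (2 * J))).
    by rewrite mulrNN !mulr_ge0.
  move=> /(_ (fun _ _ _ _ => s _ _) (fun _ _ _ _ => s _ _)).
  rewrite (_ : 2 * (2 * e^-1) = 4 * e^-1); last by ring.
  move=> H; rewrite /ktime /=; under eq_integral do rewrite EFinM.
  rewrite ge0_integralZr//; last 3 first.
  + by apply/measurable_EFinP; rewrite /md/=; meas.
  + by move=> x _; rewrite lee_fin mulr_ge0// gam_ge0.
  + by rewrite lee_fin gam_ge0.
  apply: lee_wpmul2r; first by rewrite lee_fin gam_ge0.
  apply: le_trans H; apply: ge0_le_integral => //.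
  + by move=> x _; rewrite lee_fin mulr_ge0// gam_ge0.
  + by apply/measurable_EFinP; rewrite /md/=; meas.
  + by apply/measurable_EFinP; meas.
  + move=> x _; rewrite lee_fin /md/= ler_wpM2r ?gam_ge0// normrN normrM.
    by rewrite [leRHS]mulrC ger0_norm// ler_peMr// ger0_norm// ler1n.
Qed.
End kernels.

(** * Algebra of the resonance function *)

Section powers.
Context {R : realType}.
Implicit Types (x y a b c : R) (n k : nat).

Lemma powdiff_ge x y n : 0 <= y -> y <= x -> (x - y) * x ^+ n <= x ^+ n.+1 - y ^+ n.+1.
Proof.
move=> y0 yx; have x0 := le_trans y0 yx.
have h : y * y ^+ n <= y * x ^+ n.
  by rewrite ler_wpM2l// lerXn2r// nnegrE.
rewrite !exprS; nra.
Qed.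

Lemma powdiff_le x y n : 0 <= y -> y <= x ->
  x ^+ n.+1 - y ^+ n.+1 <= n.+1%:R * (x - y) * x ^+ n.
Proof.
move=> y0 yx; have x0 := le_trans y0 yx.
elim: n => [|n IH]; first by rewrite !expr1 expr0 mulr1 mul1r.
have h : y * (x ^+ n.+1 - y ^+ n.+1) <= x * (n.+1%:R * (x - y) * x ^+ n).
  apply: ler_pM => //.
  by rewrite subr_ge0 lerXn2r// nnegrE.
have -> : x ^+ n.+2 - y ^+ n.+2 = (x - y) * x ^+ n.+1 + y * (x ^+ n.+1 - y ^+ n.+1).
  by rewrite [x ^+ n.+2]exprS [y ^+ n.+2]exprS; ring.
have -> : n.+2%:R * (x - y) * x ^+ n.+1 =
    (x - y) * x ^+ n.+1 + x * (n.+1%:R * (x - y) * x ^+ n).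
  by rewrite -[n.+2%:R]natr1 [x ^+ n.+1]exprS; ring.
by rewrite lerD2l.
Qed.

Lemma sum_pow_ge b c n : 0 <= b -> 0 <= c ->
  2 * (b * c) * (b + c) ^+ n <= (b + c) ^+ n.+2 - b ^+ n.+2 - c ^+ n.+2.
Proof.
move=> b0 c0.
have h1 := @powdiff_ge (b + c) b n b0 (_ : b <= b + c).
have h2 := @powdiff_ge (b + c) c n c0 (_ : c <= b + c).
rewrite lerDl in h1; rewrite lerDr in h2.
have := ler_wpM2l b0 (h1 c0); have := ler_wpM2l c0 (h2 b0).
have -> : (b + c) ^+ n.+2 = b * (b + c) ^+ n.+1 + c * (b + c) ^+ n.+1.
  by rewrite -mulrDl -exprS.
rewrite [b ^+ n.+2]exprS [c ^+ n.+2]exprS.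
have -> : b + c - b = c by ring.
have -> : b + c - c = b by ring.
lra.
Qed.

Lemma odd_pow x k : (- x) ^+ (2 * k).+1 = - x ^+ (2 * k).+1.
Proof. by rewrite exprNn -signr_odd oddS oddM /= expr1 mulN1r. Qed.

Lemma even_pow x k : `|x| ^+ (2 * k) = x ^+ (2 * k).
Proof. by rewrite !exprM real_normK ?num_real. Qed.

Lemma odd_pow_sum3 a b c k : a = - (b + c) -> 0 <= b * c ->
  `|a ^+ (2 * k).+1 + b ^+ (2 * k).+1 + c ^+ (2 * k).+1| =
  `|(`|b| + `|c|) ^+ (2 * k).+1 - `|b| ^+ (2 * k).+1 - `|c| ^+ (2 * k).+1|.
Proof.
move=> -> bc; rewrite odd_pow.
have [b0|b0] := leP 0 b.
  have [c0|c0] := leP 0 c.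
    rewrite (ger0_norm b0) (ger0_norm c0) -[LHS]normrN; congr `|_|; ring.
  have b00 : b = 0 by nra.
  rewrite b00 normr0 !add0r !expr0n /= subr0 !addr0 addNr.
  by rewrite subrr normr0.
have c0 : c <= 0 by nra.
rewrite (ltr0_norm b0) (ler0_norm c0) -opprD !odd_pow; congr `|_|; ring.
Qed.

(** Three reals with sum zero have largest absolute value [half_sum a b c]:
    two of them have the same sign, and the third is minus their sum. *)
Definition half_sum a b c : R := (`|a| + `|b| + `|c|) / 2.

Lemma half_sum_max a b c : a + b + c = 0 ->
  [/\ `|a| <= half_sum a b c, `|b| <= half_sum a b c & `|c| <= half_sum a b c].
Proof.
move=> h; rewrite /half_sum.
have := ler_normD a b; have := ler_normD b c; have := ler_normD a c.
have -> : a + b = - c by lra. have -> : b + c = - a by lra.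
have -> : a + c = - b by lra.
by rewrite !normrN => *; split; lra.
Qed.

(** Among three reals with sum zero two have the same sign, so that a symmetric
    property may be proved under that assumption for the last two. *)
Lemma same_sign3 (P : R -> R -> R -> Prop) :
  (forall a b c, a + b + c = 0 -> 0 <= b * c -> P a b c) ->
  (forall a b c, P a b c -> P b a c) -> (forall a b c, P a b c -> P a c b) ->
  forall a b c, a + b + c = 0 -> P a b c.
Proof.
move=> H s12 s23 a b c h.
have [bc|bc] := leP 0 (b * c); first exact: H.
have [ac|ac] := leP 0 (a * c).
  by apply: s12; apply: H => //; lra.
apply: s23; apply: s12; apply: H; first lra.
have : 0 < a * b * c ^+ 2 by nra.
have : 0 <= c ^+ 2 by exact: sqr_ge0.
by have [//|] := leP 0 (a * b); nra.
Qed.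

(** When [b] and [c] have the same sign, [a ^+ m] cancels against their powers
    up to the mixed terms of [(|b| + |c|) ^+ m], and those contain the factor
    [|b| * |c|]. *)
Lemma resonance_ge a b c k : a + b + c = 0 ->
  2 * (`|a| * `|b| * `|c|) * half_sum a b c ^+ (2 * k) <=
  `|a ^+ (2 * k.+1).+1 + b ^+ (2 * k.+1).+1 + c ^+ (2 * k.+1).+1|.
Proof.
move: a b c; apply: same_sign3.
- move=> a b c h bc; have ea : a = - (b + c) by lra.
  rewrite (odd_pow_sum3 _ ea bc).
  have na : `|a| = `|b| + `|c|.
    rewrite ea normrN; have [b0|b0] := leP 0 b.
      have [c0|c0] := leP 0 c; first by rewrite !ger0_norm// addr_ge0.
      have -> : b = 0 by nra.
      by rewrite normr0 !add0r.
    have c0 : c <= 0 by nra.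
    by rewrite (ltr0_norm b0) !ler0_norm//; lra.
  have -> : half_sum a b c = `|b| + `|c| by rewrite /half_sum na; field.
  have := @sum_pow_ge `|b| `|c| (2 * k).+1 (normr_ge0 b) (normr_ge0 c).
  rewrite mulnS !addSn add0n => hh.
  apply: le_trans (ler_norm _); apply: le_trans hh.
  by rewrite na [_ ^+ (2 * k).+1]exprS le_eqVlt; apply/orP; left; apply/eqP; ring.
- move=> a b c; rewrite /half_sum [`|b| * `|a|]mulrC [`|b| + `|a|]addrC.
  by rewrite [b ^+ _ + a ^+ _]addrC.
- move=> a b c; rewrite /half_sum [`|a| * `|c| * _]mulrAC [`|a| + `|c| + _]addrAC.
  by rewrite [a ^+ _ + c ^+ _ + _]addrAC.
Qed.

Lemma pow_sub_norm_le x y n (M : R) : `|x| <= M -> `|y| <= M ->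
  `|x ^+ n.+1 - y ^+ n.+1| <= n.+1%:R * `|x - y| * M ^+ n.
Proof.
move=> xM yM; have M0 : 0 <= M by apply: le_trans xM.
elim: n => [|n IH]; first by rewrite !expr1 expr0 mulr1 mul1r.
have -> : x ^+ n.+2 - y ^+ n.+2 = (x - y) * x ^+ n.+1 + y * (x ^+ n.+1 - y ^+ n.+1).
  by rewrite [x ^+ n.+2]exprS [y ^+ n.+2]exprS; ring.
have -> : n.+2%:R * `|x - y| * M ^+ n.+1 =
    `|x - y| * M ^+ n.+1 + M * (n.+1%:R * `|x - y| * M ^+ n).
  by rewrite -[n.+2%:R]natr1 [M ^+ n.+1]exprS; ring.
apply: le_trans (ler_normD _ _) _; rewrite !normrM; apply: lerD.
  by rewrite ler_wpM2l// normrX lerXn2r// nnegrE.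
exact: ler_pM.
Qed.

Lemma resonance_le a b c k : a + b + c = 0 ->
  `|a ^+ (2 * k).+1 + b ^+ (2 * k).+1 + c ^+ (2 * k).+1| <=
  (2 * k).+2%:R * `|a| * half_sum a b c ^+ (2 * k).
Proof.
move=> h; have [ha hb hc] := half_sum_max h.
have -> : c = - (a + b) by lra.
rewrite odd_pow -addrA -[X in _ + X]/(_ - _).
apply: le_trans (ler_normD _ _) _.
have hd : `|a + b| <= half_sum a b c by rewrite (_ : a + b = - c) ?normrN//; lra.
have := pow_sub_norm_le (2 * k) hb hd.
have -> : b - (a + b) = - a by ring.
rewrite normrN => h1.
have h2 : `|a ^+ (2 * k).+1| <= `|a| * half_sum a b c ^+ (2 * k).
  by rewrite normrX exprS ler_wpM2l// lerXn2r// nnegrE// (le_trans _ ha).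
apply: le_trans (lerD h2 h1) _.
by rewrite -[(2 * k).+2%:R]natr1 le_eqVlt; apply/orP; left; apply/eqP;
  rewrite /half_sum (_ : - (a + b) = c); [ring|lra].
Qed.

(** The even powers differ by at least [||b| - |c||] times the derivative
    [P ^+ (2 k + 1)], up to a constant, where [P = half_sum a b c].  If [b] and
    [c] have opposite signs, the first factor is [|a|].  If they have the same
    sign, it is [|b - c|], which is either comparable with [|a| = |b| + |c|] or
    so small that all three frequencies are comparable. *)
Lemma der_dichotomy a b c k : a + b + c = 0 ->
  `|a| * half_sum a b c ^+ (2 * k).+1 <=
     2 ^+ (2 * k).+3 * `|b ^+ (2 * k.+1) - c ^+ (2 * k.+1)| \/
  [/\ `|a| = half_sum a b c, half_sum a b c <= 4 * `|b|,
      half_sum a b c <= 4 * `|c| &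
      `|b - c| * half_sum a b c ^+ (2 * k).+1 <=
      2 ^+ (2 * k).+1 * `|b ^+ (2 * k.+1) - c ^+ (2 * k.+1)|].
Proof.
move=> h.
have key (x y : R) : 0 <= y -> y <= x ->
    (x - y) * x ^+ (2 * k).+1 <= `|x ^+ (2 * k.+1) - y ^+ (2 * k.+1)|.
  move=> y0 yx; apply: le_trans (ler_norm _).
  by rewrite mulnS addSn add1n; exact: powdiff_ge.
rewrite -(even_pow b) -(even_pow c).
wlog cb : b c h / `|c| <= `|b|.
  move=> W; have [cb|/ltW bc] := leP `|c| `|b|; first exact: W.
  have := W c b; rewrite (_ : a + c + b = 0); last lra.
  rewrite (distrC (`|c| ^+ _)) (distrC c).
  rewrite (_ : half_sum a c b = half_sum a b c); last first.
    by rewrite /half_sum addrAC.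
  move=> /(_ erefl bc) [?|[? ? ? ?]]; [by left|by right].
have k1 := key _ _ (normr_ge0 c) cb.
set D := `|_ - _| in k1 *.
have D0 : 0 <= D by exact: normr_ge0.
have e1 : (1 : R) <= 2 ^+ (2 * k).+1 by rewrite exprn_ege1// ler1n.
have e3 : (1 : R) <= 2 ^+ (2 * k).+3 by rewrite exprn_ege1// ler1n.
have [bc|bc] := leP (b * c) 0.
  left.
  have na : `|a| = `|b| - `|c|.
    have -> : a = - (b + c) by lra.
    rewrite normrN; have [b0|b0] := leP 0 b.
      have [c0|c0] := leP c 0.
        move: cb; rewrite (ger0_norm b0) (ler0_norm c0) => cb; rewrite ger0_norm; lra.
      have b00 : b = 0 by nra.
      move: cb; rewrite b00 normr0 (gtr0_norm c0); lra.
    have c0 : 0 <= c by nra.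
    move: cb; rewrite (ltr0_norm b0) (ger0_norm c0) => cb; rewrite ler0_norm; lra.
  have -> : half_sum a b c = `|b| by rewrite /half_sum na; field.
  by rewrite na; apply: le_trans k1 _; rewrite ler_peMl.
have na : `|a| = `|b| + `|c|.
  have -> : a = - (b + c) by lra.
  rewrite normrN; have [b0|b0] := leP 0 b.
    have c0 : 0 <= c by nra.
    by rewrite !ger0_norm// addr_ge0.
  have c0 : c <= 0 by nra.
  rewrite (ltr0_norm b0) !ler0_norm//; lra.
have nb : `|b - c| = `|b| - `|c|.
  have [b0|b0] := leP 0 b.
    have c0 : 0 <= c by nra.
    move: cb; rewrite (ger0_norm b0) (ger0_norm c0) => cb; rewrite ger0_norm//; lra.
  have c0 : c <= 0 by nra.
  move: cb; rewrite (ltr0_norm b0) (ler0_norm c0) => cb; rewrite ler0_norm; lra.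
have hs : half_sum a b c = `|b| + `|c| by rewrite /half_sum na; field.
rewrite hs na.
have hp : (`|b| + `|c|) ^+ (2 * k).+1 <= 2 ^+ (2 * k).+1 * `|b| ^+ (2 * k).+1.
  by rewrite -exprMn lerXn2r// ?nnegrE ?addr_ge0// ?mulr_ge0//; lra.
have [far|near] := leP (`|b| + `|c|) (4 * (`|b| - `|c|)).
  left.
  rewrite [X in X * D](_ : _ = 4 * 2 ^+ (2 * k).+1); last first.
    by rewrite !exprS; ring.
  have := ler_pM _ _ far hp; rewrite addr_ge0// exprn_ge0 ?addr_ge0//.
  move=> /(_ isT isT) h1; apply: le_trans h1 _.
  have := ler_wpM2l (_ : 0 <= 4 * 2 ^+ (2 * k).+1) k1.
  rewrite mulr_ge0// => /(_ isT); lra.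
right; split => //; [lra|lra|].
rewrite nb; have := ler_wpM2l (_ : 0 <= `|b| - `|c|) hp.
rewrite subr_ge0 => /(_ cb) h1; apply: le_trans h1 _.
have := ler_wpM2l (_ : 0 <= 2 ^+ (2 * k).+1) k1.
rewrite exprn_ge0// => /(_ isT); lra.
Qed.

End powers.

(** * The sum of the kernels and its use *)

Section logs.
Context {R : realType}.
Implicit Types (a b x y : R).

Lemma powRE a r : 0 < a -> a `^ r = expR (r * ln a).
Proof. by move=> a0; rewrite /powR gt_eqF. Qed.

Lemma expRE a n : 0 < a -> a ^+ n = expR (n%:R * ln a).
Proof. by move=> a0; rewrite expRM_natl lnK. Qed.

Lemma lnE a : 0 < a -> a = expR (ln a).
Proof. by move=> a0; rewrite lnK. Qed.

Lemma ln2_ge0 : 0 <= ln 2 :> R. Proof. by rewrite ln_ge0// ler1n. Qed.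

Lemma ler_ln_mul a b (c : R) : 0 < a -> 0 < b -> 0 < c -> a <= c * b ->
  ln a <= ln c + ln b.
Proof. by move=> a0 b0 c0; rewrite -lnM ?posrE// ler_ln ?posrE// mulr_gt0. Qed.

Lemma ln2X n : ln (2 ^+ n) = n%:R * ln 2 :> R.
Proof. by rewrite lnXn// mulr_natl. Qed.

Lemma ln_br_ge0 x : 0 <= ln (br x). Proof. exact/ln_ge0/br_ge1. Qed.

(** The larger modulation is at least half of [br (x + y)], and pays for
    [gam e (x + y)]; the smaller one pays for its own [gam].  The exponent
    [2 * be - 1] is too weak by [6 * be], a loss charged to any upper bound [B] of
    [br (x + y)]. *)
Lemma conv_le (be e B x y : R) : 0 <= e -> e <= be -> be <= 1 / 6 ->
  br (x + y) <= B ->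
  (br x * br y) `^ (2 * be - 1) <=
  2 * B `^ (6 * be) * gam e (x + y) * (gam e x + gam e y).
Proof.
move=> e0 eb b6 hB.
wlog yx : x y hB / br y <= br x.
  move=> W; have [?|/ltW ?] := leP (br y) (br x); first exact: W.
  by rewrite mulrC [x + y]addrC [gam e x + _]addrC; apply: W => //; rewrite addrC.
have B0 : 0 < B by apply: lt_le_trans hB; exact: br_gt0.
apply: (@le_trans _ _ (2 * B `^ (6 * be) * gam e (x + y) * gam e y)); last first.
  rewrite ler_wpM2l ?lerDr ?gam_ge0//.
  by rewrite !mulr_ge0 ?gam_ge0 ?powR_ge0.
have xy2 : br (x + y) <= 2 * br x.
  have := ler_normD x y; move: yx; rewrite /br; have := normr_ge0 x; lra.
rewrite /gam !powRE ?mulr_gt0 ?br_gt0// lnM ?posrE ?br_gt0//.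
rewrite [X in _ <= X * _ * _ * _](@lnE 2)// -!expRD ler_expR.
have l2 := ln2_ge0.
have hw := ler_ln_mul (br_gt0 _) (br_gt0 _) (ltr0Sn R 1) xy2.
have hv := ln_br_ge0 y.
have hu : ln (br y) <= ln (br x) by rewrite ler_ln ?posrE ?br_gt0.
have hl : ln (br (x + y)) <= ln B by rewrite ler_ln ?posrE ?br_gt0.
have hw0 := ln_br_ge0 (x + y).
move: hw hv hu hl hw0 l2.
set u := ln (br x); set v := ln (br y); set w := ln (br (x + y)); set l := ln B.
set t := ln 2 => hw hv hu hl hw0 l2.
have [vl|lv] := leP v l.
  have p1 : 0 <= (1 - 2 * be) * (u - w + t) by apply: mulr_ge0; lra.
  have p2 : 0 <= (2 * be + e) * (l - w) by apply: mulr_ge0; lra.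
  have p3 : 0 <= (2 * be + e) * (l - v) by apply: mulr_ge0; lra.
  have p4 : 0 <= be * t by apply: mulr_ge0; lra.
  have p5 : 0 <= (be - e) * l by apply: mulr_ge0; lra.
  lra.
have p1 : 0 <= (1 - 2 * be) * (u - v) by apply: mulr_ge0; lra.
have p2 : 0 <= (1 - 4 * be - e) * (v - l) by apply: mulr_ge0; lra.
have p3 : 0 <= (1 + e) * (l - w) by apply: mulr_ge0; lra.
have p5 : 0 <= (be - e) * l by apply: mulr_ge0; lra.
lra.
Qed.

End logs.

Section kernel_sum.
Context {R : realType}.
Variables (be e : R) (k : nat).
Implicit Types (q : R * R).
Let m := (2 * k.+1).+1.

(** All the kernels with [a] fixed that occur in the case analysis, where [m] is
    [2 * k.+1 + 1]. *)
Definition pair_kernel (a p : R * R) : R :=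
  kder e k.+1 a p + kaff m e (k%:R + 1 / 2) 2 1 a p + kaff m e (-1) 1 0 a p +
  klow m (2 * be) 0 a p + klow m (2 * be) 1 a p + ktime e k.+1 a p.

(** Symmetric in the three frequencies, so that the case analysis may permute
    them. *)
Definition total_kernel q0 q1 q2 : R :=
  (pair_kernel q0 q1 + pair_kernel q0 q2) + (pair_kernel q1 q0 + pair_kernel q1 q2) +
  (pair_kernel q2 q0 + pair_kernel q2 q1).

Lemma kder_ge0 a p : 0 <= kder e k.+1 a p.
Proof. by rewrite !mulr_ge0// gam_ge0. Qed.
Lemma kaff_ge0 c u v a p : 0 <= kaff m e c u v a p.
Proof.
by apply: mulr_ge0; [apply: mulr_ge0; [exact: powR_ge0|]|]; exact: gam_ge0.
Qed.
Lemma klow_ge0 (t v : R) a p : 0 <= klow m t v a p.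
Proof. by rewrite mulr_ge0 ?gam_ge0 ?plateau_ge0. Qed.
Lemma ktime_ge0 a p : 0 <= ktime e k.+1 a p.
Proof. by rewrite !mulr_ge0 ?gam_ge0// -even_pow exprn_ge0. Qed.

Lemma pair_kernel_ge a p :
  [/\ kder e k.+1 a p <= pair_kernel a p,
      kaff m e (k%:R + 1 / 2) 2 1 a p <= pair_kernel a p,
      kaff m e (-1) 1 0 a p <= pair_kernel a p,
      klow m (2 * be) 0 a p + klow m (2 * be) 1 a p <= pair_kernel a p &
      ktime e k.+1 a p <= pair_kernel a p].
Proof.
rewrite /pair_kernel.
have := kder_ge0 a p; have := kaff_ge0 (k%:R + 1 / 2) 2 1 a p.
have := kaff_ge0 (-1) 1 0 a p; have := klow_ge0 (2 * be) 0 a p.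
have := klow_ge0 (2 * be) 1 a p; have := ktime_ge0 a p.
by move=> *; split; lra.
Qed.

Lemma pair_kernel_ge0 a p : 0 <= pair_kernel a p.
Proof. by have [h _ _ _ _] := pair_kernel_ge a p; apply: le_trans h; exact: kder_ge0. Qed.

Lemma total_kernel_pair q0 q1 q2 : pair_kernel q0 q1 + pair_kernel q0 q2 <= total_kernel q0 q1 q2.
Proof.
rewrite /total_kernel -addrA; have := pair_kernel_ge0 q1 q0; have := pair_kernel_ge0 q1 q2.
have := pair_kernel_ge0 q2 q0; have := pair_kernel_ge0 q2 q1; lra.
Qed.

Lemma total_kernel_swap12 q0 q1 q2 : total_kernel q0 q2 q1 = total_kernel q0 q1 q2.
Proof. rewrite /total_kernel; ring. Qed.
Lemma total_kernel_swap01 q0 q1 q2 : total_kernel q1 q0 q2 = total_kernel q0 q1 q2.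
Proof. rewrite /total_kernel; ring. Qed.
Lemma total_kernel_swap02 q0 q1 q2 : total_kernel q2 q1 q0 = total_kernel q0 q1 q2.
Proof. rewrite /total_kernel; ring. Qed.

Definition resonance q0 q1 q2 : R := q0.1 ^+ m + q1.1 ^+ m + q2.1 ^+ m.
(** The weight of the modulation in the norms. *)
Definition sg q : R := br (md m q).

Lemma sg_ge1 q : 1 <= sg q. Proof. exact: br_ge1. Qed.
Lemma sg_gt0 q : 0 < sg q. Proof. exact: br_gt0. Qed.

Section triple.
Variables (q0 q1 q2 : R * R).
Hypotheses (h1 : q0.1 + q1.1 + q2.1 = 0) (h2 : q0.2 + q1.2 + q2.2 = 0).

(** The modulations of three frequencies with sum zero add up to minus the
    resonance function: a large resonance forces a large modulation. *)
Lemma md_sum : md m q1 + md m q2 = - (md m q0 + resonance q0 q1 q2).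
Proof.
rewrite /md /resonance; move: (q0.1 ^+ m) (q1.1 ^+ m) (q2.1 ^+ m) => u v w.
by move: h2 => h; lra.
Qed.

Lemma sg_sum_ge : `|resonance q0 q1 q2| <= sg q0 + sg q1 + sg q2.
Proof.
have -> : resonance q0 q1 q2 = - (md m q0 + md m q1 + md m q2).
  by rewrite -addrA md_sum; ring.
rewrite normrN; apply: le_trans (ler_normD _ _) _.
have := ler_normD (md m q0) (md m q1); rewrite /sg /br; lra.
Qed.

Lemma kderE : kder e k.+1 q0 q1 =
  `|q1.1 ^+ (2 * k.+1) - q2.1 ^+ (2 * k.+1)| *
  gam e (md m q1 + md m q2) * gam e (md m q1).
Proof.
rewrite /kder -/m; have -> : q0.1 + q1.1 = - q2.1 by apply/eqP; rewrite -addr_eq0 h1.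
have -> : (- q2.1) ^+ (2 * k.+1) = q2.1 ^+ (2 * k.+1).
  by rewrite -[LHS]even_pow normrN even_pow.
congr (_ * _ * _); rewrite md_sum gamN; congr gam.
rewrite /resonance /md odd_pow -/m.
by move: (q0.1 ^+ m) (q1.1 ^+ m) (q2.1 ^+ m) => u v w; ring.
Qed.

Lemma br_md_sum_le : br (md m q1 + md m q2) <= sg q0 + `|resonance q0 q1 q2|.
Proof.
rewrite md_sum brN /sg /br.
have := ler_normD (md m q0) (resonance q0 q1 q2); lra.
Qed.

Hypotheses (e0 : 0 <= e) (eb : e <= be) (b6 : be <= 1 / 6).

Lemma conv_pair (B : R) : sg q0 + `|resonance q0 q1 q2| <= B ->
  (sg q1 * sg q2) `^ (2 * be - 1) <=
  2 * B `^ (6 * be) * gam e (md m q1 + md m q2) *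
  (gam e (md m q1) + gam e (md m q2)).
Proof. by move=> hB; apply: conv_le => //; apply: le_trans br_md_sum_le hB. Qed.

End triple.

Section use.
Variables (q0 q1 q2 : R * R).
Hypotheses (h1 : q0.1 + q1.1 + q2.1 = 0) (h2 : q0.2 + q1.2 + q2.2 = 0).
Hypotheses (e0 : 0 <= e) (eb : e <= be) (b6 : be <= 1 / 6).
Let h1' : q0.1 + q2.1 + q1.1 = 0. Proof. by rewrite addrAC. Qed.
Let h2' : q0.2 + q2.2 + q1.2 = 0. Proof. by rewrite addrAC. Qed.

(** Fixing [q0] and using [kder]: the power of [B] lost in [conv_le] must be
    paid by the difference of powers. *)
Lemma der_bound (B T K : R) : sg q0 + `|resonance q0 q1 q2| <= B -> 0 <= T -> 0 <= K ->
  T * B `^ (6 * be) <= K * `|q1.1 ^+ (2 * k.+1) - q2.1 ^+ (2 * k.+1)| ->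
  T * (sg q1 * sg q2) `^ (2 * be - 1) <= 2 * K * total_kernel q0 q1 q2.
Proof.
move=> hB T0 K0 H.
have c := ler_wpM2l T0 (conv_pair h2 e0 eb b6 hB).
apply: le_trans c _.
have P := total_kernel_pair q0 q1 q2.
have [k1 _ _ _ _] := pair_kernel_ge q0 q1; have [k2 _ _ _ _] := pair_kernel_ge q0 q2.
rewrite (kderE h1 h2) in k1; rewrite (kderE h1' h2') in k2.
have G0 : 0 <= gam e (md m q1 + md m q2) * (gam e (md m q1) + gam e (md m q2)).
  by rewrite mulr_ge0 ?addr_ge0 ?gam_ge0.
have := ler_wpM2r G0 H.
rewrite distrC [md m q2 + _]addrC in k2.
have : 0 <= K * (total_kernel q0 q1 q2 - (pair_kernel q0 q1 + pair_kernel q0 q2)).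
  by rewrite mulr_ge0// subr_ge0.
have := ler_wpM2l K0 (lerD k1 k2).
lra.
Qed.

(** Fixing [q0] and using the localization [kaff]. *)
Lemma aff_bound (B T K rho c u v : R) :
  sg q0 + `|resonance q0 q1 q2| <= B -> 0 <= T -> 0 <= K ->
  kaff m e c u v q0 q1 <= pair_kernel q0 q1 ->
  kaff m e c u v q0 q2 <= pair_kernel q0 q2 ->
  rho <= br q0.1 `^ c * gam (1 / 2) (br q0.1 `^ c * (u * q1.1 + v * q0.1)) ->
  rho <= br q0.1 `^ c * gam (1 / 2) (br q0.1 `^ c * (u * q2.1 + v * q0.1)) ->
  T * B `^ (6 * be) <= K * rho ->
  T * (sg q1 * sg q2) `^ (2 * be - 1) <= 2 * K * total_kernel q0 q1 q2.
Proof.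
move=> hB T0 K0 k1 k2 r1 r2 H.
have c1 := ler_wpM2l T0 (conv_pair h2 e0 eb b6 hB).
apply: le_trans c1 _.
have P := total_kernel_pair q0 q1 q2.
have g1 := gam_ge0 e (md m q1); have g2 := gam_ge0 e (md m q2).
have gle : gam e (md m q1 + md m q2) <= 1.
  rewrite /gam -[leRHS](powRr0 (br (md m q1 + md m q2))) ler_powR ?br_ge1//.
  by move: e0 => e00; lra.
have B0 : 0 <= T * B `^ (6 * be) by rewrite mulr_ge0 ?powR_ge0.
apply: (@le_trans _ _ (2 * (K * rho) * (gam e (md m q1) + gam e (md m q2)))).
  have H' : T * B `^ (6 * be) * gam e (md m q1 + md m q2) <= K * rho.
    by apply: le_trans H; rewrite ler_piMr.
  have := ler_wpM2r (addr_ge0 g1 g2) H'; lra.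
have e1 := le_trans (ler_wpM2r g1 r1) k1.
have e2 := le_trans (ler_wpM2r g2 r2) k2.
have := ler_wpM2l K0 (le_trans (lerD e1 e2) P).
lra.
Qed.
End use.
End kernel_sum.

(** * Interactions of high frequencies *)

Section hh.
Context {R : realType}.

Lemma powRM3 (a b c : R) r : 0 < a -> 0 < b -> 0 < c ->
  (a * b * c) `^ r = a `^ r * (b * c) `^ r.
Proof. by move=> a0 b0 c0; rewrite -mulrA powRM// ltW// mulr_gt0. Qed.

Lemma max_scale (be s T K X : R) : 0 < s -> 0 <= T -> 0 <= be -> be <= 1 / 6 ->
  T * s `^ (8 * be - 1) <= K * X ->
  T * s `^ (2 * be - 1) * (4 * s) `^ (6 * be) <= 4 * K * X.
Proof.
move=> s0 T0 b0 b6 H.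
have h4 : 4 `^ (6 * be) <= 4 :> R by apply: ler1_powR; lra.
have -> : T * s `^ (2 * be - 1) * (4 * s) `^ (6 * be) =
    4 `^ (6 * be) * (T * s `^ (8 * be - 1)).
  rewrite powRM ?(ltW s0)// (_ : 8 * be - 1 = 2 * be - 1 + 6 * be); last by ring.
  by rewrite (@powRD _ s (2 * be - 1) (6 * be)) ?(gt_eqF s0) ?implybT//; ring.
rewrite -[leRHS]mulrA; apply: ler_pM => //; rewrite ?powR_ge0//.
by rewrite mulr_ge0// powR_ge0.
Qed.

Variables (be e : R) (k : nat).
Let m := (2 * k.+1).+1.
Let c0 : R := k%:R + 1 / 2.
Local Notation sg := (sg k).
Local Notation resonance := (resonance k).
Local Notation total_kernel := (total_kernel be e k).

(** When [q0] has the dominant modulation, [B] is comparable with it and the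
    exponents of [sg q0] combine to [8 * be - 1]. *)
Lemma max_der_bound (q0 q1 q2 : R * R) (T K : R) :
  q0.1 + q1.1 + q2.1 = 0 -> q0.2 + q1.2 + q2.2 = 0 ->
  0 <= e -> e <= be -> be <= 1 / 6 ->
  `|resonance q0 q1 q2| <= 3 * sg q0 -> 0 <= T -> 0 <= K ->
  T * sg q0 `^ (8 * be - 1) <= K * `|q1.1 ^+ (2 * k.+1) - q2.1 ^+ (2 * k.+1)| ->
  T * (sg q0 * sg q1 * sg q2) `^ (2 * be - 1) <= 8 * K * total_kernel q0 q1 q2.
Proof.
move=> h1 h2 e0 eb b6 h3 T0 K0 H.
rewrite powRM3 ?sg_gt0// mulrA (_ : 8 * K = 2 * (4 * K)); last by ring.
apply: (der_bound h1 h2 e0 eb b6 (B := 4 * sg q0)); [lra|by rewrite mulr_ge0 ?powR_ge0|by rewrite mulr_ge0|].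
by apply: max_scale => //; [exact: sg_gt0|lra].
Qed.

Lemma max_aff_bound (q0 q1 q2 : R * R) (T K rho c u v : R) :
  q0.2 + q1.2 + q2.2 = 0 ->
  0 <= e -> e <= be -> be <= 1 / 6 ->
  `|resonance q0 q1 q2| <= 3 * sg q0 -> 0 <= T -> 0 <= K ->
  kaff m e c u v q0 q1 <= pair_kernel be e k q0 q1 ->
  kaff m e c u v q0 q2 <= pair_kernel be e k q0 q2 ->
  rho <= br q0.1 `^ c * gam (1 / 2) (br q0.1 `^ c * (u * q1.1 + v * q0.1)) ->
  rho <= br q0.1 `^ c * gam (1 / 2) (br q0.1 `^ c * (u * q2.1 + v * q0.1)) ->
  T * sg q0 `^ (8 * be - 1) <= K * rho ->
  T * (sg q0 * sg q1 * sg q2) `^ (2 * be - 1) <= 8 * K * total_kernel q0 q1 q2.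
Proof.
move=> h2 e0 eb b6 h3 T0 K0 k1 k2 r1 r2 H.
rewrite powRM3 ?sg_gt0// mulrA (_ : 8 * K = 2 * (4 * K)); last by ring.
have U := @aff_bound _ be e k q0 q1 q2 h2 e0 eb b6 (4 * sg q0)
  (T * sg q0 `^ (2 * be - 1)) (4 * K) rho c u v.
apply: U => //; [lra|by rewrite mulr_ge0 ?powR_ge0|by rewrite mulr_ge0|].
by apply: max_scale => //; [exact: sg_gt0|lra].
Qed.

Lemma gam_half_ge (y : R) : `|y| <= 1 -> 1 / 4 <= gam (1 / 2) y.
Proof.
move=> y1; rewrite /gam (_ : 1 / 4 = 2 `^ (- 2%:R)); last first.
  by rewrite powR_invn// -natrX div1r.
apply: (@le_trans _ _ (2 `^ (-1 - 1 / 2))).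
  by rewrite ler_powR ?ler1n//; lra.
rewrite !powRE ?br_gt0// ler_expR.
have : ln (br y) <= ln 2 by rewrite ler_ln ?posrE ?br_gt0// /br; lra.
lra.
Qed.

(** The dichotomy of the derivative.  In the degenerate case the kernel [kder]
    is useless very close to [q1.1 = q2.1], and the localization [kaff] at the
    scale [P `^ (- (k + 1 / 2))] takes over; this scale is where the
    two bounds coincide. *)
Lemma high_high_core (q0 q1 q2 : R * R) (T K1 K2 : R) :
  q0.1 + q1.1 + q2.1 = 0 -> q0.2 + q1.2 + q2.2 = 0 ->
  0 <= e -> e <= be -> be <= 1 / 6 ->
  `|resonance q0 q1 q2| <= 3 * sg q0 -> 0 <= T -> 0 <= K1 -> 0 <= K2 ->
  let P := half_sum q0.1 q1.1 q2.1 in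
  1 <= P ->
  T * sg q0 `^ (8 * be - 1) <= K1 * (`|q0.1| * P ^+ (2 * k).+1) ->
  (P <= 4 * `|q0.1| -> P <= 4 * `|q1.1| -> P <= 4 * `|q2.1| ->
    T * sg q0 `^ (8 * be - 1) <= K2 * P `^ c0) ->
  T * (sg q0 * sg q1 * sg q2) `^ (2 * be - 1) <=
    8 * (K1 * 2 ^+ (2 * k).+3 + 4 * K2 + K2 * (2 ^+ k.+1 * 2 ^+ (2 * k).+1)) *
    total_kernel q0 q1 q2.
Proof.
move=> h1 h2 e0 eb b6 h3 T0 K10 K20 P P1 H1 H2.
have Pt0 : 0 <= total_kernel q0 q1 q2.
  by apply: le_trans (total_kernel_pair _ _ _ _ _ _); rewrite addr_ge0// pair_kernel_ge0.
have a1 : 0 <= K1 * 2 ^+ (2 * k).+3 by rewrite mulr_ge0.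
have a2 : 0 <= 4 * K2 by rewrite mulr_ge0.
have a3 : 0 <= K2 * (2 ^+ k.+1 * 2 ^+ (2 * k).+1) by rewrite !mulr_ge0.
have fin K : 0 <= K -> K <= K1 * 2 ^+ (2 * k).+3 + 4 * K2 + K2 * (2 ^+ k.+1 * 2 ^+ (2 * k).+1) ->
    T * (sg q0 * sg q1 * sg q2) `^ (2 * be - 1) <= 8 * K * total_kernel q0 q1 q2 ->
    T * (sg q0 * sg q1 * sg q2) `^ (2 * be - 1) <=
    8 * (K1 * 2 ^+ (2 * k).+3 + 4 * K2 + K2 * (2 ^+ k.+1 * 2 ^+ (2 * k).+1)) *
    total_kernel q0 q1 q2.
  move=> K0 KK h; apply: le_trans h _; rewrite ler_wpM2r// ler_wpM2l//.
have [D|[aP Pb Pc D]] := der_dichotomy k h1.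
  apply: (fin (K1 * 2 ^+ (2 * k).+3)) => //; first lra.
  apply: max_der_bound => //; rewrite -mulrA; apply: le_trans H1 _.
  by rewrite ler_wpM2l.
have P0 : 0 < P := lt_le_trans ltr01 P1.
have {}H2 := H2 (_ : P <= 4 * `|q0.1|) Pb Pc.
have {}H2 : T * sg q0 `^ (8 * be - 1) <= K2 * P `^ c0 by apply: H2; rewrite aP -/P; lra.
have c00 : 0 <= c0 by rewrite addr_ge0// divr_ge0.
have Pc0 : 0 < P `^ c0 by exact: powR_gt0.
pose A := br q0.1 `^ c0.
have bE : br q0.1 = 1 + P by rewrite /br aP.
have PA : P `^ c0 <= A.
  by rewrite /A bE ge0_ler_powR// ?nnegrE; clear -P0 P1; lra.
have AP : A <= 2 ^+ k.+1 * P `^ c0.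
  apply: (@le_trans _ _ ((2 * P) `^ c0)).
    by rewrite /A bE ge0_ler_powR// ?nnegrE; clear -P0 P1; lra.
  rewrite powRM ?(ltW P0)// ler_wpM2r ?powR_ge0// -powR_mulrn//.
  rewrite ler_powR ?ler1n// /c0 -[k.+1%:R]natr1; lra.
have e1 : 2 * q1.1 + 1 * q0.1 = q1.1 - q2.1 by clear -h1; lra.
have e2 : 2 * q2.1 + 1 * q0.1 = - (q1.1 - q2.1) by clear -h1; lra.
have A0 : 0 < A by apply: lt_le_trans PA.
(* Below the scale A^-1 the localization applies, above it the derivative. *)
have [near|far] := leP (`|q1.1 - q2.1| * A) 1.
  apply: (fin (4 * K2)) => //; first by clear -a1 a2 a3; lra.
  have g (y : R) : `|y| = `|q1.1 - q2.1| ->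
      P `^ c0 / 4 <= A * gam (1 / 2) (A * y).
    move=> yE; apply: ler_pM => //.
    - by rewrite ltW.
    - by rewrite -div1r; apply: gam_half_ge; rewrite normrM yE gtr0_norm// mulrC.
  apply: (@max_aff_bound _ _ _ _ _ (P `^ c0 / 4) c0 2 1) => //.
  - by have [] := pair_kernel_ge be e k q0 q1.
  - by have [] := pair_kernel_ge be e k q0 q2.
  - by apply: g; rewrite e1.
  - by apply: g; rewrite e2 normrN.
  - by apply: le_trans H2 _; rewrite le_eqVlt; apply/orP; left; apply/eqP; field.
apply: (fin (K2 * (2 ^+ k.+1 * 2 ^+ (2 * k).+1))) => //; first by clear -a1 a2 a3; lra.
apply: max_der_bound => //; apply: le_trans H2 _.
rewrite -!mulrA ler_wpM2l//.
have PP : P ^+ (2 * k).+1 = P `^ c0 * P `^ c0.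
  rewrite -powRD ?(gt_eqF P0) ?implybT// -powR_mulrn ?(ltW P0)//.
  by congr (_ `^ _); rewrite /c0 -[(2 * k).+1%:R]natr1 natrM; field.
rewrite PP -/P in D.
have h4 : P `^ c0 * 1 <= 2 ^+ k.+1 * (`|q1.1 - q2.1| * (P `^ c0 * P `^ c0)).
  have -> : 2 ^+ k.+1 * (`|q1.1 - q2.1| * (P `^ c0 * P `^ c0)) =
     P `^ c0 * (`|q1.1 - q2.1| * (2 ^+ k.+1 * P `^ c0)) by ring.
  rewrite ler_wpM2l ?powR_ge0//; apply: le_trans (ltW far) _.
  by rewrite ler_wpM2l.
rewrite mulr1 in h4; apply: le_trans h4 _.
by rewrite ler_wpM2l// exprn_ge0.
Qed.

End hh.

Section high_high_logs.
Context {R : realType}.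

(** The monomial inequalities behind [high_high_monomials], in logarithms: [p] is the
    logarithm of the largest frequency, the [a]s and [n]s those of the
    frequencies and of their brackets, [ls] that of the dominant modulation and
    [t] is [ln 2].  In each regime the smallest frequency is free and the other two
    are equal to [p] up to [t], or all three are up to [2 * t]; the hypothesis on [be] makes the remaining
    exponents nonnegative at both ends of the range of the free one. *)
Lemma high_high_log (be r k a0 a1 a2 n0 n1 n2 p ls t : R) :
  0 <= be -> be <= 1 / 36 -> 0 <= r -> 0 <= k ->
  8 * (2 * k + 3) * be <= k + 3 / 4 - r ->
  0 <= t -> 0 <= p -> a0 <= p -> a1 <= p -> a2 <= p -> 0 <= a1 -> 0 <= a2 ->
  0 <= n0 -> a0 <= n0 -> n1 <= a1 + t -> n2 <= a2 + t ->
  a0 + a1 + a2 + 2 * k * p - t <= ls ->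
  let L := 2 * a0 - 2 * r * n0 + 2 * r * n1 + 2 * r * n2 + (8 * be - 1) * ls in
  [/\ p - t <= a1 -> p - t <= a2 -> L <= (8 * r + 7) * t + a0 + (2 * k + 1) * p,
      p - t <= a0 -> p - t <= a2 -> L <= (8 * r + 7) * t + a1 + (2 * k + 1) * p,
      p - t <= a0 -> p - t <= a1 -> L <= (8 * r + 7) * t + a2 + (2 * k + 1) * p &
      p - 2 * t <= a0 -> p - 2 * t <= a1 -> p - 2 * t <= a2 ->
        L <= (8 * r + 7) * t + (k + 1 / 2) * p].
Proof.
move=> b0 b1 r0 k0 H t0 p0 a0p a1p a2p a10 a20 n00 n0a n1a n2a ls0 L.
have bk : 0 <= be * k by apply: mulr_ge0.
have bk1 : be * k <= 1 / 36 * k by apply: ler_wpM2r.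
have kr : 0 <= k + 3 / 4 - r by apply: le_trans H; lra.
have bt : 0 <= be * t by apply: mulr_ge0.
have rt : 0 <= r * t by apply: mulr_ge0.
have c0 : 0 <= 1 - 8 * be by lra.
have A0 : 0 <= 4 * k + 1 - 16 * be * (k + 1) by lra.
have A1 : 0 <= 4 * k + 3 - 4 * r - 8 * (2 * k + 3) * be by clear -H kr; lra.
have A2 : 0 <= 4 * k + 3 - 2 * r - 8 * (2 * k + 3) * be by clear -A1 r0; lra.
have A3 : 0 <= 3 * k + 3 / 2 - 2 * r - 8 * (2 * k + 3) * be by clear -H kr k0; lra.
have pn1 : 0 <= r * (p + t - n1) by apply: mulr_ge0 => //; clear -n1a a1p; lra.
have pn2 : 0 <= r * (p + t - n2) by apply: mulr_ge0 => //; clear -n2a a2p; lra.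
rewrite /L; split => [h1 h2|h1 h2|h1 h2|h0 h1 h2].
- have p1 : 0 <= r * n0 by apply: mulr_ge0.
  have p4 : 0 <= (1 - 8 * be) * (ls - (a0 + 2 * (p - t) + 2 * k * p - t)).
    by apply: mulr_ge0 => //; clear -ls0 h1 h2; lra.
  have p5 : 0 <= be * (p - a0) by apply: mulr_ge0 => //; clear -a0p; lra.
  have p6 : 0 <= p * (4 * k + 3 - 4 * r - 8 * (2 * k + 3) * be) by apply: mulr_ge0.
  by clear -p1 pn1 pn2 p4 p5 p6 bt rt t0; lra.
- have p1 : 0 <= r * (n0 - p + t).
    by apply: mulr_ge0 => //; clear -n0a h1; lra.
  have p2 : 0 <= r * (a1 + t - n1) by apply: mulr_ge0 => //; clear -n1a; lra.
  have p4 : 0 <= (1 - 8 * be) * (ls - (a1 + 2 * (p - t) + 2 * k * p - t)).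
    by apply: mulr_ge0 => //; clear -ls0 h1 h2; lra.
  have p5 : 0 <= (p - a1) * (4 * k + 1 - 16 * be * (k + 1)).
    by apply: mulr_ge0 => //; clear -a1p; lra.
  have p6 : 0 <= a1 * (4 * k + 3 - 2 * r - 8 * (2 * k + 3) * be) by apply: mulr_ge0.
  by clear -p1 p2 pn2 p4 p5 p6 bt rt t0 h1 h2 a0p; lra.
- have p1 : 0 <= r * (n0 - p + t).
    by apply: mulr_ge0 => //; clear -n0a h1; lra.
  have p2 : 0 <= r * (a2 + t - n2) by apply: mulr_ge0 => //; clear -n2a; lra.
  have p4 : 0 <= (1 - 8 * be) * (ls - (a2 + 2 * (p - t) + 2 * k * p - t)).
    by apply: mulr_ge0 => //; clear -ls0 h1 h2; lra.
  have p5 : 0 <= (p - a2) * (4 * k + 1 - 16 * be * (k + 1)).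
    by apply: mulr_ge0 => //; clear -a2p; lra.
  have p6 : 0 <= a2 * (4 * k + 3 - 2 * r - 8 * (2 * k + 3) * be) by apply: mulr_ge0.
  by clear -p1 p2 pn1 p4 p5 p6 bt rt t0 h1 h2 a0p; lra.
have p1 : 0 <= r * (n0 - p + 2 * t).
  by apply: mulr_ge0 => //; clear -n0a h0; lra.
have p4 : 0 <= (1 - 8 * be) * (ls - (3 * (p - 2 * t) + 2 * k * p - t)).
  by apply: mulr_ge0 => //; clear -ls0 h0 h1 h2; lra.
have p5 : 0 <= p * (3 * k + 3 / 2 - 2 * r - 8 * (2 * k + 3) * be) by apply: mulr_ge0.
by clear -p1 pn1 pn2 p4 p5 bt rt t0 a0p h0; lra.
Qed.

(** The square of the multiplier of the derivative of a product, in spaces of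
    regularity [- r]; the modulations are kept apart. *)
Definition sq_mult (r : R) (x0 x1 x2 : R) : R :=
  x0 ^+ 2 * (br x0 `^ (- (2 * r)) * br x1 `^ (2 * r) * br x2 `^ (2 * r)).

Lemma sq_mult_ge0 r x0 x1 x2 : 0 <= sq_mult r x0 x1 x2.
Proof. by rewrite mulr_ge0 ?sqr_ge0// !mulr_ge0// powR_ge0. Qed.

Lemma min3P (a b c : R) : [\/ a <= b /\ a <= c, b <= a /\ b <= c | c <= a /\ c <= b].
Proof.
have [ab|/ltW ba] := leP a b.
  have [ac|/ltW ca] := leP a c; first by constructor 1.
  by constructor 3; split => //; apply: le_trans ab.
have [bc|/ltW cb] := leP b c; first by constructor 2.
by constructor 3; split => //; apply: le_trans ba.
Qed.

Lemma half_sum_ln (a b c : R) : a + b + c = 0 -> 0 < `|b| -> `|a| <= `|b| ->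
  `|a| <= `|c| -> ln (half_sum a b c) - ln 2 <= ln `|b|.
Proof.
move=> h B ab ac.
have h1 : half_sum a b c <= 2 * `|b|.
  have := ler_normD a b; rewrite (_ : a + b = - c) ?normrN; last lra.
  rewrite /half_sum; lra.
have h2 : 0 < half_sum a b c.
  by rewrite /half_sum; have := normr_ge0 a; have := normr_ge0 c; lra.
by rewrite lerBlDl; apply: ler_ln_mul.
Qed.

Lemma quarter_ln (P a : R) : 0 < P -> 0 < a -> P <= 4 * a -> ln P - 2 * ln 2 <= ln a.
Proof.
move=> P0 A h; have f4 : 0 < 4 :> R by [].
have := ler_ln_mul P0 A f4 h.
rewrite (_ : 4 = 2 ^+ 2 :> R) ?lnXn//; last by ring.
by rewrite -[ln 2 *+ 2]mulr_natl lerBlDl.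
Qed.

Lemma le_mid (L t a b p : R) : a <= b -> L <= t + a + p -> L <= t + b + p.
Proof. by move=> ab h; apply: le_trans h _; rewrite lerD2r lerD2l. Qed.

(** The dominant modulation [s] is at least a third of the resonance, hence of
    the order of the product of the three frequencies times [P ^+ (2 k)]. *)
Lemma high_high_monomials (be r : R) (k : nat) (x0 x1 x2 s : R) :
  0 <= be -> be <= 1 / 36 -> 0 <= r ->
  8 * (2 * k%:R + 3) * be <= k%:R + 3 / 4 - r ->
  x0 + x1 + x2 = 0 -> 1 <= `|x1| -> 1 <= `|x2| -> 0 < s ->
  `|x0 ^+ (2 * k.+1).+1 + x1 ^+ (2 * k.+1).+1 + x2 ^+ (2 * k.+1).+1| <= 3 * s ->
  let P := half_sum x0 x1 x2 in
  let K := expR ((8 * r + 7) * ln 2) in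
  [/\ sq_mult r x0 x1 x2 * s `^ (8 * be - 1) <= K * (`|x0| * P ^+ (2 * k).+1),
      sq_mult r x0 x1 x2 * s `^ (8 * be - 1) <= K * (`|x1| * P ^+ (2 * k).+1),
      sq_mult r x0 x1 x2 * s `^ (8 * be - 1) <= K * (`|x2| * P ^+ (2 * k).+1) &
      P <= 4 * `|x0| -> P <= 4 * `|x1| -> P <= 4 * `|x2| ->
      sq_mult r x0 x1 x2 * s `^ (8 * be - 1) <= K * P `^ (k%:R + 1 / 2)].
Proof.
move=> b0 b1 r0 H hx x11 x21 s0 hs P K.
have [P0 P1 P2] := half_sum_max hx; rewrite -/P in P0 P1 P2.
have Pge1 : 1 <= P by apply: le_trans P1.
have Pgt0 : 0 < P by lra.
have [z|nz] := eqVneq x0 0.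
  rewrite /sq_mult z expr0n /= mul0r mul0r.
  by split => *; rewrite ?mulr_ge0 ?expR_ge0 ?exprn_ge0 ?powR_ge0// ltW.
have X0 : 0 < `|x0| by rewrite normr_gt0.
have X1 : 0 < `|x1| by lra.
have X2 : 0 < `|x2| by lra.
have t0 := @ln2_ge0 R.
have two : 0 < 2 :> R by [].
have leln (a b : R) : 0 < a -> 0 < b -> a <= b -> ln a <= ln b.
  by move=> a0 b0' ab; rewrite ler_ln ?posrE.
have n1 : ln (br x1) <= ln `|x1| + ln 2.
  by rewrite addrC; apply: ler_ln_mul; rewrite ?br_gt0// /br; lra.
have n2 : ln (br x2) <= ln `|x2| + ln 2.
  by rewrite addrC; apply: ler_ln_mul; rewrite ?br_gt0// /br; lra.
have n0 : ln `|x0| <= ln (br x0) by apply: leln; rewrite ?br_gt0// /br; lra.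
have lsE : ln `|x0| + ln `|x1| + ln `|x2| + 2 * k%:R * ln P - ln 2 <= ln s.
  have := resonance_ge k hx; rewrite -/P => hge.
  have Y0 : 0 < `|x0| * `|x1| * `|x2| * P ^+ (2 * k).
    by rewrite !mulr_gt0// exprn_gt0.
  have hle : `|x0| * `|x1| * `|x2| * P ^+ (2 * k) <= 2 * s by lra.
  have := ler_ln_mul Y0 s0 two hle.
  rewrite lnM ?posrE ?mulr_gt0 ?exprn_gt0// lnM ?posrE ?mulr_gt0// lnM ?posrE//.
  rewrite lnXn// -[ln P *+ _]mulr_natl natrM; lra.
have lP : 0 <= ln P by exact: ln_ge0.
have [c1 c2 c3 c4] := high_high_log b0 b1 r0 (ler0n R k) H t0 lP (leln _ _ X0 Pgt0 P0)
  (leln _ _ X1 Pgt0 P1) (leln _ _ X2 Pgt0 P2) (ln_ge0 x11) (ln_ge0 x21)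
  (ln_br_ge0 x0) n0 n1 n2 lsE.
have lhs : sq_mult r x0 x1 x2 * s `^ (8 * be - 1) = expR (2 * ln `|x0| -
    2 * r * ln (br x0) + 2 * r * ln (br x1) + 2 * r * ln (br x2) +
    (8 * be - 1) * ln s).
  rewrite /sq_mult -[x0 ^+ 2]real_normK ?num_real// (expRE 2 X0) !powRE ?br_gt0//.
  by rewrite -!expRD; congr expR; ring.
have rhs (x : R) : 0 < x -> K * (x * P ^+ (2 * k).+1) =
    expR ((8 * r + 7) * ln 2 + ln x + (2 * k%:R + 1) * ln P).
  move=> x0'; rewrite /K (expRE _ Pgt0) [X in X * expR _](lnE x0') -!expRD.
  by congr expR; rewrite -[(2 * k).+1%:R]natr1 natrM; ring.
have hx1 : x1 + x0 + x2 = 0 by rewrite -hx; ring.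
have hx2 : x2 + x0 + x1 = 0 by rewrite -hx; ring.
have hx1' : x1 + x2 + x0 = 0 by rewrite -hx; ring.
have hx2' : x2 + x1 + x0 = 0 by rewrite -hx; ring.
have hx' : x0 + x2 + x1 = 0 by rewrite -hx; ring.
have pE (a b c : R) : `|a| + `|b| + `|c| = `|x0| + `|x1| + `|x2| ->
   half_sum a b c = P by rewrite /P /half_sum => ->.
rewrite !rhs// !lhs !ler_expR.
have C4 : P <= 4 * `|x0| -> P <= 4 * `|x1| -> P <= 4 * `|x2| ->
   sq_mult r x0 x1 x2 * s `^ (8 * be - 1) <= K * P `^ (k%:R + 1 / 2).
  move=> h0 h1 h2; rewrite lhs powRE// /K -expRD ler_expR.
  by have := c4 (quarter_ln Pgt0 X0 h0) (quarter_ln Pgt0 X1 h1)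
    (quarter_ln Pgt0 X2 h2).
have lemin (a b : R) : 0 < `|a| -> 0 < `|b| -> `|a| <= `|b| -> ln `|a| <= ln `|b|.
  by move=> *; exact: leln.
have main : [/\ 2 * ln `|x0| - 2 * r * ln (br x0) + 2 * r * ln (br x1) +
   2 * r * ln (br x2) + (8 * be - 1) * ln s <=
   (8 * r + 7) * ln 2 + ln `|x0| + (2 * k%:R + 1) * ln P,
   2 * ln `|x0| - 2 * r * ln (br x0) + 2 * r * ln (br x1) +
   2 * r * ln (br x2) + (8 * be - 1) * ln s <=
   (8 * r + 7) * ln 2 + ln `|x1| + (2 * k%:R + 1) * ln P &
   2 * ln `|x0| - 2 * r * ln (br x0) + 2 * r * ln (br x1) +
   2 * r * ln (br x2) + (8 * be - 1) * ln s <=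
   (8 * r + 7) * ln 2 + ln `|x2| + (2 * k%:R + 1) * ln P].
  case: (min3P `|x0| `|x1| `|x2|) => -[m1 m2].
  - have g1 := half_sum_ln hx X1 m1 m2; have g2 := half_sum_ln hx' X2 m2 m1.
    rewrite pE// in g1; rewrite pE in g2; last by rewrite addrAC.
    have l3 := c1 g1 g2; have l1 := lemin _ _ X0 X1 m1; have l2 := lemin _ _ X0 X2 m2.
    by split => //; apply: le_mid l3.
  - have g1 := half_sum_ln hx1 X0 m1 m2; have g2 := half_sum_ln hx1' X2 m2 m1.
    rewrite pE in g1; last by rewrite [`|x1| + _]addrC.
    rewrite pE in g2; last by rewrite addrC addrA.
    have l3 := c2 g1 g2; have l1 := lemin _ _ X1 X0 m1; have l2 := lemin _ _ X1 X2 m2.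
    by split => //; apply: le_mid l3.
  - have g1 := half_sum_ln hx2 X0 m1 m2; have g2 := half_sum_ln hx2' X1 m2 m1.
    rewrite pE in g1; last by rewrite -addrA addrC.
    rewrite pE in g2; last by rewrite -addrA addrC [`|x1| + _]addrC.
    have l3 := c3 g1 g2; have l1 := lemin _ _ X2 X0 m1; have l2 := lemin _ _ X2 X1 m2.
    by split => //; apply: le_mid l3.
case: main => m1 m2 m3; split => // h0 h1 h2.
by have := C4 h0 h1 h2; rewrite lhs.
Qed.

End high_high_logs.

Section high_high_final.
Context {R : realType}.

Definition high_high_const (r : R) (k : nat) : R :=
  8 * (expR ((8 * r + 7) * ln 2) * 2 ^+ (2 * k).+3 +
    4 * expR ((8 * r + 7) * ln 2) +
    expR ((8 * r + 7) * ln 2) * (2 ^+ k.+1 * 2 ^+ (2 * k).+1)).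

Lemma high_high_const_ge0 r k : 0 <= high_high_const r k.
Proof. by rewrite mulr_ge0. Qed.

Variables (be e r : R) (k : nat).

(** One of the three modulations dominates; that frequency is held fixed.  The
    assumption that both factors have frequency at least 1 allows brackets
    to be replaced by absolute values. *)
Lemma high_high_bound (q0 q1 q2 : R * R) :
  q0.1 + q1.1 + q2.1 = 0 -> q0.2 + q1.2 + q2.2 = 0 ->
  0 <= e -> e <= be -> be <= 1 / 36 -> 0 <= r ->
  8 * (2 * k%:R + 3) * be <= k%:R + 3 / 4 - r ->
  1 <= `|q1.1| -> 1 <= `|q2.1| ->
  sq_mult r q0.1 q1.1 q2.1 * (sg k q0 * sg k q1 * sg k q2) `^ (2 * be - 1) <=
  high_high_const r k * total_kernel be e k q0 q1 q2.
Proof.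
rewrite /high_high_const.
move=> h1 h2 e0 eb b36 r0 H x11 x21.
have b0 := le_trans e0 eb.
have b6 : be <= 1 / 6 by lra.
set K := expR _; have K0 : 0 <= K by exact: expR_ge0.
have W0 := sq_mult_ge0 r q0.1 q1.1 q2.1.
have P1 : 1 <= half_sum q0.1 q1.1 q2.1.
  by have [_ h _] := half_sum_max h1; apply: le_trans h.
have pE (a b c : R) : `|a| + `|b| + `|c| = `|q0.1| + `|q1.1| + `|q2.1| ->
   half_sum a b c = half_sum q0.1 q1.1 q2.1 by rewrite /half_sum => ->.
have hsum := sg_sum_ge k h2.
have [s0|s0] := leP `|resonance k q0 q1 q2| (3 * sg k q0).
  have [m0 _ _ m4] := high_high_monomials b0 b36 r0 H h1 x11 x21 (sg_gt0 k q0) s0.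
  exact: high_high_core.
have [s1|s1] := leP `|resonance k q0 q1 q2| (3 * sg k q1).
  have [_ m1 _ m4] := high_high_monomials b0 b36 r0 H h1 x11 x21 (sg_gt0 k q1) s1.
  have h1' : q1.1 + q0.1 + q2.1 = 0 by rewrite [q1.1 + _]addrC.
  have h2' : q1.2 + q0.2 + q2.2 = 0 by rewrite [q1.2 + _]addrC.
  have pe := pE q1.1 q0.1 q2.1 (congr1 (fun x => x + _) (addrC _ _)).
  rewrite -total_kernel_swap01 [sg k q0 * _]mulrC.
  apply: high_high_core => //; rewrite ?pe//.
    by rewrite /resonance [q1.1 ^+ _ + _]addrC.
  by move=> *; exact: m4.
have s2 : `|resonance k q0 q1 q2| <= 3 * sg k q2 by lra.
have [_ _ m2 m4] := high_high_monomials b0 b36 r0 H h1 x11 x21 (sg_gt0 k q2) s2.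
have h1' : q2.1 + q1.1 + q0.1 = 0 by rewrite -addrA addrC [q1.1 + _]addrC.
have h2' : q2.2 + q1.2 + q0.2 = 0 by rewrite -addrA addrC [q1.2 + _]addrC.
have pe : half_sum q2.1 q1.1 q0.1 = half_sum q0.1 q1.1 q2.1.
  by apply: pE; rewrite -addrA addrC [`|q1.1| + _]addrC.
rewrite -total_kernel_swap02 (_ : sg k q0 * sg k q1 * sg k q2 =
  sg k q2 * sg k q1 * sg k q0); last by ring.
apply: high_high_core => //; rewrite ?pe//.
  by rewrite /resonance -addrA addrC [q1.1 ^+ _ + _]addrC.
by move=> *; exact: m4.
Qed.
End high_high_final.

(** * Interactions with a low frequency *)

Section gam_aux.
Context {R : realType}.
Implicit Types (x y e be : R).

Lemma gam_sum_ge x y e : 0 <= e -> e <= 1 -> br x <= br y ->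
  br y `^ (-1 - e) <= 4 * gam e (x + y).
Proof.
move=> e0 e1 xy.
have hb : br (x + y) <= 2 * br y.
  have := ler_normD x y; move: xy; rewrite /br; lra.
have t0 := @ln2_ge0 R.
rewrite /gam !powRE ?br_gt0// [X in _ <= X * _](_ : 4 = 2 ^+ 2); last by ring.
rewrite (@expRE _ _ 2)// -expRD ler_expR.
have hl := ler_ln_mul (br_gt0 _) (br_gt0 y) (ltr0Sn R 1) hb.
have : 0 <= (1 + e) * (ln 2 + ln (br y) - ln (br (x + y))).
  by apply: mulr_ge0; lra.
have : 0 <= (1 - e) * ln 2 by apply: mulr_ge0; lra.
lra.
Qed.

Lemma prod_le_gam x y be e : 0 <= e -> e <= be -> be <= 1 / 6 -> br x <= br y ->
  br x `^ (2 * be - 1) * br y `^ (2 * be - 1) <= gam e x.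
Proof.
move=> e0 eb b6 xy; rewrite /gam !powRE ?br_gt0// -expRD ler_expR.
have l0 := ln_br_ge0 x.
have lpq : ln (br x) <= ln (br y) by rewrite ler_ln ?posrE ?br_gt0.
have : 0 <= (1 - 2 * be) * (ln (br y) - ln (br x)) by apply: mulr_ge0; lra.
have : 0 <= (1 - 4 * be - e) * ln (br x) by apply: mulr_ge0; lra.
lra.
Qed.

End gam_aux.

Section low.
Context {R : realType}.
Variables (be e : R) (k : nat).
Hypotheses (e0 : 0 <= e) (eb : e <= be) (b36 : be <= 1 / 36).
Let m := (2 * k.+1).+1.
Local Notation sg := (sg k).
Local Notation resonance := (resonance k).
Local Notation total_kernel := (total_kernel be e k).

Lemma total_kernel_ge0 (q0 q1 q2 : R * R) : 0 <= total_kernel q0 q1 q2.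
Proof. by apply: le_trans (total_kernel_pair _ _ _ _ _ _); rewrite addr_ge0// pair_kernel_ge0. Qed.

Lemma powRDp (a r t : R) : 0 < a -> a `^ (r + t) = a `^ r * a `^ t.
Proof. by move=> a0; rewrite !powRE// mulrDl expRD. Qed.

Lemma powR_decr (a b r : R) : 0 < a -> a <= b -> r <= 0 -> b `^ r <= a `^ r.
Proof.
move=> a0 ab r0; have b0 : 0 < b by apply: lt_le_trans ab.
rewrite !powRE// ler_expR ler_wnM2l// ler_ln ?posrE//.
Qed.

Lemma powR_incr (a b r : R) : 0 < a -> a <= b -> 0 <= r -> a `^ r <= b `^ r.
Proof.
move=> a0 ab r0; have b0 : 0 < b by apply: lt_le_trans ab.
by rewrite !powRE// ler_expR ler_wpM2l// ler_ln ?posrE.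
Qed.

Lemma powR_le1 (a r : R) : 1 <= a -> r <= 0 -> a `^ r <= 1.
Proof. by move=> a1 r0; rewrite -[leRHS](powRr0 a) ler_powR. Qed.

Lemma gam_half_scale_ge (M N x : R) : 0 < N -> 0 <= M -> `|x| <= M * N ->
  N^-1 * (1 + M) ^- 2 <= N^-1 * gam (1 / 2) (N^-1 * x).
Proof.
move=> N0 M0 xM; have N1 : 0 < N^-1 by rewrite invr_gt0.
rewrite ler_wpM2l ?(ltW N1)// /gam.
apply: (@le_trans _ _ ((1 + M) `^ (-1 - 1 / 2))).
  rewrite -powR_invn ?addr_ge0//; rewrite ler_powR ?lerDl//; lra.
apply: powR_decr; [exact: br_gt0| |lra].
rewrite /br lerD2l normrM (gtr0_norm N1) mulrC ler_pdivrMr//.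
Qed.

(** When both free frequencies are at most of the size of the fixed one, the
    cut-off [kaff] alone suffices, at the price of its length [br q0.1]. *)
Lemma wide_bound (q0 q1 q2 : R * R) (T K M : R) :
  q0.2 + q1.2 + q2.2 = 0 -> 0 <= T -> 0 <= K -> 0 <= M ->
  `|q1.1| <= M * br q0.1 -> `|q2.1| <= M * br q0.1 ->
  T * br (md m q1 + md m q2) `^ (6 * be - 1 - e) * br q0.1 <= K ->
  T * (sg q1 * sg q2) `^ (2 * be - 1) <= 2 * (K * (1 + M) ^+ 2) * total_kernel q0 q1 q2.
Proof.
move=> h2 T0 K0 M0 x1M x2M H.
have b6 : be <= 1 / 6 by move: b36 => h; lra.
have c := conv_le e0 eb b6 (lexx (br (md m q1 + md m q2))).
apply: le_trans (ler_wpM2l T0 c) _.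
have P := total_kernel_pair be e k q0 q1 q2.
have [_ _ k1 _ _] := pair_kernel_ge be e k q0 q1.
have [_ _ k2 _ _] := pair_kernel_ge be e k q0 q2.
have N0 := br_gt0 q0.1.
have kE (p : R * R) : `|p.1| <= M * br q0.1 ->
    (br q0.1)^-1 * (1 + M) ^- 2 * gam e (md m p) <= kaff m e (-1) 1 0 q0 p.
  move=> pM; rewrite /kaff powR_inv1 ?(ltW N0)// [1 * p.1]mul1r mul0r addr0.
  apply: ler_wpM2r; first exact: gam_ge0.
  exact: (@gam_half_scale_ge M (br q0.1) p.1 N0 M0 pM).
have l1 := le_trans (kE _ x1M) k1; have l2 := le_trans (kE _ x2M) k2.
have g1 := gam_ge0 e (md m q1); have g2 := gam_ge0 e (md m q2).
have M1 : 0 < (1 + M) ^+ 2 by rewrite exprn_gt0// ltr_wpDr.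
set Y := br (md m q1 + md m q2).
have Yg : Y `^ (6 * be) * gam e (md m q1 + md m q2) = Y `^ (6 * be - 1 - e).
  by rewrite /gam -/Y -powRDp ?br_gt0//; congr (_ `^ _); ring.
set Z := Y `^ (6 * be - 1 - e) in H Yg.
have -> : T * (2 * Y `^ (6 * be) * gam e (md m q1 + md m q2) *
    (gam e (md m q1) + gam e (md m q2))) =
    2 * (T * Z) * (gam e (md m q1) + gam e (md m q2)) by rewrite -Yg; ring.
have l12 : (br q0.1)^-1 * (1 + M) ^- 2 * (gam e (md m q1) + gam e (md m q2)) <=
   total_kernel q0 q1 q2 by lra.
have H' : T * Z <= K * (br q0.1)^-1 by rewrite ler_pdivlMr.
apply: (@le_trans _ _ (2 * (K * (br q0.1)^-1) * (gam e (md m q1) + gam e (md m q2)))).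
  by rewrite ler_wpM2r ?addr_ge0// ler_wpM2l.
have l3 : (br q0.1)^-1 * (gam e (md m q1) + gam e (md m q2)) <=
    (1 + M) ^+ 2 * total_kernel q0 q1 q2.
  apply: le_trans (ler_wpM2l (ltW M1) l12).
  rewrite le_eqVlt; apply/orP; left; apply/eqP; field.
  by rewrite !gt_eqF// ltr_wpDr.
have := ler_wpM2l K0 l3; lra.
Qed.

(** A low frequency is far from the two others, so the differences of powers
    that involve it have full size. *)
Lemma low_der_ge (x0 x1 x2 : R) : x0 + x1 + x2 = 0 -> `|x1| <= 1 -> 4 < `|x0| ->
  `|x0| ^+ (2 * k.+1) <= 2 ^+ (2 * k.+1) * 2 * `|x1 ^+ (2 * k.+1) - x2 ^+ (2 * k.+1)| /\
  `|x0| ^+ (2 * k.+1) <= 2 ^+ (2 * k.+1) * 2 * `|x0 ^+ (2 * k.+1) - x1 ^+ (2 * k.+1)|.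
Proof.
move=> h x11 x04.
have key (y : R) : 2 <= `|y| -> `|y| ^+ (2 * k.+1) <= 2 * `|y ^+ (2 * k.+1) - x1 ^+ (2 * k.+1)|.
  move=> y2; rewrite -(even_pow y) -(even_pow x1).
  have h1 : `|x1| ^+ (2 * k.+1) <= 1 by rewrite exprn_ile1.
  have h2 : 2 <= `|y| ^+ (2 * k.+1).
    rewrite mulnS exprD; apply: (@le_trans _ _ (`|y| ^+ 2)); first by nra.
    by rewrite ler_peMr ?exprn_ge0// exprn_ege1//; lra.
  have := ler_norm (`|y| ^+ (2 * k.+1) - `|x1| ^+ (2 * k.+1)); lra.
have n0 : `|x0| <= 2 * `|x2|.
  have := ler_normD x1 x2; rewrite (_ : x1 + x2 = - x0) ?normrN; lra.
have e2 : (1 : R) <= 2 ^+ (2 * k.+1) by rewrite exprn_ege1// ler1n.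
split.
  have x22 : 2 <= `|x2| by lra.
  have h1 : `|x0| ^+ (2 * k.+1) <= 2 ^+ (2 * k.+1) * `|x2| ^+ (2 * k.+1).
    by rewrite -exprMn lerXn2r// nnegrE// mulr_ge0.
  apply: le_trans h1 _; rewrite -mulrA ler_wpM2l// distrC; exact: key.
have x02 : 2 <= `|x0| by lra.
apply: le_trans (key _ x02) _; by rewrite -mulrA ler_peMl.
Qed.

Lemma sqr_le_pow (x : R) : 1 <= x -> x ^+ 2 <= x ^+ (2 * k.+1).
Proof. by move=> x1; apply: ler_weXn2l => //; rewrite leq_pmulr. Qed.

(** The stronger decay [-1 - e] of the low-frequency modulation, provided by the
    low-frequency part of the norm, is used when that modulation dominates: the
    difference of powers for fixed [q1] is too small, so the frequency
    with the smaller of the two other modulations is integrated instead. *)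
Lemma low_gain_bound (q0 q1 q2 : R * R) :
  q0.1 + q1.1 + q2.1 = 0 -> q0.2 + q1.2 + q2.2 = 0 ->
  `|q1.1| <= 1 -> 4 < `|q0.1| ->
  `|q0.1| ^+ 2 * (sg q0 `^ (2 * be - 1) * sg q1 `^ (-1 - e) * sg q2 `^ (2 * be - 1)) <=
  8 * (2 ^+ (2 * k.+1) * 2) * total_kernel q0 q1 q2.
Proof.
move=> h1 h2 x11 x04.
have [d1 d2] := low_der_ge h1 x11 x04.
set C := 2 ^+ (2 * k.+1) * 2 in d1 d2 *.
have C0 : 0 <= C by rewrite mulr_ge0.
have b36' := b36; have e0' := e0; have eb' := eb.
have b6 : be <= 1 / 6 by lra.
have X1 : 1 <= `|q0.1| by lra.
have X2 := sqr_le_pow X1.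
have X0 : 0 <= `|q0.1| ^+ 2 by exact: exprn_ge0.
have s1e : sg q1 `^ (-1 - e) <= sg q1 `^ (2 * be - 1).
  by rewrite ler_powR ?sg_ge1//; lra.
have hsum := sg_sum_ge k h2.
have h1b : q2.1 + q0.1 + q1.1 = 0 by rewrite -h1; ring.
have h2b : q2.2 + q0.2 + q1.2 = 0 by rewrite -h2; ring.
have weak : `|q0.1| ^+ 2 * (sg q0 `^ (2 * be - 1) * sg q1 `^ (-1 - e) *
    sg q2 `^ (2 * be - 1)) <= `|q0.1| ^+ 2 * (sg q0 * sg q1 * sg q2) `^ (2 * be - 1).
  rewrite ler_wpM2l// !powRM ?mulr_ge0 ?(ltW (sg_gt0 _ _))//.
  by rewrite ler_wpM2r ?powR_ge0// ler_wpM2l ?powR_ge0.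
have [s0|s0] := leP `|resonance q0 q1 q2| (3 * sg q0).
  apply: le_trans weak _; apply: max_der_bound => //.
  apply: le_trans (le_trans X2 d1); rewrite ler_piMr//.
  by apply: powR_le1; [exact: sg_ge1|lra].
have [s2|s2] := leP `|resonance q0 q1 q2| (3 * sg q2).
  apply: le_trans weak _.
  rewrite -total_kernel_swap02 -total_kernel_swap12.
  rewrite (_ : sg q0 * sg q1 * sg q2 = sg q2 * sg q0 * sg q1); last by ring.
  apply: max_der_bound => //.
    rewrite (_ : resonance q2 q0 q1 = resonance q0 q1 q2); first exact: s2.
    by rewrite /resonance; ring.
  apply: le_trans (le_trans X2 d2); rewrite ler_piMr//.
  by apply: powR_le1; [exact: sg_ge1|lra].
have s01 : sg q0 <= sg q1 by clear -s0 s2 hsum; lra.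
have s21 : sg q2 <= sg q1 by clear -s0 s2 hsum; lra.
have half (p : R * R) : sg p <= sg q1 ->
    sg q1 `^ (-1 - e) <= 4 * gam e (md m p + md m q1).
  by move=> sp; apply: gam_sum_ge => //; lra.
have small (p q : R * R) : sg p <= sg q ->
    sg p `^ (2 * be - 1) * sg q `^ (2 * be - 1) <= gam e (md m p).
  by move=> pq; apply: prod_le_gam => //; lra.
have fin (p q a : R * R) D : sg p <= sg q -> sg p <= sg q1 ->
    kder e k.+1 a p = D * gam e (md m p + md m q1) * gam e (md m p) ->
    `|q0.1| ^+ 2 <= C * D -> kder e k.+1 a p <= total_kernel q0 q1 q2 ->
    `|q0.1| ^+ 2 * (sg p `^ (2 * be - 1) * sg q1 `^ (-1 - e) * sg q `^ (2 * be - 1))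
     <= 8 * C * total_kernel q0 q1 q2.
  move=> pq p1 kE hD kP.
  have P0 := total_kernel_ge0 q0 q1 q2.
  have g1 := gam_ge0 e (md m p + md m q1); have g2 := gam_ge0 e (md m p).
  have hs := ler_pM (mulr_ge0 (powR_ge0 _ _) (powR_ge0 _ _)) (powR_ge0 _ _)
    (small _ _ pq) (half _ p1).
  have hh := ler_pM X0 (mulr_ge0 (mulr_ge0 (powR_ge0 _ _) (powR_ge0 _ _))
    (powR_ge0 _ _)) hD hs.
  have -> : `|q0.1| ^+ 2 * (sg p `^ (2 * be - 1) * sg q1 `^ (-1 - e) *
     sg q `^ (2 * be - 1)) = `|q0.1| ^+ 2 * (sg p `^ (2 * be - 1) *
     sg q `^ (2 * be - 1) * sg q1 `^ (-1 - e)) by ring.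
  apply: le_trans hh _.
  have := ler_wpM2l C0 kP; rewrite kE.
  have := mulr_ge0 C0 P0; clear; lra.
have [s02|/ltW s20] := leP (sg q0) (sg q2).
  apply: (fin q0 q2 q2 `|q0.1 ^+ (2 * k.+1) - q1.1 ^+ (2 * k.+1)|) => //.
  - by rewrite (kderE _ _ h1b h2b).
  - exact: le_trans X2 d2.
  - rewrite -total_kernel_swap02 -total_kernel_swap12.
    apply: le_trans (total_kernel_pair _ _ _ _ _ _).
    have [kb _ _ _ _] := pair_kernel_ge be e k q2 q0.
    by apply: le_trans kb _; rewrite lerDl pair_kernel_ge0.
have -> : sg q0 `^ (2 * be - 1) * sg q1 `^ (-1 - e) * sg q2 `^ (2 * be - 1) =
  sg q2 `^ (2 * be - 1) * sg q1 `^ (-1 - e) * sg q0 `^ (2 * be - 1) by ring.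
have h1c : q0.1 + q2.1 + q1.1 = 0 by rewrite -h1; ring.
have h2c : q0.2 + q2.2 + q1.2 = 0 by rewrite -h2; ring.
apply: (fin q2 q0 q0 `|q2.1 ^+ (2 * k.+1) - q1.1 ^+ (2 * k.+1)|) => //.
- by rewrite (kderE _ _ h1c h2c).
- by rewrite distrC; exact: le_trans X2 d1.
- rewrite -total_kernel_swap12; apply: le_trans (total_kernel_pair _ _ _ _ _ _).
  have [kb _ _ _ _] := pair_kernel_ge be e k q0 q2.
  by apply: le_trans kb _; rewrite lerDl pair_kernel_ge0.
Qed.

End low.

Section low_near_bound.
Context {R : realType}.
Variables (be e : R) (k : nat).
Let m := (2 * k.+1).+1.
Local Notation sg := (sg k).
Local Notation resonance := (resonance k).
Local Notation total_kernel := (total_kernel be e k).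

Lemma powR_scale_le (c y r : R) : 1 <= c -> 0 < y -> r <= 1 ->
  (c * y) `^ r <= c * y `^ r.
Proof.
move=> c1 y0 r1; rewrite powRM ?(ltW y0)//; last by lra.
by rewrite ler_wpM2r ?powR_ge0// ler1_powR.
Qed.

(** Without the low-frequency part of the norm, the multiplier has to be
    smaller by the factor of the second bound on [T].  Let [X = |q0.1|].  If
    [sg q0] is at least the derivative [X ^+ (2 k + 2)], it provides the decay by itself;
    otherwise the factor is at most [2 / X], which leaves room for the loss in
    [conv_le]. *)
Lemma low_near_bound : 0 <= e -> e <= be -> be <= 1 / 36 ->
  exists2 K : R, 0 <= K & forall (q0 q1 q2 : R * R) (T : R),
  q0.1 + q1.1 + q2.1 = 0 -> q0.2 + q1.2 + q2.2 = 0 ->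
  `|q1.1| <= 1 -> 4 < `|q0.1| -> 0 <= T -> T <= `|q0.1| ^+ 2 ->
  T <= `|q0.1| ^+ 2 * (`|q0.1|^-1 + sg q0 / `|q0.1| ^+ m) ->
  T * (sg q0 * sg q1 * sg q2) `^ (2 * be - 1) <= K * total_kernel q0 q1 q2.
Proof.
move=> e0 eb b36.
pose C : R := 2 ^+ (2 * k.+1) * 2.
pose M : R := 1 + (2 * k.+1).+2%:R * 2 ^+ (2 * k.+1).
have C0 : 0 <= C by rewrite /C mulr_ge0.
have M1 : 1 <= M by rewrite /M lerDl mulr_ge0.
exists (2 * (2 * M * C)); first by rewrite !mulr_ge0//; lra.
move=> q0 q1 q2 T h1 h2 x11 x04 T0 T1 T2.
have [d1 _] := low_der_ge k h1 x11 x04; rewrite -/C in d1.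
set X := `|q0.1| in x04 T1 T2 d1.
have X0 : 0 < X by lra.
have XJ0 : 0 < X ^+ (2 * k.+1) by rewrite exprn_gt0.
have s1 := sg_ge1 k q0; have s0 := sg_gt0 k q0.
have b6 : be <= 1 / 6 by lra.
have hr : `|resonance q0 q1 q2| <= (M - 1) * X ^+ (2 * k.+1).
  have h1' : q1.1 + q0.1 + q2.1 = 0 by rewrite -h1; ring.
  have := resonance_le k.+1 h1'; rewrite -/m.
  have -> : q1.1 ^+ m + q0.1 ^+ m + q2.1 ^+ m = resonance q0 q1 q2 by rewrite /resonance -/m; ring.
  move=> /le_trans; apply.
  have hP : half_sum q1.1 q0.1 q2.1 <= 2 * X.
    have h := ler_normD q0.1 q1.1.
    have e2 : q0.1 + q1.1 = - q2.1 by apply/eqP; rewrite -addr_eq0 h1.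
    rewrite e2 normrN -/X in h; rewrite /half_sum -/X; clear -h x11 x04; lra.
  have hP0 : 0 <= half_sum q1.1 q0.1 q2.1 by rewrite /half_sum divr_ge0// !addr_ge0.
  have hPJ : half_sum q1.1 q0.1 q2.1 ^+ (2 * k.+1) <= 2 ^+ (2 * k.+1) * X ^+ (2 * k.+1).
    by rewrite -exprMn lerXn2r// nnegrE// mulr_ge0// ltW.
  rewrite /M addrAC subrr add0r -[leRHS]mulrA; apply: ler_pM;
    [by rewrite mulr_ge0|by rewrite exprn_ge0|by rewrite ler_piMr|exact: hPJ].
rewrite powRM3 ?sg_gt0// mulrA.
have [big|small] := leP (X ^+ (2 * k.+1)) (sg q0).
  have hB : sg q0 + `|resonance q0 q1 q2| <= M * sg q0.
    have := ler_wpM2l (_ : 0 <= M - 1) big; rewrite subr_ge0 => /(_ M1) h.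
    clear -h hr; lra.
  apply: (der_bound h1 h2 e0 eb b6 hB).
  - by rewrite mulr_ge0 ?powR_ge0.
  - by rewrite !mulr_ge0//; lra.
  apply: (@le_trans _ _ (M * X ^+ 2)); last first.
    have X1 : 1 <= X by lra.
    have := ler_wpM2l (_ : 0 <= M) (le_trans (sqr_le_pow k X1) d1).
    have M0 : 0 <= M by lra.
    have := mulr_ge0 (mulr_ge0 M0 C0) (normr_ge0 (q1.1 ^+ (2 * k.+1) - q2.1 ^+ (2 * k.+1))).
    move=> h3 /(_ M0) h4; clear -h3 h4; lra.
  have h6 : (M * sg q0) `^ (6 * be) <= M * sg q0 `^ (6 * be).
    by apply: powR_scale_le => //; lra.
  apply: (@le_trans _ _ (T * sg q0 `^ (2 * be - 1) * (M * sg q0 `^ (6 * be)))).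
    by rewrite ler_wpM2l// mulr_ge0 ?powR_ge0.
  have -> : T * sg q0 `^ (2 * be - 1) * (M * sg q0 `^ (6 * be)) =
     M * (T * sg q0 `^ (2 * be - 1 + 6 * be)) by rewrite (@powRDp _ (sg q0) (2 * be - 1) (6 * be))//; ring.
  rewrite ler_wpM2l//; first by lra.
  apply: le_trans T1; rewrite ler_piMr//; apply: powR_le1 => //; lra.
have hB : sg q0 + `|resonance q0 q1 q2| <= M * X ^+ (2 * k.+1).
  clear -hr small; lra.
apply: (der_bound h1 h2 e0 eb b6 hB).
- by rewrite mulr_ge0 ?powR_ge0.
- by rewrite !mulr_ge0//; lra.
have TX : T <= 2 * X.
  apply: le_trans T2 _.
  have h7 : sg q0 / X ^+ m <= X^-1.
    rewrite ler_pdivrMr ?exprn_gt0// /m exprS mulrA mulVf ?gt_eqF// mul1r.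
    exact: ltW.
  apply: (@le_trans _ _ (X ^+ 2 * (X^-1 + X^-1))).
    by rewrite ler_wpM2l ?exprn_ge0 ?(ltW X0)// lerD2l.
  rewrite le_eqVlt; apply/orP; left; apply/eqP; field; by rewrite gt_eqF.
have h6 : (M * X ^+ (2 * k.+1)) `^ (6 * be) <= M * (X ^+ (2 * k.+1)) `^ (6 * be).
  by apply: powR_scale_le => //; lra.
have h8 : sg q0 `^ (2 * be - 1) <= 1 by apply: powR_le1 => //; lra.
have h9 : X * (X ^+ (2 * k.+1)) `^ (6 * be) <= X ^+ (2 * k.+1).
  rewrite (expRE _ X0) [X in X * _ `^ _](lnE X0) powRE ?expR_gt0// expRK -expRD ler_expR.
  have lX : 0 <= ln X by apply: ln_ge0; lra.
  have kk : 1 + 12 * (k%:R + 1) * be <= 2 * (k%:R + 1).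
    have kr : 0 <= k%:R :> R by [].
    have := ler_wpM2l (_ : 0 <= 12 * (k%:R + 1)) b36.
    rewrite mulr_ge0 ?addr_ge0// => /(_ isT); clear -kr; lra.
  rewrite natrM -[k.+1%:R]natr1; have := ler_wpM2r lX kk; clear; lra.
apply: (@le_trans _ _ (2 * X * 1 * (M * (X ^+ (2 * k.+1)) `^ (6 * be)))).
  apply: ler_pM => //; rewrite ?powR_ge0 ?mulr_ge0 ?powR_ge0//.
  by apply: ler_pM => //; rewrite powR_ge0.
have M0 : 0 <= 2 * M by clear -M1; lra.
have := ler_wpM2l M0 (le_trans h9 d1); clear; lra.
Qed.

End low_near_bound.

(** * Time frequency far above the dispersion relation *)

Section far_pos_aux.
Context {R : realType}.
Implicit Types (x y L p be s : R).

Lemma lnXE (a : R) n : 0 < a -> ln (a ^+ n) = n%:R * ln a.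
Proof. by move=> a0; rewrite lnXn// mulr_natl. Qed.

(** A variant of [conv_le] for a sum of modulations comparable with [L]: the
    smaller modulation may be anywhere up to [L] without loss of a power of
    [L] beyond [4 * be], because the plateau profile keeps its mass. *)
Lemma plateau_pair be L x y : 0 <= be -> be <= 1 / 6 -> 1 <= L ->
  L <= 4 * br (x + y) ->
  (br x * br y) `^ (2 * be - 1) <=
  32 * L `^ (4 * be - 1) * (plateau (2 * be) L x + plateau (2 * be) L y).
Proof.
move=> b0 b6 L1 hL; have L0 : 0 < L by lra.
wlog yx : x y hL / br y <= br x.
  move=> W; have [?|/ltW ?] := leP (br y) (br x); first exact: W.
  by rewrite mulrC [plateau _ _ x + _]addrC; apply: W => //; rewrite addrC.
apply: (@le_trans _ _ (32 * L `^ (4 * be - 1) * plateau (2 * be) L y)); last first.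
  by rewrite ler_wpM2l ?mulr_ge0 ?powR_ge0// lerDr plateau_ge0.
have hx : L <= 8 * br x.
  have := ler_normD x y; move: yx hL; rewrite /br; clear; lra.
have t0 := @ln2_ge0 R.
have Y0 := br_gt0 y.
have ly0 := ln_br_ge0 y.
have lL0 : 0 <= ln L by exact: ln_ge0.
have lyx : ln (br y) <= ln (br x) by rewrite ler_ln ?posrE ?br_gt0.
have lhx : ln L <= 3 * ln 2 + ln (br x).
  have f8 : 0 < 8 :> R by [].
  have := ler_ln_mul L0 (br_gt0 x) f8 hx.
  by rewrite (_ : 8 = 2 ^+ 3 :> R) ?ln2X//; ring.
set u := L `^ (- (2 * be)) * br y `^ (2 * be).
have uE : u = expR (2 * be * (ln (br y) - ln L)).
  by rewrite /u !powRE// -expRD; congr expR; ring.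
have u0 : 0 < u by rewrite uE expR_gt0.
have pl c : 0 < c -> 1 + u <= c ->
    L `^ (- (2 * be)) * br y `^ (2 * be - 1) * c ^- 2 <= plateau (2 * be) L y.
  move=> c0 uc; rewrite /plateau -/u ler_wpM2l ?mulr_ge0 ?powR_ge0//.
  by rewrite lef_pV2 ?posrE ?exprn_gt0 ?ltr_wpDr ?(ltW u0)// lerXn2r// nnegrE
    ?(ltW c0)// addr_ge0// ltW.
have [yL|Ly] := leP (br y) L.
  have lyL : ln (br y) <= ln L by rewrite ler_ln ?posrE.
  have u1 : u <= 1.
    by rewrite uE -expR0 ler_expR mulr_ge0_le0 ?subr_le0// mulr_ge0.
  have two : 0 < 2 :> R by [].
  have u2 : 1 + u <= 2 by clear -u1; lra.
  have := pl 2 two u2 => h.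
  have P32 : 0 <= 32 * L `^ (4 * be - 1) by rewrite mulr_ge0 ?powR_ge0.
  apply: le_trans (ler_wpM2l P32 h).
  have -> : 32 * L `^ (4 * be - 1) * (L `^ (- (2 * be)) * br y `^ (2 * be - 1) * 2 ^- 2) =
    8 * (L `^ (4 * be - 1) * L `^ (- (2 * be)) * br y `^ (2 * be - 1)) by field.
  rewrite [X in _ <= X * _](_ : 8 = 2 ^+ 3); last by ring.
  rewrite (@expRE _ 2)// !powRE ?mulr_gt0 ?br_gt0// lnM ?posrE ?br_gt0// -!expRD ler_expR.
  have : 0 <= (1 - 2 * be) * (3 * ln 2 + ln (br x) - ln L) by apply: mulr_ge0; lra.
  have := mulr_ge0 b0 t0; clear; lra.
have lLy : ln L <= ln (br y) by rewrite ler_ln ?posrE// ltW.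
have u1 : 1 <= u.
  by rewrite uE -expR0 ler_expR mulr_ge0 ?subr_ge0// mulr_ge0.
have uu0 : 0 < 2 * u by rewrite mulr_gt0.
have u2 : 1 + u <= 2 * u by clear -u1; lra.
have := pl _ uu0 u2 => h.
have P32 : 0 <= 32 * L `^ (4 * be - 1) by rewrite mulr_ge0 ?powR_ge0.
apply: le_trans (ler_wpM2l P32 h).
have -> : 32 * L `^ (4 * be - 1) * (L `^ (- (2 * be)) * br y `^ (2 * be - 1) * (2 * u) ^- 2) =
    8 * (L `^ (4 * be - 1) * L `^ (- (2 * be)) * br y `^ (2 * be - 1) * (u^-1 * u^-1)).
  by field; rewrite gt_eqF.
have -> : u^-1 = expR (- (2 * be * (ln (br y) - ln L))) by rewrite uE expRN.
apply: (@le_trans _ _ (L `^ (4 * be - 1) * L `^ (- (2 * be)) * br y `^ (2 * be - 1) *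
   (expR (- (2 * be * (ln (br y) - ln L))) * expR (- (2 * be * (ln (br y) - ln L)))))).
  rewrite !powRE ?mulr_gt0 ?br_gt0// lnM ?posrE ?br_gt0// -!expRD ler_expR.
  have : 0 <= (1 - 2 * be) * (ln (br x) - ln (br y)) by apply: mulr_ge0; lra.
  have : 0 <= (1 - 6 * be) * (ln (br y) - ln L) by apply: mulr_ge0; lra.
  clear; lra.
rewrite ler_peMl// ?ler1n//.
by rewrite mulr_ge0 ?mulr_ge0 ?powR_ge0 ?expR_ge0.
Qed.

Lemma gam_halfE x : gam (1 / 2) x = expR (- (3 / 2) * ln (br x)).
Proof. by rewrite /gam powRE ?br_gt0//; congr expR; field. Qed.

Lemma far_factor_ge1 (X0 N1 N2 s : R) : 1 <= s -> 1 <= N1 -> 1 <= N2 ->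
  0 <= X0 -> X0 <= N1 + N2 ->
  X0 ^+ 2 * (N1 `^ (- (2 * s)) * N2 `^ (- (2 * s))) <=
  2 * (N1 `^ (- (3 / 2)) + N2 `^ (- (3 / 2))).
Proof.
move=> s1 n1 n2 x0 xN; have N10 : 0 < N1 by lra. have N20 : 0 < N2 by lra.
have dec N : 1 <= N -> N `^ (- (2 * s)) <= N ^- 2.
  move=> n; rewrite -powR_invn; last by lra.
  rewrite ler_powR//; lra.
have inv N : 1 <= N -> N ^- 2 <= N `^ (- (3 / 2)).
  move=> n; rewrite -powR_invn; last by lra.
  rewrite ler_powR//; lra.
apply: (@le_trans _ _ ((N1 + N2) ^+ 2 * (N1 ^- 2 * N2 ^- 2))).
  apply: ler_pM; rewrite ?exprn_ge0 ?mulr_ge0 ?powR_ge0//.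
    by rewrite lerXn2r ?nnegrE//; lra.
  by apply: ler_pM; rewrite ?powR_ge0 ?dec.
apply: (@le_trans _ _ (2 * (N1 ^- 2 + N2 ^- 2))); last first.
  by rewrite ler_wpM2l// lerD// inv.
have -> : 2 * (N1 ^- 2 + N2 ^- 2) = (2 * (N1 ^+ 2 + N2 ^+ 2)) * (N1 ^- 2 * N2 ^- 2).
  by field; rewrite !gt_eqF.
apply: ler_wpM2r.
  by rewrite mulr_ge0// invr_ge0 exprn_ge0// ltW.
have := sqr_ge0 (N1 - N2); clear; lra.
Qed.

(** The power of [L] controls [x0] through the first hypothesis when [x1] is
    comparable with [x0], and the product of all three through the second
    when [x1] is larger. *)
Lemma far_factor_lt1 (x0 x1 x2 L : R) (k : nat) : x0 + x1 + x2 = 0 ->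
  br x0 ^+ 3 <= L ->
  8 * (`|x0| * `|x1| * `|x2| * half_sum x0 x1 x2 ^+ (2 * k)) <= L ->
  `|x0| ^+ 2 * L `^ (- (7 / 6)) <= 32 * gam (1 / 2) x1.
Proof.
move=> h hN hS.
have [->|nz] := eqVneq x0 0; first by rewrite normr0 expr0n mul0r mulr_ge0 ?gam_ge0.
have X0 : 0 < `|x0| by rewrite normr_gt0.
have L0 : 0 < L by apply: lt_le_trans hN; rewrite exprn_gt0 ?br_gt0.
have t0 := @ln2_ge0 R.
have ln3 : 3 * ln (br x0) <= ln L.
  by rewrite -lnXE ?br_gt0// ler_ln ?posrE ?exprn_gt0 ?br_gt0.
have lx0 : ln `|x0| <= ln (br x0) by rewrite ler_ln ?posrE ?br_gt0// /br; lra.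
have n0 := ln_br_ge0 x0.
rewrite gam_halfE (expRE _ X0) powRE//.
rewrite [X in _ <= X * _](_ : 32 = 2 ^+ 5); last by ring.
rewrite (@expRE _ 2)// -!expRD ler_expR.
have [near|far] := leP (br x1) (8 * br x0).
  have f8 : 0 < 8 :> R by [].
  have := ler_ln_mul (br_gt0 x1) (br_gt0 x0) f8 near.
  rewrite (_ : 8 = 2 ^+ 3 :> R) ?ln2X; last by ring.
  clear -ln3 lx0 n0 t0; lra.
have b1 : 1 <= br x0 := br_ge1 x0.
have X1 : br x1 <= 2 * `|x1| by move: far b1; rewrite /br; clear; lra.
have X1' : 0 < `|x1| by have := br_gt0 x1; clear -X1; lra.
have X2 : br x1 <= 2 * `|x2|.
  have := ler_normD x0 x2; rewrite (_ : x0 + x2 = - x1) ?normrN; last by lra.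
  move: far b1; rewrite /br; clear; lra.
have [P0 P1 P2] := half_sum_max h.
have PP : 1 <= half_sum x0 x1 x2 ^+ (2 * k).
  rewrite exprn_ege1//; apply: le_trans P1.
  by move: far b1; rewrite /br; clear; lra.
have hL : `|x0| * br x1 ^+ 2 <= L.
  apply: le_trans hS.
  have h4 : br x1 ^+ 2 <= 4 * (`|x1| * `|x2|).
    rewrite expr2; have := ler_pM (ltW (br_gt0 x1)) (ltW (br_gt0 x1)) X1 X2.
    clear; lra.
  have := ler_wpM2l (ltW X0) h4.
  have Q0 : 0 <= `|x0| * `|x1| * `|x2| by rewrite !mulr_ge0.
  have := ler_wpM2l Q0 PP; clear -Q0; lra.
have : ln `|x0| + 2 * ln (br x1) <= ln L.
  by rewrite -lnXE ?br_gt0// -lnM ?posrE ?exprn_gt0 ?br_gt0// ler_ln ?posrE ?mulr_gt0 ?exprn_gt0 ?br_gt0.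
clear -ln3 lx0 n0 t0; lra.
Qed.

End far_pos_aux.

Section far_pos.
Context {R : realType}.

(** Large enough that, when the resonance has the size of the time frequency,
    the frequency [q0.1] is at most a quarter of the largest one; the summand 2
    makes the modulation comparable with the time frequency. *)
Definition far_const (k : nat) : R := 4 * (2 * k.+1).+2%:R * 4 ^+ (2 * k.+1) + 2.

Lemma far_const_ge2 k : 2 <= far_const k.
Proof. by rewrite /far_const lerDr !mulr_ge0. Qed.

Lemma br_triangle (x0 x1 x2 : R) : x0 + x1 + x2 = 0 -> `|x0| <= br x1 + br x2.
Proof.
move=> h; have := ler_normD x1 x2.
rewrite (_ : x1 + x2 = - x0) ?normrN /br; lra.
Qed.

Lemma sg_far k (q : R * R) : let m := (2 * k.+1).+1 in far_const k * br q.1 ^+ m <= br q.2 -> br q.2 <= 2 * sg k q.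
Proof.
move=> m h; have h2 := far_const_ge2 k.
have N0 : 0 <= br q.1 ^+ m by rewrite exprn_ge0// ltW// br_gt0.
have := ler_wpM2r N0 h2.
have hx : `|q.1 ^+ m| <= br q.1 ^+ m.
  by rewrite normrX lerXn2r ?nnegrE ?(ltW (br_gt0 _))// /br lerDr.
have := ler_normB q.2 (q.1 ^+ m); have := lerB_dist q.2 (q.1 ^+ m).
move: h hx N0; rewrite /sg /md /br -/m; clear; lra.
Qed.

(** If the resonance is small compared with the time frequency [L], then so is
    the modulation of [q0] compared with [L] up to a factor, and the sum of the
    two other modulations has size [L].  The kernel [klow] then needs
    only integrability in one of the space frequencies: this comes from the
    weights when [s >= 1], and from the room in the powers of [L] when
    [s < 1]. *)
Lemma far_pos_nonres (be e s : R) (k : nat) : let m := (2 * k.+1).+1 in 0 <= e -> e <= be -> be <= 1 / 36 ->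
  12 * m%:R * be <= 1 -> 3 * m%:R * be <= m%:R - s -> 0 <= s ->
  forall (q0 q1 q2 : R * R) (T : R),
  q0.1 + q1.1 + q2.1 = 0 -> q0.2 + q1.2 + q2.2 = 0 -> 0 <= T ->
  T <= `|q0.1| ^+ 2 * br q0.2 `^ (2 * s / m%:R) *
       (br q1.1 `^ (- (2 * s)) * br q2.1 `^ (- (2 * s))) ->
  far_const k * br q0.1 ^+ m <= br q0.2 ->
  4 * `|resonance k q0 q1 q2| <= br q0.2 ->
  T * (sg k q0 * sg k q1 * sg k q2) `^ (2 * be - 1) <= 64 * 32 * total_kernel be e k q0 q1 q2.
Proof.
move=> m e0 eb b36 b12 b3 s0 q0 q1 q2 T h1 h2 T0 TT hf hr.
set L := br q0.2 in TT hf hr.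
have L1 : 1 <= L := br_ge1 _.
have L0 : 0 < L := br_gt0 _.
have sL : L <= 2 * sg k q0 by exact: sg_far.
have b0 : 0 <= be by apply: le_trans eb.
have b6 : be <= 1 / 6 by clear -b36; lra.
have hmu : L <= 4 * br (md m q1 + md m q2).
  rewrite (md_sum k h2) brN.
  have := lerB_normD (md m q0) (resonance k q0 q1 q2).
  move: sL hr; rewrite /sg /br -/m; clear; lra.
have pp := plateau_pair b0 b6 L1 hmu.
set G := plateau (2 * be) L (md m q1) + plateau (2 * be) L (md m q2) in pp.
have G0 : 0 <= G by rewrite addr_ge0// plateau_ge0.
have hs0 : sg k q0 `^ (2 * be - 1) <= 2 * L `^ (2 * be - 1).
  rewrite !powRE ?sg_gt0// [X in _ <= X * _](@lnE _ 2)// -expRD ler_expR.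
  have := ler_ln_mul L0 (sg_gt0 k q0) (ltr0Sn R 1) sL => h.
  have : 0 <= (1 - 2 * be) * (ln 2 + ln (sg k q0) - ln L).
    by apply: mulr_ge0; clear -h b36; lra.
  have := mulr_ge0 b0 (@ln2_ge0 R); clear; lra.
pose ex := 2 * s / m%:R + 6 * be - 2.
pose W := br q1.1 `^ (- (2 * s)) * br q2.1 `^ (- (2 * s)).
have W0 : 0 <= W by rewrite mulr_ge0 ?powR_ge0.
have m0 : 0 < m%:R :> R by rewrite ltr0n.
have m3 : 3 <= m%:R :> R by rewrite ler_nat /m mulnS.
have mex : m%:R * ex = 2 * s + m%:R * (6 * be - 2).
  by rewrite /ex; field; rewrite gt_eqF.
pose g := gam (1 / 2) q1.1 + gam (1 / 2) q2.1.
have gg0 : 0 <= g by rewrite addr_ge0// gam_ge0.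
have F : `|q0.1| ^+ 2 * L `^ ex * W <= 32 * g.
  have [s1|s1] := leP 1 s.
    have ex0 : ex <= 0.
      by rewrite -(pmulr_rle0 _ m0) mex; clear -b3; lra.
    have := far_factor_ge1 s1 (br_ge1 q1.1) (br_ge1 q2.1) (normr_ge0 q0.1)
      (br_triangle h1).
    have -> : - (3 / 2) = -1 - 1 / 2 :> R by field.
    rewrite -/W -/(gam _ _) -/(gam _ _) -/g => h.
    apply: (@le_trans _ _ (`|q0.1| ^+ 2 * W)); last by clear -h gg0; lra.
    rewrite -mulrA ler_wpM2l ?exprn_ge0// ler_piMl// powR_le1//.
  have ex0 : ex <= - (7 / 6).
    by rewrite -(ler_pM2l m0) mex; clear -b12 m3 s1; lra.
  have W1 : W <= 1.
    rewrite /W -[1](mul1r 1); apply: ler_pM; rewrite ?powR_ge0// powR_le1 ?br_ge1//;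
      by clear -s0; lra.
  have N3 : br q0.1 ^+ 3 <= L.
    apply: (@le_trans _ _ (br q0.1 ^+ m)).
      by apply: ler_weXn2l; rewrite ?br_ge1// /m mulnS.
    apply: le_trans hf; rewrite ler_peMl ?exprn_ge0 ?(ltW (br_gt0 _))//.
    by have := far_const_ge2 k; clear; lra.
  have rg := resonance_ge k h1.
  have hS : 8 * (`|q0.1| * `|q1.1| * `|q2.1| * half_sum q0.1 q1.1 q2.1 ^+ (2 * k)) <= L.
    by move: rg hr; rewrite /resonance -/m; clear; lra.
  have := far_factor_lt1 h1 N3 hS => h.
  apply: (@le_trans _ _ (`|q0.1| ^+ 2 * L `^ (- (7 / 6)) * 1)).
    apply: ler_pM => //; first by rewrite mulr_ge0 ?exprn_ge0 ?powR_ge0.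
    by rewrite ler_wpM2l ?exprn_ge0// ler_powR.
  rewrite mulr1; apply: le_trans h _; rewrite ler_wpM2l// lerDl gam_ge0//.
have kl : g * G <= total_kernel be e k q0 q1 q2.
  apply: le_trans (total_kernel_pair _ _ _ _ _ _).
  have [_ _ _ k1 _] := pair_kernel_ge be e k q0 q1.
  have [_ _ _ k2 _] := pair_kernel_ge be e k q0 q2.
  apply: le_trans (lerD k1 k2).
  rewrite /klow -/L -/m !mul0r !addr0 ![1 * q0.1]mul1r.
  have -> : q1.1 + q0.1 = - q2.1 by apply/eqP; rewrite -addr_eq0 -h1; apply/eqP; ring.
  have -> : q2.1 + q0.1 = - q1.1 by apply/eqP; rewrite -addr_eq0 -h1; apply/eqP; ring.
  by rewrite !gamN /g /G le_eqVlt; apply/orP; left; apply/eqP; ring.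
rewrite powRM3 ?sg_gt0//.
apply: (@le_trans _ _ (`|q0.1| ^+ 2 * L `^ (2 * s / m%:R) * W *
   (2 * L `^ (2 * be - 1) * (32 * L `^ (4 * be - 1) * G)))).
  apply: ler_pM => //; first by rewrite mulr_ge0 ?powR_ge0.
  by apply: ler_pM; rewrite ?powR_ge0.
have -> : `|q0.1| ^+ 2 * L `^ (2 * s / m%:R) * W *
   (2 * L `^ (2 * be - 1) * (32 * L `^ (4 * be - 1) * G)) =
   64 * (`|q0.1| ^+ 2 * L `^ ex * W) * G.
  have -> : L `^ ex = L `^ (2 * s / m%:R) * (L `^ (2 * be - 1) * L `^ (4 * be - 1)).
    by rewrite !powRE// -!expRD; congr expR; rewrite /ex; ring.
  by ring.
have := ler_wpM2r G0 F; have := kl; clear; lra.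
Qed.

(** In the resonant case the two free frequencies are much larger than [q0.1]
    and [L] is at most of the order of [P ^+ m]; the weights of the factors
    absorb the one on [L], and the bound reduces to [high_high_bound] with [r = 0]. *)
Lemma far_pos (be e s : R) (k : nat) : let m := (2 * k.+1).+1 in 0 <= e -> e <= be -> be <= 1 / 36 ->
  12 * m%:R * be <= 1 -> 3 * m%:R * be <= m%:R - s -> 0 <= s -> s < m%:R ->
  exists2 K : R, 0 <= K & forall (q0 q1 q2 : R * R) (T : R),
  q0.1 + q1.1 + q2.1 = 0 -> q0.2 + q1.2 + q2.2 = 0 -> 0 <= T ->
  T <= `|q0.1| ^+ 2 * br q0.2 `^ (2 * s / m%:R) *
       (br q1.1 `^ (- (2 * s)) * br q2.1 `^ (- (2 * s))) ->
  far_const k * br q0.1 ^+ m <= br q0.2 ->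
  T * (sg k q0 * sg k q1 * sg k q2) `^ (2 * be - 1) <= K * total_kernel be e k q0 q1 q2.
Proof.
move=> m e0 eb b36 b12 b3 s0 sm.
have b0 : 0 <= be by apply: le_trans eb.
have m0 : 0 < m%:R :> R by rewrite ltr0n.
pose c : R := 4 * (2 * k.+1).+2%:R.
have c1 : 1 <= c.
  have : 1 <= (2 * k.+1).+2%:R :> R by rewrite ler1n.
  rewrite /c; clear; lra.
pose L1 := c * 2 ^+ m.
have L11 : 1 <= L1.
  have h : (1 : R) <= 2 ^+ m by rewrite exprn_ege1// ler1n.
  by rewrite /L1 mulr_ege1.
pose Kh : R := high_high_const 0 k; have Kh0 : 0 <= Kh := high_high_const_ge0 0 k.
pose K2 := (c `^ 2 * 2 `^ (2 * s)) * Kh.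
have K20 : 0 <= K2 by rewrite !mulr_ge0 ?powR_ge0.
pose K3 := 2 * (12 * L1 `^ 2 * (1 + 2) ^+ 2).
have K30 : 0 <= K3 by rewrite !mulr_ge0 ?powR_ge0// exprn_ge0.
exists (64 * 32 + K2 + K3); first by rewrite !addr_ge0.
move=> q0 q1 q2 T h1 h2 T0 TT hf.
have Pt0 := total_kernel_ge0 be e k q0 q1 q2.
have kp := mulr_ge0 K20 Pt0; have kp3 := mulr_ge0 K30 Pt0.
have [hr|hr] := leP (4 * `|resonance k q0 q1 q2|) (br q0.2).
  have := far_pos_nonres e0 eb b36 b12 b3 s0 h1 h2 T0 TT hf hr.
  by clear -Pt0 kp kp3; lra.
set L := br q0.2 in TT hf hr.
have L0 : 0 < L := br_gt0 _.
have [P0 P1 P2] := half_sum_max h1.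
set P := half_sum q0.1 q1.1 q2.1 in P0 P1 P2.
have rl := resonance_le k.+1 h1; rewrite -/P -/m in rl.
have rl' : L <= c * (`|q0.1| * P ^+ (2 * k.+1)).
  by rewrite /c; move: rl hr; rewrite /resonance -/m; clear; lra.
have X4 : 4 * `|q0.1| <= P.
  rewrite leNgt; apply/negP => h4.
  have Pn : 0 <= P by apply: le_trans P0.
  have h5 : P ^+ (2 * k.+1) <= 4 ^+ (2 * k.+1) * `|q0.1| ^+ (2 * k.+1).
    by rewrite -exprMn lerXn2r ?nnegrE// ?mulr_ge0// ltW.
  have h6 : `|q0.1| ^+ m <= br q0.1 ^+ m.
    by rewrite lerXn2r ?nnegrE ?(ltW (br_gt0 _))// /br lerDr.
  have h7 : 0 < br q0.1 ^+ m by rewrite exprn_gt0// br_gt0.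
  have c0 : 0 <= c by clear -c1; lra.
  have h8 : c * (`|q0.1| * P ^+ (2 * k.+1)) <= c * 4 ^+ (2 * k.+1) * br q0.1 ^+ m.
    apply: (@le_trans _ _ (c * (`|q0.1| * (4 ^+ (2 * k.+1) * `|q0.1| ^+ (2 * k.+1))))).
      by rewrite ler_wpM2l// ler_wpM2l.
    have -> : c * (`|q0.1| * (4 ^+ (2 * k.+1) * `|q0.1| ^+ (2 * k.+1))) =
      c * 4 ^+ (2 * k.+1) * `|q0.1| ^+ m by rewrite /m [_ ^+ (2 * k.+1).+1]exprS; ring.
    by rewrite ler_wpM2l// mulr_ge0.
  move: hf; rewrite /far_const -/c mulrDl => hf.
  by clear -h7 h8 hf rl'; lra.
have t2 : 0 <= 2 * s / m%:R by rewrite divr_ge0 ?mulr_ge0// ltW.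
have t2' : 2 * s / m%:R <= 2.
  by rewrite ler_pdivrMr//; clear -sm; lra.
have X12 : 3 * P <= 4 * `|q1.1| /\ 3 * P <= 4 * `|q2.1|.
  have e1 := ler_normD q0.1 q1.1; have e2 := ler_normD q0.1 q2.1.
  rewrite (_ : q0.1 + q1.1 = - q2.1) ?normrN in e1; last first.
    by apply/eqP; rewrite -addr_eq0 h1.
  rewrite (_ : q0.1 + q2.1 = - q1.1) ?normrN in e2; last first.
    by apply/eqP; rewrite -addr_eq0 -h1; apply/eqP; ring.
  by move: X4; rewrite /P /half_sum; clear -e1 e2; split; lra.
case: X12 => X1 X2.
have s1 := sg_ge1 k q0.
(* If all the frequencies are bounded, everything else is. *)
have [Pb|Pb] := leP 2 P; last first.
  have Pn : 0 <= P by apply: le_trans P0.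
  have LL : L <= L1.
    apply: le_trans rl' _; rewrite /L1 ler_wpM2l//; first by clear -c1; lra.
    rewrite /m exprS; apply: ler_pM => //; first by rewrite exprn_ge0.
      by clear -P0 Pb; lra.
    by rewrite lerXn2r ?nnegrE// ltW.
  have T1 : T <= 4 * L1 `^ 2.
    apply: le_trans TT _.
    have W1 : br q1.1 `^ (- (2 * s)) * br q2.1 `^ (- (2 * s)) <= 1.
      rewrite -[leRHS](mul1r 1); apply: ler_pM; rewrite ?powR_ge0// powR_le1 ?br_ge1//;
        by clear -s0; lra.
    rewrite -[leRHS]mulr1; apply: ler_pM => //.
    - by rewrite mulr_ge0 ?exprn_ge0 ?powR_ge0.
    - by rewrite mulr_ge0 ?powR_ge0.
    apply: ler_pM; rewrite ?exprn_ge0 ?powR_ge0//.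
      have X02 : `|q0.1| <= 2 by clear -P0 Pb; lra.
      by have := normr_ge0 q0.1; clear -X02; nra.
    apply: (@le_trans _ _ (L1 `^ (2 * s / m%:R))); first exact: powR_incr.
    by rewrite ler_powR.
  have N0 := br_ge1 q0.1.
  have U := @wide_bound _ be e k e0 eb b36 q0 q1 q2 (T * sg k q0 `^ (2 * be - 1))
    (12 * L1 `^ 2) 2 h2.
  rewrite powRM3 ?sg_gt0// mulrA; apply: le_trans (U _ _ _ _ _ _) _.
  - by rewrite mulr_ge0 ?powR_ge0.
  - by rewrite mulr_ge0 ?powR_ge0.
  - by [].
  - by clear -P1 Pb N0; lra.
  - by clear -P2 Pb N0; lra.
  - have p1 : sg k q0 `^ (2 * be - 1) <= 1 by apply: powR_le1 => //; clear -b36; lra.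
    have p2 : br (md m q1 + md m q2) `^ (6 * be - 1 - e) <= 1.
      by apply: powR_le1; [exact: br_ge1|clear -b36 e0; lra].
    have p3 : br q0.1 <= 3 by move: X4 Pb; rewrite /br; clear; lra.
    apply: (@le_trans _ _ (4 * L1 `^ 2 * 1 * 1 * 3)); last by clear; lra.
    apply: ler_pM => //; [by rewrite !mulr_ge0 ?powR_ge0|exact: ltW (br_gt0 _)|].
    apply: ler_pM => //; [by rewrite !mulr_ge0 ?powR_ge0|exact: powR_ge0|].
    by apply: ler_pM => //; exact: powR_ge0.
  rewrite -/K3; clear -kp kp3 Pt0; lra.
have P00 : 0 < P by clear -Pb; lra.
have x11 : 1 <= `|q1.1| by clear -X1 Pb; lra.
have x21 : 1 <= `|q2.1| by clear -X2 Pb; lra.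
have mc : 8 * (2 * k%:R + 3) * be <= k%:R + 3 / 4 - 0.
  have mE : m%:R = 2 * k%:R + 3 :> R.
    by rewrite /m mulnS !addSn add0n -addn3 natrD natrM.
  move: b12; rewrite mE => b12; have := ler0n R k; clear -b12; lra.
have hh := high_high_bound h1 h2 e0 eb b36 (lexx 0) mc x11 x21.
have wE : sq_mult 0 q0.1 q1.1 q2.1 = `|q0.1| ^+ 2.
  by rewrite /sq_mult mulr0 oppr0 !powRr0 !mulr1 real_normK ?num_real.
rewrite wE -/Kh in hh.
have TX : T <= (c `^ 2 * 2 `^ (2 * s)) * `|q0.1| ^+ 2.
  apply: le_trans TT _.
  have LP : L `^ (2 * s / m%:R) <= c `^ 2 * P `^ (2 * s).
    apply: (@le_trans _ _ ((c * P ^+ m) `^ (2 * s / m%:R))).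
      apply: powR_incr => //; apply: le_trans rl' _.
      rewrite ler_wpM2l//; first by clear -c1; lra.
      by rewrite /m exprS ler_wpM2r// exprn_ge0// ltW.
    rewrite powRM ?exprn_ge0 ?(ltW P00)//; last by clear -c1; lra.
    apply: ler_pM; rewrite ?powR_ge0//; first by rewrite ler_powR.
    rewrite -powR_mulrn ?(ltW P00)// -powRrM.
    by rewrite (_ : m%:R * (2 * s / m%:R) = 2 * s)//; field; rewrite gt_eqF.
  have N1 : br q1.1 `^ (- (2 * s)) <= 2 `^ (2 * s) * P `^ (- (2 * s)).
    have PN : P <= 2 * br q1.1 by move: X1; rewrite /br; clear -P00; lra.
    rewrite !powRE ?br_gt0// -expRD ler_expR.
    have := ler_ln_mul P00 (br_gt0 q1.1) (ltr0Sn R 1) PN => h.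
    have : 0 <= 2 * s * (ln 2 + ln (br q1.1) - ln P).
      by apply: mulr_ge0; clear -s0 h; lra.
    by clear; lra.
  have N2 : br q2.1 `^ (- (2 * s)) <= 1.
    by apply: powR_le1; [exact: br_ge1|clear -s0; lra].
  apply: (@le_trans _ _ (`|q0.1| ^+ 2 * (c `^ 2 * P `^ (2 * s)) *
     (2 `^ (2 * s) * P `^ (- (2 * s)) * 1))).
    apply: ler_pM; rewrite ?mulr_ge0 ?exprn_ge0 ?powR_ge0//.
      by rewrite ler_wpM2l ?exprn_ge0.
    by apply: ler_pM; rewrite ?powR_ge0.
  have PP : P `^ (2 * s) * P `^ (- (2 * s)) = 1 by rewrite -powRDp// subrr powRr0.
  have -> : `|q0.1| ^+ 2 * (c `^ 2 * P `^ (2 * s)) *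
     (2 `^ (2 * s) * P `^ (- (2 * s)) * 1) = c `^ 2 * 2 `^ (2 * s) * `|q0.1| ^+ 2 *
     (P `^ (2 * s) * P `^ (- (2 * s))) by ring.
  by rewrite PP mulr1.
have S0 : 0 <= (sg k q0 * sg k q1 * sg k q2) `^ (2 * be - 1) by exact: powR_ge0.
apply: le_trans (ler_wpM2r S0 TX) _.
have c20 : 0 <= c `^ 2 * 2 `^ (2 * s) by rewrite mulr_ge0 ?powR_ge0.
have h9 := ler_wpM2l c20 hh.
have h10 : c `^ 2 * 2 `^ (2 * s) * (Kh * total_kernel be e k q0 q1 q2) =
  K2 * total_kernel be e k q0 q1 q2 by rewrite /K2; ring.
rewrite h10 mulrA in h9; clear -kp kp3 Pt0 h9; lra.
Qed.

End far_pos.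

(** * Time frequency far below the dispersion relation *)

Section far_neg.
Context {R : realType}.

(** If [b] and [c] have the same sign nothing cancels; otherwise the difference
    of the powers contains the factor [|b| - |c| = |a|] times the derivative. *)
Lemma pair_sum_ge (a b c : R) (k : nat) : a + b + c = 0 ->
  `|a| * half_sum a b c ^+ (2 * k) <=
  2 ^+ (2 * k).+1 * `|b ^+ (2 * k).+1 + c ^+ (2 * k).+1|.
Proof.
move=> h; wlog cb : b c h / `|c| <= `|b|.
  move=> W; have [?|/ltW ?] := leP `|c| `|b|; first exact: W.
  rewrite (_ : half_sum a b c = half_sum a c b); last by rewrite /half_sum addrAC.
  by rewrite [b ^+ _ + _]addrC; apply: W => //; rewrite addrAC.
have e1 : (1 : R) <= 2 ^+ (2 * k).+1 by rewrite exprn_ege1// ler1n.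
have [P0 P1 P2] := half_sum_max h.
have oN (x : R) : x <= 0 -> x ^+ (2 * k).+1 = - `|x| ^+ (2 * k).+1.
  by move=> x0; rewrite (ler0_norm x0) odd_pow opprK.
have oP (x : R) : 0 <= x -> x ^+ (2 * k).+1 = `|x| ^+ (2 * k).+1.
  by move=> x0; rewrite (ger0_norm x0).
have hsum : `|a| <= `|b| + `|c|.
  by have := ler_normD b c; rewrite (_ : b + c = - a) ?normrN//; lra.
have hb2 : half_sum a b c <= 2 * `|b|.
  by rewrite /half_sum; clear -hsum cb; lra.
have hs0 : 0 <= half_sum a b c by apply: le_trans P0.
have same : `|b| ^+ (2 * k).+1 <= `|b ^+ (2 * k).+1 + c ^+ (2 * k).+1| ->
    `|a| * half_sum a b c ^+ (2 * k) <=
    2 ^+ (2 * k).+1 * `|b ^+ (2 * k).+1 + c ^+ (2 * k).+1|.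
  move=> hh; apply: (@le_trans _ _ ((2 * `|b|) ^+ (2 * k).+1)).
    rewrite exprS; apply: ler_pM; rewrite ?exprn_ge0//.
      by clear -P0 hb2; lra.
    by rewrite lerXn2r// nnegrE// mulr_ge0.
  by rewrite exprMn ler_wpM2l.
have diff : `|a| = `|b| - `|c| ->
   `|b| ^+ (2 * k).+1 - `|c| ^+ (2 * k).+1 <= `|b ^+ (2 * k).+1 + c ^+ (2 * k).+1| ->
    `|a| * half_sum a b c ^+ (2 * k) <=
    2 ^+ (2 * k).+1 * `|b ^+ (2 * k).+1 + c ^+ (2 * k).+1|.
  move=> na hh; have -> : half_sum a b c = `|b| by rewrite /half_sum na; field.
  rewrite na; apply: le_trans (powdiff_ge (2 * k) (normr_ge0 c) cb) _.
  by apply: le_trans hh _; rewrite ler_peMl.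
have pc : 0 <= `|c| ^+ (2 * k).+1 by rewrite exprn_ge0.
have pb : 0 <= `|b| ^+ (2 * k).+1 by rewrite exprn_ge0.
have [b0|/ltW b0] := leP 0 b; have [c0|/ltW c0] := leP 0 c.
- have eb := oP _ b0; have ec := oP _ c0.
  apply: same; rewrite eb ec; apply: le_trans (ler_norm _); clear -pc; lra.
- have eb := oP _ b0; have ec := oN _ c0.
  apply: diff; last by rewrite eb ec ler_norm.
  move: cb; rewrite (ger0_norm b0) (ler0_norm c0) (_ : a = - (b + c)); last by lra.
  by rewrite normrN => cb; rewrite ger0_norm; lra.
- have eb := oN _ b0; have ec := oP _ c0.
  apply: diff; last first.
    by rewrite eb ec -[leRHS]normrN; apply: le_trans (ler_norm _); clear; lra.
  move: cb; rewrite (ler0_norm b0) (ger0_norm c0) (_ : a = - (b + c)); last by lra.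
  by rewrite normrN => cb; rewrite ler0_norm; lra.
- have eb := oN _ b0; have ec := oN _ c0.
  apply: same; rewrite eb ec -[leRHS]normrN; apply: le_trans (ler_norm _); clear -pc; lra.
Qed.

(** The monomial inequality behind [far_neg], in logarithms, when the two free
    frequencies are the largest: [x], [p], [l] stand for the
    frequency [q0.1], the largest frequency and the time
    frequency [q0.2], the [n]s for the brackets of the free frequencies and the
    [s]s for the modulations. *)
Lemma far_neg_log (be e r k x p t l n1 n2 s0 s1 s2 a : R) :
  0 <= e -> e <= be -> be <= 1 / 36 -> 0 <= r -> 0 <= k ->
  8 * (2 * k + 3) * be <= k + 3 / 4 - r -> a * (2 * k + 3) = 2 * r -> a <= 1 ->
  0 <= t -> 0 <= x -> x <= p -> 0 <= l -> l <= (2 * k + 3) * x ->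
  n1 <= p + t -> n2 <= p + t -> (2 * k + 3) * x - t <= s0 ->
  x + 2 * (k + 1) * p - (2 * k + 5) * t <= s1 -> 0 <= s2 -> s2 <= s1 ->
  2 * x - a * l + 2 * r * n1 + 2 * r * n2 + (2 * be - 1) * (s0 + s1 + s2) <=
  (4 * r + 4 * k + 8) * t + 2 * (k + 1) * (p - t) - (1 + e) * s2 - (1 + e) * l.
Proof.
move=> e0 eb b36 r0 k0 H ha a1 t0 x0 xp l0 lx n1p n2p hs0 hs1 s20 s21.
have b0 : 0 <= be by apply: le_trans eb.
have p1 : 0 <= (1 + e - a) * ((2 * k + 3) * x - l) by apply: mulr_ge0; lra.
have p2 : 0 <= r * (p + t - n1) by apply: mulr_ge0; lra.
have p3 : 0 <= r * (p + t - n2) by apply: mulr_ge0; lra.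
have p4 : 0 <= (1 - 2 * be) * (s0 - ((2 * k + 3) * x - t)) by apply: mulr_ge0; lra.
have p5 : 0 <= (2 * be + e) * (s1 - s2) by apply: mulr_ge0; lra.
have p6 : 0 <= (1 - 4 * be - e) * (s1 - (x + 2 * (k + 1) * p - (2 * k + 5) * t)).
  by apply: mulr_ge0; lra.
have bk : 0 <= be * k by apply: mulr_ge0.
have bk1 : be * k <= 1 / 36 * k by apply: ler_wpM2r.
have kr : 0 <= k + 3 / 4 - r by apply: le_trans H; lra.
have A1 : 0 <= 4 * k + 4 - 4 * r - 10 * (k + 1) * be by clear -kr bk1 b36 H b0 bk; lra.
have A2 : 0 <= 4 * k + 3 - 2 * r - 8 * (2 * k + 3) * be by clear -kr H r0; lra.
have p7 : 0 <= (p - x) * (4 * k + 4 - 4 * r - 10 * (k + 1) * be).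
  by apply: mulr_ge0 => //; lra.
have p8 : 0 <= x * (4 * k + 3 - 2 * r - 8 * (2 * k + 3) * be) by apply: mulr_ge0.
have p9 : 0 <= (be - e) * ((2 * k + 3) * x + x + 2 * (k + 1) * p).
  have kx : 0 <= k * x by apply: mulr_ge0.
  have kp : 0 <= k * p by apply: mulr_ge0 => //; clear -x0 xp; lra.
  by apply: mulr_ge0; [clear -eb; lra|clear -kx kp x0 xp; lra].
have p10 : 0 <= be * t by apply: mulr_ge0.
have p11 : 0 <= (4 * be + e) * ((2 * k + 5) * t).
  by apply: mulr_ge0; [clear -e0 b0; lra|apply: mulr_ge0 => //; clear -k0; lra].
have hax : a * ((2 * k + 3) * x) = 2 * r * x by rewrite -ha; ring.
clear -p1 p2 p3 p4 p5 p6 p7 p8 p9 p10 p11 hax; lra.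
Qed.

(** The negative power of [br q0.2] exceeds that of the space weight only when
    [q0.2] is small.  Then the modulation of [q0] has the full size of
    [q0.1 ^+ m], and that of one free frequency, say [q1], is at least
    [|q0.1| * P ^+ (m - 1)].  If all frequencies are comparable a cut-off suffices;
    otherwise [q1] is fixed and [ktime] integrates over the small time
    frequency. *)
Lemma far_neg (be e r : R) (k : nat) : let m := (2 * k.+1).+1 in
  0 <= e -> e <= be -> be <= 1 / 36 -> 0 <= r ->
  8 * (2 * k%:R + 3) * be <= k%:R + 3 / 4 - r ->
  exists2 K : R, 0 <= K & forall (q0 q1 q2 : R * R) (T : R),
  q0.1 + q1.1 + q2.1 = 0 -> q0.2 + q1.2 + q2.2 = 0 -> 0 <= T ->
  T <= `|q0.1| ^+ 2 * br q0.2 `^ (- (2 * r / m%:R)) *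
       (br q1.1 `^ (2 * r) * br q2.1 `^ (2 * r)) ->
  2 ^+ (2 * m).+1 * br q0.2 <= br q0.1 ^+ m ->
  T * (sg k q0 * sg k q1 * sg k q2) `^ (2 * be - 1) <= K * total_kernel be e k q0 q1 q2.
Proof.
move=> m e0 eb b36 r0 H.
have b0 : 0 <= be by apply: le_trans eb.
have m0 : 0 < m%:R :> R by rewrite ltr0n.
have mE : m%:R = 2 * k%:R + 3 :> R.
  by rewrite /m mulnS !addSn add0n -addn3 natrD natrM.
have t0 := @ln2_ge0 R.
have k0 : 0 <= k%:R :> R by [].
pose Ka := expR ((12 * r + m%:R + 3) * ln 2).
pose Kb := expR ((4 * r + 4 * k%:R + 8) * ln 2).
exists (2 * (Ka * (1 + 4) ^+ 2) + Kb).
  by rewrite addr_ge0 ?mulr_ge0 ?exprn_ge0 ?expR_ge0.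
move=> q0 q1 q2 T h1 h2 T0 TT hf.
have Pt0 := total_kernel_ge0 be e k q0 q1 q2.
have kpa : 0 <= 2 * (Ka * (1 + 4) ^+ 2) * total_kernel be e k q0 q1 q2.
  by rewrite !mulr_ge0 ?exprn_ge0 ?expR_ge0.
have kpb : 0 <= Kb * total_kernel be e k q0 q1 q2 by rewrite mulr_ge0 ?expR_ge0.
set L := br q0.2 in TT hf.
have L1 : 1 <= L := br_ge1 _.
have L0 : 0 < L := br_gt0 _.
have [P0 P1 P2] := half_sum_max h1.
set P := half_sum q0.1 q1.1 q2.1 in P0 P1 P2.
have N4 : 4 <= br q0.1.
  rewrite leNgt; apply/negP => n4.
  have h : br q0.1 ^+ m <= 4 ^+ m.
    by rewrite lerXn2r ?nnegrE ?(ltW n4)// ltW// br_gt0.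
  have h' : 4 ^+ m = 2 ^+ (2 * m) :> R by rewrite exprM; congr (_ ^+ _); ring.
  have h3 : (1 : R) <= 2 ^+ (2 * m) by rewrite exprn_ege1// ler1n.
  rewrite h' in h; rewrite [2 ^+ (2 * m).+1]exprS in hf.
  have h4 : 0 <= 2 ^+ (2 * m) * (L - 1) by rewrite mulr_ge0 ?exprn_ge0// subr_ge0.
  by clear -h h3 hf h4; lra.
have X3 : 3 <= `|q0.1| by move: N4; rewrite /br; clear; lra.
have X0 : 0 < `|q0.1| by clear -X3; lra.
have N2X : br q0.1 <= 2 * `|q0.1| by rewrite /br; clear -X3; lra.
have Pp : 0 < P by clear -P0 X0; lra.
have LX : 2 ^+ m.+1 * L <= `|q0.1| ^+ m.
  have h : br q0.1 ^+ m <= 2 ^+ m * `|q0.1| ^+ m.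
    by rewrite -exprMn lerXn2r ?nnegrE ?mulr_ge0// ltW// br_gt0.
  have e2 : 0 < 2 ^+ m :> R by rewrite exprn_gt0.
  rewrite -(ler_pM2l e2); apply: le_trans h; apply: le_trans hf.
  by rewrite mulrA -exprD mul2n -addnn addnS.
have e2m : (2 : R) <= 2 ^+ m.+1.
  by rewrite exprS ler_peMr// exprn_ege1// ler1n.
have s0X : `|q0.1| ^+ m <= 2 * sg k q0.
  have h : `|q0.1| ^+ m <= `|q0.2 - q0.1 ^+ m| + `|q0.2|.
    rewrite -normrX; have := ler_normB (q0.2 - q0.1 ^+ m) q0.2.
    by rewrite (_ : q0.2 - q0.1 ^+ m - q0.2 = - q0.1 ^+ m) ?normrN//; ring.
  have := ler_wpM2r (ltW L0) e2m.
  move: LX h; rewrite /sg /md -/m /L /br; clear; lra.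
have XP : `|q0.1| ^+ m <= `|q0.1| * P ^+ (2 * k.+1).
  by rewrite /m exprS ler_wpM2l// lerXn2r// nnegrE// ltW.
have mu : `|q0.1| * P ^+ (2 * k.+1) <= 2 ^+ m.+1 * br (md m q1 + md m q2).
  have ps := pair_sum_ge k.+1 h1; rewrite -/P -/m in ps.
  have h : `|q1.1 ^+ m + q2.1 ^+ m| <= br (md m q1 + md m q2) - 1 + `|q0.2|.
    rewrite (md_sum k h2) brN /br /resonance /md -/m.
    have := ler_normB (q0.2 - q0.1 ^+ m + (q0.1 ^+ m + q1.1 ^+ m + q2.1 ^+ m)) q0.2.
    rewrite (_ : _ - q0.2 = q1.1 ^+ m + q2.1 ^+ m); last by ring.
    by clear; lra.
  have e2 : 0 <= 2 ^+ m :> R by rewrite exprn_ge0.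
  have := ler_wpM2l e2 h; move: ps LX XP; rewrite [2 ^+ m.+1]exprS /L {1}/br.
  by clear -e2; lra.
have two : 0 < 2 :> R by [].
have lmu : ln `|q0.1| + 2 * (k%:R + 1) * ln P - (m%:R + 1) * ln 2 <=
    ln (br (md m q1 + md m q2)).
  have e2 : 0 < 2 ^+ m.+1 :> R by rewrite exprn_gt0.
  have Z : 0 < `|q0.1| * P ^+ (2 * k.+1) by rewrite mulr_gt0// exprn_gt0.
  have := ler_ln_mul Z (br_gt0 _) e2 mu.
  rewrite lnM ?posrE ?exprn_gt0// !lnXE// natrM -[k.+1%:R]natr1 -[m.+1%:R]natr1.
  by clear; lra.
have ls0 : m%:R * ln `|q0.1| - ln 2 <= ln (sg k q0).
  have Z : 0 < `|q0.1| ^+ m by rewrite exprn_gt0.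
  have := ler_ln_mul Z (sg_gt0 k q0) two s0X.
  by rewrite lnXE//; clear; lra.
have lL : ln L <= m%:R * ln `|q0.1|.
  rewrite -lnXE// ler_ln ?posrE ?exprn_gt0//.
  have := ler_wpM2r (ltW L0) e2m; clear -LX L0; lra.
have lL0 : 0 <= ln L by exact: ln_ge0.
have lx0 : 0 <= ln `|q0.1| by apply: ln_ge0; clear -X3; lra.
have lxp : ln `|q0.1| <= ln P by rewrite ler_ln ?posrE.
have kr : 0 <= k%:R + 3 / 4 - r.
  by apply: le_trans H; rewrite !mulr_ge0// addr_ge0// mulr_ge0.
have [near|far] := leP P (4 * `|q0.1|).
  have U := @wide_bound _ be e k e0 eb b36 q0 q1 q2 (T * sg k q0 `^ (2 * be - 1)) Ka 4 h2.
  rewrite powRM3 ?sg_gt0// mulrA; apply: le_trans (U _ _ _ _ _ _) _.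
  - by rewrite mulr_ge0 ?powR_ge0.
  - exact: expR_ge0.
  - by [].
  - by rewrite /br; clear -P1 near; lra.
  - by rewrite /br; clear -P2 near; lra.
  - apply: (@le_trans _ _ (`|q0.1| ^+ 2 * 1 * (br q1.1 `^ (2 * r) * br q2.1 `^ (2 * r)) *
      sg k q0 `^ (2 * be - 1) * br (md m q1 + md m q2) `^ (6 * be - 1) * (2 * `|q0.1|))).
      have l1 : L `^ (- (2 * r / m%:R)) <= 1.
        by apply: powR_le1 => //; rewrite oppr_le0 divr_ge0 ?mulr_ge0// ltW.
      apply: ler_pM => //.
      + by rewrite !mulr_ge0 ?powR_ge0.
      + exact: ltW (br_gt0 _).
      apply: ler_pM; rewrite ?mulr_ge0 ?powR_ge0//; last first.
        by rewrite ler_powR ?br_ge1//; clear -e0; lra.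
      apply: ler_wpM2r; first exact: powR_ge0.
      apply: le_trans TT _; rewrite ler_wpM2r ?mulr_ge0 ?powR_ge0//.
      by rewrite ler_wpM2l ?exprn_ge0.
    have nb (x : R) : `|x| <= P -> ln (br x) <= ln `|q0.1| + 3 * ln 2.
      move=> xP; have h : br x <= 8 * `|q0.1|.
        by rewrite /br; clear -xP near X3; lra.
      have f8 : 0 < 8 :> R by [].
      have := ler_ln_mul (br_gt0 x) X0 f8 h.
      by rewrite (_ : 8 = 2 ^+ 3 :> R) ?ln2X; [rewrite addrC|ring].
    have n1 := nb _ P1; have n2 := nb _ P2.
    rewrite mulr1 (expRE _ X0) [X in _ * (_ * X)](lnE X0) !powRE ?sg_gt0 ?br_gt0//.
    rewrite [X in _ * (X * _)](@lnE _ 2)// -!expRD ler_expR /Ka.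
    have lmu2 : m%:R * ln `|q0.1| - (m%:R + 1) * ln 2 <= ln (br (md m q1 + md m q2)).
      apply: le_trans lmu; rewrite mE.
      have : 0 <= (k%:R + 1) * (ln P - ln `|q0.1|).
        by apply: mulr_ge0; [clear -k0; lra|clear -lxp; lra].
      by clear; lra.
    rewrite mE in lmu2 ls0 *.
    have p1 : 0 <= r * (ln `|q0.1| + 3 * ln 2 - ln (br q1.1)).
      by apply: mulr_ge0 => //; clear -n1; lra.
    have p2 : 0 <= r * (ln `|q0.1| + 3 * ln 2 - ln (br q2.1)).
      by apply: mulr_ge0 => //; clear -n2; lra.
    have p3 : 0 <= (1 - 2 * be) * (ln (sg k q0) - ((2 * k%:R + 3) * ln `|q0.1| - ln 2)).
      by apply: mulr_ge0; [clear -b36; lra|clear -ls0; lra].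
    have p4 : 0 <= (1 - 6 * be) * (ln (br (md m q1 + md m q2)) -
       ((2 * k%:R + 3) * ln `|q0.1| - (2 * k%:R + 3 + 1) * ln 2)).
      by apply: mulr_ge0; [clear -b36; lra|clear -lmu2; lra].
    have p5 : 0 <= ln `|q0.1| * (4 * k%:R + 3 - 4 * r - 8 * (2 * k%:R + 3) * be).
      by apply: mulr_ge0 => //; clear -H kr; lra.
    have p6 : 0 <= be * ln 2 by exact: mulr_ge0.
    have p7 : 0 <= be * (k%:R * ln 2) by rewrite !mulr_ge0.
    by clear -p1 p2 p3 p4 p5 p6 p7 t0; lra.
  by clear -kpb; lra.
have a1 : 2 * r / m%:R <= 1.
  by rewrite ler_pdivrMr// mE; clear -kr k0; lra.
have X12 : P <= 2 * `|q1.1| /\ P <= 2 * `|q2.1|.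
  have e1 := ler_normD q0.1 q1.1; have e2 := ler_normD q0.1 q2.1.
  rewrite (_ : q0.1 + q1.1 = - q2.1) ?normrN in e1; last first.
    by apply/eqP; rewrite -addr_eq0 h1.
  rewrite (_ : q0.1 + q2.1 = - q1.1) ?normrN in e2; last first.
    by apply/eqP; rewrite -addr_eq0 -h1; apply/eqP; ring.
  by move: far; rewrite /P /half_sum; clear -e1 e2; split; lra.
have P11 : 1 <= P by clear -P0 X3; lra.
have nb (x : R) : `|x| <= P -> ln (br x) <= ln P + ln 2.
  move=> xP; rewrite addrC; apply: ler_ln_mul => //; first exact: br_gt0.
  by rewrite /br; clear -xP P11; lra.
have n1 := nb _ P1; have n2 := nb _ P2.
(* p has the larger modulation of the two free frequencies and is fixed. *)
have core (p q : R * R) : sg k q <= sg k p ->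
    br (md m p + md m q) = br (md m q1 + md m q2) -> P <= 2 * `|q.1| ->
    ktime e k.+1 p q <= total_kernel be e k q0 q1 q2 -> p.2 + q.2 = - q0.2 ->
    sg k q0 * sg k q1 * sg k q2 = sg k q0 * sg k p * sg k q ->
    T * (sg k q0 * sg k q1 * sg k q2) `^ (2 * be - 1) <=
    Kb * total_kernel be e k q0 q1 q2.
  move=> qp bE Xq kP pq ->.
  apply: (@le_trans _ _ (Kb * ktime e k.+1 p q)); last by rewrite ler_wpM2l ?expR_ge0.
  have q0' : 0 < `|q.1| by clear -Xq Pp; lra.
  rewrite /ktime pq gamN -/m -(even_pow q.1) /gam -[br (md m q)]/(sg k q) -/L.
  apply: le_trans (ler_wpM2r (powR_ge0 _ _) TT) _.
  rewrite (expRE _ X0) (expRE _ q0') !powRE ?mulr_gt0 ?sg_gt0 ?br_gt0//.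
  rewrite !lnM ?posrE ?mulr_gt0 ?sg_gt0// -!expRD ler_expR.
  have lq : ln P <= ln 2 + ln `|q.1| by exact: ler_ln_mul.
  have lsqp : ln (sg k q) <= ln (sg k p) by rewrite ler_ln ?posrE ?sg_gt0.
  have lsq : 0 <= ln (sg k q) by exact: ln_br_ge0.
  have lsp : ln `|q0.1| + 2 * (k%:R + 1) * ln P - (2 * k%:R + 5) * ln 2 <= ln (sg k p).
    have hb : br (md m p + md m q) <= 2 * sg k p.
      have := ler_normD (md m p) (md m q); move: qp; rewrite /sg /br -/m; clear; lra.
    have := ler_ln_mul (br_gt0 _) (sg_gt0 k p) two hb.
    by rewrite bE; move: lmu; rewrite mE; clear; lra.
  rewrite mE in ls0 lL.
  have ha : 2 * r / m%:R * (2 * k%:R + 3) = 2 * r.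
    by rewrite -mE; field; rewrite gt_eqF.
  have := far_neg_log e0 eb b36 r0 k0 H ha a1 t0 lx0 lxp lL0 lL n1 n2 ls0 lsp lsq lsqp.
  rewrite natrM -[k.+1%:R]natr1.
  have : 0 <= (k%:R + 1) * (ln 2 + ln `|q.1| - ln P).
    by apply: mulr_ge0; [clear -k0; lra|clear -lq; lra].
  by clear; lra.
case: X12 => X1 X2.
suff main : T * (sg k q0 * sg k q1 * sg k q2) `^ (2 * be - 1) <=
    Kb * total_kernel be e k q0 q1 q2 by clear -main kpa; lra.
have [s21|/ltW s12] := leP (sg k q2) (sg k q1).
  apply: (core q1 q2) => //.
  - rewrite -total_kernel_swap01 -total_kernel_swap12; apply: le_trans (total_kernel_pair _ _ _ _ _ _).
    have [_ _ _ _ kt] := pair_kernel_ge be e k q1 q2.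
    by apply: le_trans kt _; rewrite lerDl pair_kernel_ge0.
  - by apply/eqP; rewrite -addr_eq0 -h2; apply/eqP; ring.
apply: (core q2 q1) => //.
- by rewrite addrC.
- rewrite -total_kernel_swap02; apply: le_trans (total_kernel_pair _ _ _ _ _ _).
  have [_ _ _ _ kt] := pair_kernel_ge be e k q2 q1.
  by apply: le_trans kt _; rewrite lerDl pair_kernel_ge0.
- by apply/eqP; rewrite -addr_eq0 -h2; apply/eqP; ring.
- by ring.
Qed.

End far_neg.

(** * Multiplier estimates over all frequencies *)

Section multiplier.
Context {R : realType}.

Lemma sq_mult_low_bounded (r : R) (x0 x1 x2 : R) : 0 <= r -> x0 + x1 + x2 = 0 ->
  `|x1| <= 1 -> `|x0| <= 4 -> sq_mult r x0 x1 x2 <= 16 * (2 `^ (2 * r) * 6 `^ (2 * r)).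
Proof.
move=> r0 h1 x11 x04.
have x2le : br x2 <= 6.
  have := ler_normD x0 x1; rewrite (_ : x0 + x1 = - x2); last by lra.
  by rewrite normrN /br; lra.
rewrite /sq_mult; apply: ler_pM; rewrite ?sqr_ge0 ?mulr_ge0 ?powR_ge0//.
  rewrite -real_normK ?num_real//; have := normr_ge0 x0; nra.
apply: ler_pM; rewrite ?mulr_ge0 ?powR_ge0//; last first.
  by apply: powR_incr; rewrite ?br_gt0 ?mulr_ge0.
rewrite -[leRHS]mul1r; apply: ler_pM; rewrite ?powR_ge0//.
  by apply: powR_le1; rewrite ?br_ge1// oppr_le0 mulr_ge0.
by apply: powR_incr; rewrite ?br_gt0 ?mulr_ge0// /br; lra.
Qed.

Lemma sq_mult_low (r : R) (x0 x1 x2 : R) : 0 <= r -> x0 + x1 + x2 = 0 ->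
  `|x1| <= 1 -> 4 < `|x0| -> sq_mult r x0 x1 x2 <= 4 `^ (2 * r) * `|x0| ^+ 2.
Proof.
move=> r0 h1 x11 x04.
have x2le : br x2 <= 2 * br x0.
  have := ler_normD x0 x1; rewrite (_ : x0 + x1 = - x2); last by lra.
  by rewrite normrN /br; lra.
rewrite /sq_mult real_normK ?num_real// mulrC ler_wpM2r ?sqr_ge0//.
apply: (@le_trans _ _ (br x0 `^ (- (2 * r)) * 2 `^ (2 * r) * (2 * br x0) `^ (2 * r))).
  apply: ler_pM; rewrite ?mulr_ge0 ?powR_ge0//; last first.
    by apply: powR_incr; rewrite ?br_gt0 ?mulr_ge0.
  rewrite ler_wpM2l ?powR_ge0//.
  by apply: powR_incr; rewrite ?br_gt0 ?mulr_ge0// /br; lra.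
rewrite (_ : 4 = 2 * 2 :> R); last by ring.
rewrite !powRM ?(ltW (br_gt0 _))// powRN le_eqVlt; apply/orP; left; apply/eqP.
by field; rewrite gt_eqF// powR_gt0// br_gt0.
Qed.

Lemma sq_mult_swap (r : R) (x0 x1 x2 : R) : sq_mult r x0 x2 x1 = sq_mult r x0 x1 x2.
Proof. by rewrite /sq_mult; ring. Qed.

Section params.
Variables (be e r : R) (k : nat).
Let m := (2 * k.+1).+1.

Lemma low_bounded (C : R) : 0 <= e -> e <= be -> be <= 1 / 36 -> 0 <= C ->
  forall (q0 q1 q2 : R * R) (T : R),
  q0.1 + q1.1 + q2.1 = 0 -> q0.2 + q1.2 + q2.2 = 0 ->
  `|q1.1| <= 1 -> `|q0.1| <= 4 -> 0 <= T -> T <= C ->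
  T * (sg k q0 * sg k q1 * sg k q2) `^ (2 * be - 1) <=
  2 * (C * 5 * (1 + 5) ^+ 2) * total_kernel be e k q0 q1 q2.
Proof.
move=> e0 eb b36 C0 q0 q1 q2 T h1 h2 x11 x04 T0 TC.
have X2 : `|q2.1| <= 5.
  have := ler_normD q0.1 q1.1; rewrite (_ : q0.1 + q1.1 = - q2.1); last by lra.
  by rewrite normrN; lra.
have X0 := normr_ge0 q0.1.
have U := @wide_bound _ be e k e0 eb b36 q0 q1 q2 T (C * 5) 5 h2 T0 _ _ _ _ _.
rewrite powRM3 ?sg_gt0// mulrA.
apply: (@le_trans _ _ (T * (sg k q1 * sg k q2) `^ (2 * be - 1))).
  rewrite -[leRHS]mulr1 -mulrA [sg k q0 `^ _ * _]mulrC mulrA.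
  rewrite ler_wpM2l ?mulr_ge0 ?powR_ge0//.
  by apply: powR_le1; rewrite ?sg_ge1//; lra.
apply: U => //.
- by rewrite mulr_ge0.
- by rewrite /br; lra.
- by rewrite /br; lra.
apply: ler_pM; rewrite ?mulr_ge0 ?powR_ge0 ?(ltW (br_gt0 _))//; last by rewrite /br; lra.
rewrite -[leRHS]mulr1; apply: ler_pM; rewrite ?powR_ge0//.
by apply: powR_le1; rewrite ?br_ge1//; lra.
Qed.

(** Outside the low frequencies the factor [C] times [sq_mult] is bounded by
    [high_high_bound].  A low frequency needs the additional decay in the last
    hypothesis, which holds for the part of the time weight that exceeds the space
    weight, see [excess_near_pos] and [excess_near_neg]. *)
Lemma near_mult_bound (C : R) : 0 <= e -> e <= be -> be <= 1 / 36 -> 0 <= r ->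
  8 * (2 * k%:R + 3) * be <= k%:R + 3 / 4 - r -> 0 <= C ->
  exists2 K : R, 0 <= K & forall (q0 q1 q2 : R * R) (T : R),
  q0.1 + q1.1 + q2.1 = 0 -> q0.2 + q1.2 + q2.2 = 0 -> 0 <= T ->
  T <= C * sq_mult r q0.1 q1.1 q2.1 ->
  (4 < `|q0.1| ->
   T <= C * sq_mult r q0.1 q1.1 q2.1 * (`|q0.1|^-1 + sg k q0 / `|q0.1| ^+ m)) ->
  T * (sg k q0 * sg k q1 * sg k q2) `^ (2 * be - 1) <= K * total_kernel be e k q0 q1 q2.
Proof.
move=> e0 eb b36 r0 H C0.
have [Kl Kl0 KL] := @low_near_bound _ be e k e0 eb b36.
pose Kh := high_high_const r k; have Kh0 : 0 <= Kh := high_high_const_ge0 r k.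
pose Cb : R := C * (16 * (2 `^ (2 * r) * 6 `^ (2 * r))).
have Cb0 : 0 <= Cb by rewrite /Cb !mulr_ge0 ?powR_ge0.
pose Cl : R := C * 4 `^ (2 * r).
have Cl0 : 0 <= Cl by rewrite /Cl mulr_ge0 ?powR_ge0.
have Cb1 : 0 <= 2 * (Cb * 5 * (1 + 5) ^+ 2) by rewrite !mulr_ge0 ?exprn_ge0.
have ClK : 0 <= Cl * Kl by rewrite mulr_ge0.
have CK : 0 <= C * Kh by rewrite mulr_ge0.
exists (C * Kh + 2 * (Cb * 5 * (1 + 5) ^+ 2) + Cl * Kl); first by rewrite !addr_ge0.
move=> q0 q1 q2 T h1 h2 T0 T1 T2.
have Pt0 := total_kernel_ge0 be e k q0 q1 q2.
have low (p q : R * R) : q0.1 + p.1 + q.1 = 0 -> q0.2 + p.2 + q.2 = 0 ->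
    `|p.1| <= 1 -> T <= C * sq_mult r q0.1 p.1 q.1 ->
    (4 < `|q0.1| ->
     T <= C * sq_mult r q0.1 p.1 q.1 * (`|q0.1|^-1 + sg k q0 / `|q0.1| ^+ m)) ->
    T * (sg k q0 * sg k p * sg k q) `^ (2 * be - 1) <=
    (2 * (Cb * 5 * (1 + 5) ^+ 2) + Cl * Kl) * total_kernel be e k q0 p q.
  move=> g1 g2 p1 S1 S2; have Pt := total_kernel_ge0 be e k q0 p q.
  rewrite [(_ + Cl * Kl) * _]mulrDl; have [x04|x04] := leP `|q0.1| 4.
    apply: (@le_trans _ _ (2 * (Cb * 5 * (1 + 5) ^+ 2) * total_kernel be e k q0 p q)).
      apply: low_bounded => //; apply: le_trans S1 _; rewrite ler_wpM2l//.
      exact: sq_mult_low_bounded.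
    by rewrite lerDl mulr_ge0.
  apply: (@le_trans _ _ (Cl * Kl * total_kernel be e k q0 p q)); last first.
    by rewrite lerDr mulr_ge0.
  have [Cl00|Clp] := eqVneq Cl 0.
    have -> : T = 0.
      apply/eqP; rewrite eq_le T0 andbT; apply: le_trans S1 _.
      apply: le_trans (ler_wpM2l C0 (sq_mult_low r0 g1 p1 x04)) _.
      by rewrite mulrA -/Cl Cl00 mul0r.
    by rewrite mul0r !mulr_ge0.
  have Cl1 : 0 < Cl by rewrite lt_neqAle eq_sym Clp.
  have -> : T = Cl * (Cl^-1 * T) by rewrite mulrA divff// mul1r.
  rewrite -[leLHS]mulrA -[leRHS]mulrA ler_wpM2l//.
  have X0 : 0 <= `|q0.1|^-1 + sg k q0 / `|q0.1| ^+ m.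
    by rewrite addr_ge0 ?invr_ge0// divr_ge0 ?exprn_ge0// ltW// sg_gt0.
  have W : C * sq_mult r q0.1 p.1 q.1 <= Cl * `|q0.1| ^+ 2.
    by rewrite /Cl -mulrA ler_wpM2l// sq_mult_low.
  apply: KL => //.
  - by rewrite mulr_ge0// invr_ge0.
  - by rewrite ler_pdivrMl//; apply: le_trans W.
  - rewrite ler_pdivrMl// mulrA; apply: le_trans (S2 x04) _.
    by rewrite ler_wpM2r.
rewrite -[C * Kh + _ + _]addrA [(C * Kh + _) * _]mulrDl.
have [x11|x11] := leP `|q1.1| 1.
  have L := low q1 q2 h1 h2 x11 T1 T2.
  by apply: le_trans L _; rewrite lerDr mulr_ge0.
have [x21|x21] := leP `|q2.1| 1.
  have L := low q2 q1; rewrite total_kernel_swap12 sq_mult_swap in L.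
  rewrite [sg k q0 * _ * _]mulrAC; apply: le_trans (L _ _ x21 T1 T2) _.
  - by rewrite addrAC.
  - by rewrite addrAC.
  by rewrite lerDr mulr_ge0.
apply: (@le_trans _ _ (C * Kh * total_kernel be e k q0 q1 q2)); last first.
  by rewrite lerDl mulr_ge0// addr_ge0.
apply: le_trans (ler_wpM2r (powR_ge0 _ _) T1) _.
by rewrite -[leLHS]mulrA -[leRHS]mulrA ler_wpM2l//; apply: high_high_bound => //; exact: ltW.
Qed.

(** The inverse of the modulation weight of a factor, with the gain that its norm
    provides at low frequencies. *)
Definition low_decay (q : R * R) : R :=
  sg k q `^ (if `|q.1| <= 1 then -1 - e else 2 * be - 1).

(** At low frequencies [low_decay] takes the place of the decay that [near_mult_bound]
    asks of the multiplier. *)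
Lemma mult_low_decay : 0 <= e -> e <= be -> be <= 1 / 36 -> 0 <= r ->
  8 * (2 * k%:R + 3) * be <= k%:R + 3 / 4 - r ->
  exists2 K : R, 0 <= K & forall q0 q1 q2 : R * R,
  q0.1 + q1.1 + q2.1 = 0 -> q0.2 + q1.2 + q2.2 = 0 ->
  sq_mult r q0.1 q1.1 q2.1 * (sg k q0 `^ (2 * be - 1) * low_decay q1 * low_decay q2) <=
  K * total_kernel be e k q0 q1 q2.
Proof.
move=> e0 eb b36 r0 H.
pose Kh := high_high_const r k; have Kh0 : 0 <= Kh := high_high_const_ge0 r k.
pose Cb : R := 16 * (2 `^ (2 * r) * 6 `^ (2 * r)).
have Cb0 : 0 <= Cb by rewrite /Cb !mulr_ge0 ?powR_ge0.
have Cb1 : 0 <= 2 * (Cb * 5 * (1 + 5) ^+ 2) by rewrite !mulr_ge0 ?exprn_ge0.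
pose Kl : R := 4 `^ (2 * r) * (8 * (2 ^+ (2 * k.+1) * 2)).
have Kl0 : 0 <= Kl by rewrite /Kl !mulr_ge0 ?powR_ge0 ?exprn_ge0.
exists (Kh + 2 * (Cb * 5 * (1 + 5) ^+ 2) + Kl); first by rewrite !addr_ge0.
move=> q0 q1 q2 h1 h2.
have Pt0 := total_kernel_ge0 be e k q0 q1 q2.
have lle q : low_decay q <= sg k q `^ (2 * be - 1).
  by rewrite /low_decay ler_powR ?sg_ge1//; case: ifP => _; lra.
have l0 q : 0 <= low_decay q by rewrite powR_ge0.
have low (p q : R * R) : q0.1 + p.1 + q.1 = 0 -> q0.2 + p.2 + q.2 = 0 ->
    `|p.1| <= 1 ->
    sq_mult r q0.1 p.1 q.1 * (sg k q0 `^ (2 * be - 1) * low_decay p * low_decay q) <=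
    (2 * (Cb * 5 * (1 + 5) ^+ 2) + Kl) * total_kernel be e k q0 p q.
  move=> g1 g2 p1; have Pt := total_kernel_ge0 be e k q0 p q.
  rewrite [(_ + Kl) * _]mulrDl; have [x04|x04] := leP `|q0.1| 4.
    apply: (@le_trans _ _ (2 * (Cb * 5 * (1 + 5) ^+ 2) * total_kernel be e k q0 p q)).
      apply: le_trans (low_bounded e0 eb b36 Cb0 g1 g2 p1 x04 (sq_mult_ge0 r q0.1 p.1 q.1) _).
        rewrite ler_wpM2l ?sq_mult_ge0// !powRM ?mulr_ge0 ?(ltW (sg_gt0 _ _))//.
        by rewrite !ler_pM// ?mulr_ge0 ?powR_ge0// ler_wpM2l ?powR_ge0.
      exact: sq_mult_low_bounded.
    by rewrite lerDl mulr_ge0.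
  apply: (@le_trans _ _ (Kl * total_kernel be e k q0 p q)); last first.
    by rewrite lerDr mulr_ge0.
  have W := sq_mult_low r0 g1 p1 x04.
  apply: le_trans (ler_wpM2r _ W) _; first by rewrite !mulr_ge0 ?powR_ge0.
  rewrite -[leLHS]mulrA /Kl -[leRHS]mulrA ler_wpM2l ?powR_ge0//.
  have L := @low_gain_bound _ be e k e0 eb b36 q0 p q g1 g2 p1 x04; apply: le_trans _ L.
  rewrite ler_wpM2l ?exprn_ge0// {1}/low_decay p1.
  by rewrite ler_wpM2l ?mulr_ge0 ?powR_ge0.
rewrite -[Kh + _ + _]addrA [(Kh + _) * _]mulrDl.
have [x11|x11] := leP `|q1.1| 1.
  have L := low q1 q2 h1 h2 x11.
  by apply: le_trans L _; rewrite lerDr mulr_ge0.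
have [x21|x21] := leP `|q2.1| 1.
  have L := low q2 q1; rewrite total_kernel_swap12 sq_mult_swap in L.
  rewrite [_ `^ _ * low_decay q1 * _]mulrAC; apply: le_trans (L _ _ x21) _.
  - by rewrite addrAC.
  - by rewrite addrAC.
  by rewrite lerDr mulr_ge0.
apply: (@le_trans _ _ (Kh * total_kernel be e k q0 q1 q2)); last first.
  by rewrite lerDl mulr_ge0// addr_ge0.
apply: (@le_trans _ _ (sq_mult r q0.1 q1.1 q2.1 *
    (sg k q0 * sg k q1 * sg k q2) `^ (2 * be - 1))); last first.
  by apply: high_high_bound => //; exact: ltW.
rewrite ler_wpM2l ?sq_mult_ge0// !powRM ?mulr_ge0 ?(ltW (sg_gt0 _ _))//.
by rewrite !ler_pM// ?mulr_ge0 ?powR_ge0// ler_wpM2l ?powR_ge0.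
Qed.

End params.
End multiplier.

(** * The excess of the time weight over the space weight *)

Section excess.
Context {R : realType}.

Lemma powR_pow_quot (N t : R) (m : nat) : 0 < N -> (0 < m)%N ->
  (N ^+ m) `^ (t / m%:R) = N `^ t.
Proof.
move=> N0 m0; rewrite !powRE ?exprn_gt0// lnXE//; congr expR.
by field; rewrite pnatr_eq0 -lt0n.
Qed.

(** The two weights agree when [br q.2 = br q.1 ^+ m], so the excess vanishes
    near the dispersion relation up to the modulation. *)
Definition excess (m : nat) (s : R) (q : R * R) : R :=
  Num.max 0 (br q.2 `^ (2 * s / m%:R) - br q.1 `^ (2 * s)).

Lemma excess_ge0 m s q : 0 <= excess m s q.
Proof. by rewrite /excess le_max lexx. Qed.

Lemma excess_le m s q : excess m s q <= br q.2 `^ (2 * s / m%:R).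
Proof. by rewrite /excess ge_max powR_ge0/= lerBlDr lerDl powR_ge0. Qed.

Lemma time_weight_le m s q :
  br q.2 `^ (2 * s / m%:R) <= br q.1 `^ (2 * s) + excess m s q.
Proof. by rewrite -lerBlDl /excess le_max lexx orbT. Qed.

Lemma br_modulation_le (m : nat) (q : R * R) :
  br q.2 <= `|q.1| ^+ m + br (md m q) /\ `|q.1| ^+ m <= br q.2 + br (md m q) - 2.
Proof.
rewrite /br /md -normrX; split.
  by have := ler_normD (q.2 - q.1 ^+ m) (q.1 ^+ m); rewrite subrK; lra.
have := ler_normB q.2 (q.2 - q.1 ^+ m).
by rewrite (_ : q.2 - (q.2 - q.1 ^+ m) = q.1 ^+ m); [lra|ring].
Qed.

(** For [s >= 0] the excess is present only if [br q.2] is larger than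
    [br q.1 ^+ m], and the relative increment is at most the modulation over
    [|q.1| ^+ m]; a power with exponent at most 2 of [1 + y] grows like [y] for
    bounded [y]. *)
Lemma excess_near_pos (m : nat) (s c : R) (q : R * R) : (0 < m)%N ->
  0 <= s -> s < m%:R -> 1 <= c -> br q.2 <= c * br q.1 ^+ m ->
  excess m s q <= c ^+ 2 * br q.1 `^ (2 * s) /\
  (0 < `|q.1| -> excess m s q <=
     (c + 1) * br q.1 `^ (2 * s) * (br (md m q) / `|q.1| ^+ m)).
Proof.
move=> m0 s0 sm c1 hc.
have m0' : 0 < m%:R :> R by rewrite ltr0n.
set N := br q.1; set L := br q.2.
have N0 : 0 < N := br_gt0 _.
have Nm0 : 0 < N ^+ m by rewrite exprn_gt0.
have a0 : 0 <= 2 * s / m%:R by rewrite divr_ge0 ?mulr_ge0// ltW.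
have a2 : 2 * s / m%:R <= 2 by rewrite ler_pdivrMr//; lra.
have Ns : 0 <= N `^ (2 * s) by apply: powR_ge0.
have c0 : 0 <= c by lra.
split.
  apply: le_trans (excess_le _ _ _) _.
  apply: (@le_trans _ _ ((c * N ^+ m) `^ (2 * s / m%:R))).
    by apply: powR_incr => //; exact: br_gt0.
  rewrite powRM ?(ltW Nm0)// powR_pow_quot// ler_wpM2r//.
  by rewrite -powR_mulrn// ler_powR.
move=> X0; have Xm0 : 0 < `|q.1| ^+ m by rewrite exprn_gt0.
have y0 : 0 <= br (md m q) / `|q.1| ^+ m by rewrite divr_ge0 ?ltW ?br_gt0.
have R0 : 0 <= (c + 1) * N `^ (2 * s) * (br (md m q) / `|q.1| ^+ m).
  by rewrite !mulr_ge0 ?addr_ge0.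
rewrite /excess ge_max R0/= -/N -/L.
have [LN|LN] := leP L (N ^+ m).
  apply: le_trans R0; rewrite subr_le0 -(@powR_pow_quot N _ m)//.
  by apply: powR_incr => //; exact: br_gt0.
pose y := L / N ^+ m - 1.
have yp : 0 <= y by rewrite /y subr_ge0 ler_pdivlMr// mul1r ltW.
have yc : y <= c - 1 by rewrite /y lerB// ler_pdivrMr.
have XN : `|q.1| ^+ m <= N ^+ m.
  by rewrite lerXn2r ?nnegrE ?(ltW N0)// /N /br; lra.
have yy : y <= br (md m q) / `|q.1| ^+ m.
  have [h _] := br_modulation_le m q.
  apply: (@le_trans _ _ (br (md m q) / N ^+ m)); last first.
    by rewrite ler_wpM2l ?(ltW (br_gt0 _))// lef_pV2.
  rewrite (_ : y = (L - N ^+ m) / N ^+ m); last first.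
    by rewrite /y mulrBl divff// gt_eqF.
  rewrite ler_wpM2r ?invr_ge0 ?(ltW Nm0)//.
  by move: h; rewrite -/L; lra.
have LE : L = N ^+ m * (1 + y).
  by rewrite /y addrC subrK mulrC divfK// gt_eqF.
rewrite LE powRM; [|exact: ltW|exact: addr_ge0].
rewrite powR_pow_quot//.
have e2 : (1 + y) `^ (2 * s / m%:R) <= (1 + y) ^+ 2.
  by rewrite -powR_mulrn; [rewrite ler_powR//; lra|lra].
have e3 : (1 + y) ^+ 2 - 1 <= (c + 1) * y.
  have := mulr_ge0 yp (_ : 0 <= c - 1 - y); rewrite subr_ge0 => /(_ yc).
  by rewrite expr2; lra.
rewrite [(c + 1) * _]mulrC -[leRHS]mulrA -{2}[N `^ (2 * s)]mulr1 -mulrBr ler_wpM2l//.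
have := ler_wpM2l (_ : 0 <= c + 1) yy; rewrite addr_ge0// => /(_ isT); lra.
Qed.

(** For negative regularity the excess is present only if [br q.2] is smaller
    than [br q.1 ^+ m].  The term [|q.1|^-1] comes from the relative
    difference between [br q.1 ^+ m] and [|q.1| ^+ m]. *)
Lemma excess_near_neg (m : nat) (r c : R) (q : R * R) : (0 < m)%N ->
  0 <= r -> 2 * r <= m%:R -> 1 <= c -> br q.1 ^+ m <= c * br q.2 ->
  excess m (- r) q <= c * br q.1 `^ (- (2 * r)) /\
  (0 < `|q.1| -> excess m (- r) q <=
     c * m%:R * br q.1 `^ (- (2 * r)) *
       (`|q.1|^-1 + br (md m q) / `|q.1| ^+ m)).
Proof.
move=> m0 r0 rm c1 hc.
have m0' : 0 < m%:R :> R by rewrite ltr0n.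
have m1 : 1 <= m%:R :> R by rewrite ler1n.
set N := br q.1; set L := br q.2.
have N1 : 1 <= N := br_ge1 _; have N0 : 0 < N := br_gt0 _.
have L0 : 0 < L := br_gt0 _.
have Nm0 : 0 < N ^+ m by rewrite exprn_gt0.
have a0 : 0 <= 2 * r / m%:R by rewrite divr_ge0 ?mulr_ge0// ltW.
have a1 : 2 * r / m%:R <= 1 by rewrite ler_pdivrMr// mul1r.
have Ns : 0 <= N `^ (- (2 * r)) by apply: powR_ge0.
have c0 : 0 <= c by lra.
have aE : 2 * - r / m%:R = - (2 * r / m%:R) by rewrite mulrN mulNr.
have nE : 2 * - r = - (2 * r) by rewrite mulrN.
have LN1 : L `^ (- (2 * r / m%:R)) <= c * N `^ (- (2 * r)).
  rewrite -(@powR_pow_quot N _ m)// mulNr !powRN -ler_pdivrMl; last by lra.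
  rewrite -invfM lef_pV2 ?posrE ?mulr_gt0 ?powR_gt0//; last by lra.
  apply: le_trans (powR_scale_le c1 L0 a1).
  by apply: powR_incr.
split; first by apply: le_trans (excess_le _ _ _) _; rewrite aE.
move=> X0; have Xm0 : 0 < `|q.1| ^+ m by rewrite exprn_gt0.
have y0 : 0 <= `|q.1|^-1 + br (md m q) / `|q.1| ^+ m.
  by rewrite addr_ge0 ?invr_ge0// divr_ge0 ?ltW ?br_gt0.
rewrite /excess ge_max; apply/andP; split; first by rewrite !mulr_ge0// ltW.
rewrite aE nE -/N -/L.
have [NL|LN] := leP (N ^+ m) L.
  apply: (@le_trans _ _ 0); last by rewrite !mulr_ge0// ltW.
  rewrite subr_le0 -(@powR_pow_quot N _ m)// mulNr.
  by apply: powR_decr => //; rewrite oppr_le0.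
have x1 : L / N ^+ m <= 1 by rewrite ler_pdivrMr// mul1r ltW.
have x0 : 0 < L / N ^+ m by rewrite divr_gt0.
have NE : N `^ (- (2 * r)) = L `^ (- (2 * r / m%:R)) * (L / N ^+ m) `^ (2 * r / m%:R).
  rewrite -(@powR_pow_quot N _ m)// powRM ?invr_ge0 ?ltW// !powRE ?invr_gt0//.
  by rewrite -!expRD lnV ?posrE//; congr expR; ring.
have xa : L / N ^+ m <= (L / N ^+ m) `^ (2 * r / m%:R).
  by rewrite -[leLHS]powRr1 ?(ltW x0)// !powRE// ler_expR ler_wnM2r// ln_le0.
rewrite {1}NE -{1}[L `^ _]mulr1 -mulrBr.
apply: (@le_trans _ _ (c * N `^ (- (2 * r)) * (1 - L / N ^+ m))).
  apply: ler_pM; rewrite ?powR_ge0//; last by lra.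
  by rewrite subr_ge0; have := powR_incr x0 x1 a0; rewrite powR1.
rewrite -[c * m%:R * _]mulrAC -[leRHS]mulrA ler_wpM2l ?mulr_ge0//.
rewrite (_ : 1 - L / N ^+ m = (N ^+ m - L) / N ^+ m); last first.
  by rewrite mulrBl divff// gt_eqF.
have XN : `|q.1| <= N by rewrite /N /br; lra.
have XNm : `|q.1| ^+ m <= N ^+ m by rewrite lerXn2r ?nnegrE ?(ltW N0).
have sN : br (md m q) / N ^+ m <= br (md m q) / `|q.1| ^+ m.
  by rewrite ler_wpM2l ?(ltW (br_gt0 _))// lef_pV2.
have iN : N^-1 <= `|q.1|^-1 by rewrite lef_pV2.
have [_ h] := br_modulation_le m q.
have d := powdiff_le m.-1 (normr_ge0 q.1) XN; rewrite prednK// in d.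
rewrite (_ : N - `|q.1| = 1) in d; last by rewrite /N /br addrK.
rewrite mulr1 in d.
apply: (@le_trans _ _ ((m%:R * N ^+ m.-1 + br (md m q)) / N ^+ m)).
  rewrite ler_wpM2r ?invr_ge0 ?(ltW Nm0)//.
  by move: d h; rewrite -/L; lra.
rewrite mulrDl (_ : m%:R * N ^+ m.-1 / N ^+ m = m%:R * N^-1); last first.
  have Nm : N ^+ m = N * N ^+ m.-1 by rewrite -exprS prednK.
  by rewrite Nm; field; rewrite expf_neq0 ?gt_eqF.
rewrite mulrDr lerD//; first by rewrite ler_wpM2l.
by apply: le_trans sN _; rewrite ler_peMl// divr_ge0 ?ltW ?br_gt0.
Qed.

Section mult.
Variables (be e s : R) (k : nat).
Let m := (2 * k.+1).+1.
Let r : R := Num.max 0 (- s).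

(** For [s >= 0] the weights cancel, because the bracket of a sum is at most the
    product of the brackets: nonnegative regularity reduces to regularity 0. *)
Lemma sq_mult_reduce (x0 x1 x2 : R) : x0 + x1 + x2 = 0 ->
  sq_mult (- s) x0 x1 x2 <= sq_mult r x0 x1 x2.
Proof.
move=> h1; rewrite /sq_mult ler_wpM2l ?sqr_ge0// /r.
have [s0|s0] := leP 0 s; last first.
  by rewrite (max_idPr _)// oppr_ge0 ltW.
rewrite (max_idPl _) ?oppr_le0// !mulr0 oppr0 !powRr0 !mulr1.
rewrite !mulrN opprK !powRN -mulrA -invfM ler_pdivrMr ?mulr_gt0 ?powR_gt0 ?br_gt0//.
rewrite mul1r -powRM ?(ltW (br_gt0 _))//.
apply: powR_incr; rewrite ?br_gt0 ?mulr_ge0//.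
rewrite /br; have := ler_normD x1 x2.
rewrite (_ : x1 + x2 = - x0) ?normrN; last by lra.
have := mulr_ge0 (normr_ge0 x1) (normr_ge0 x2); lra.
Qed.

(** The estimate behind the second inequality of the theorem, where no gain at
    low frequencies is available: either the time frequency of the output is
    far from the dispersion relation, and [far_pos] or [far_neg] applies, or the
    excess gives the decay that [near_mult_bound] asks for. *)
Lemma mult_excess : 0 <= e -> e <= be -> be <= 1 / 36 -> s < m%:R ->
  (0 <= s -> 12 * m%:R * be <= 1 /\ 3 * m%:R * be <= m%:R - s) ->
  8 * (2 * k%:R + 3) * be <= k%:R + 3 / 4 - r ->
  exists2 K : R, 0 <= K & forall q0 q1 q2 : R * R,
  q0.1 + q1.1 + q2.1 = 0 -> q0.2 + q1.2 + q2.2 = 0 ->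
  q0.1 ^+ 2 * excess m s q0 * (br q1.1 `^ (- (2 * s)) * br q2.1 `^ (- (2 * s))) *
    (sg k q0 * sg k q1 * sg k q2) `^ (2 * be - 1) <= K * total_kernel be e k q0 q1 q2.
Proof.
move=> e0 eb b36 sm Hpos H.
have b0 : 0 <= be by apply: le_trans eb.
have m1 : (1 : R) <= m%:R by rewrite ler1n.
have mE : m%:R = 2 * k%:R + 3 :> R.
  by rewrite /m mulnS !addSn add0n -addn3 natrD natrM.
have k0 : 0 <= k%:R :> R by [].
have r0 : 0 <= r by rewrite /r le_max lexx.
have rm : 2 * r <= m%:R.
  have : 0 <= k%:R + 3 / 4 - r.
    by apply: le_trans H; rewrite !mulr_ge0// addr_ge0// mulr_ge0.
  by rewrite mE; lra.
pose c : R := far_const k + 2 ^+ (2 * m).+1 + 1.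
have c1 : 1 <= c.
  have := far_const_ge2 k (R := R); have : 0 <= 2 ^+ (2 * m).+1 :> R by rewrite exprn_ge0.
  by rewrite /c; lra.
pose C : R := c ^+ 2 + (c + 1) + c + c * m%:R.
have c0 : 0 <= c := le_trans ler01 c1.
have cm0 : 0 <= c * m%:R by apply: mulr_ge0.
have cc0 : 0 <= c ^+ 2 by apply: sqr_ge0.
have C0 : 0 <= C by rewrite /C !addr_ge0.
have C1 : c ^+ 2 <= C by rewrite /C -!addrA lerDl !addr_ge0.
have C2 : c + 1 <= C.
  apply: (@le_trans _ _ (c ^+ 2 + (c + 1))); first by rewrite lerDr.
  by rewrite /C -[leRHS]addrA lerDl addr_ge0.
have C3 : c <= C by apply: le_trans C2; rewrite lerDl.
have C4 : c * m%:R <= C by rewrite /C lerDr !addr_ge0.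
have [Kn Kn0 KN] := near_mult_bound e0 eb b36 r0 H C0.
have Tn (q0 q1 q2 : R * R) : 0 <= q0.1 ^+ 2 * excess m s q0 *
    (br q1.1 `^ (- (2 * s)) * br q2.1 `^ (- (2 * s))).
  apply: mulr_ge0; last by apply: mulr_ge0; exact: powR_ge0.
  by apply: mulr_ge0; [exact: sqr_ge0|exact: excess_ge0].
have near q0 q1 q2 : q0.1 + q1.1 + q2.1 = 0 -> q0.2 + q1.2 + q2.2 = 0 ->
    excess m s q0 <= C * br q0.1 `^ (2 * s) ->
    (0 < `|q0.1| -> excess m s q0 <=
       C * br q0.1 `^ (2 * s) * (`|q0.1|^-1 + sg k q0 / `|q0.1| ^+ m)) ->
    q0.1 ^+ 2 * excess m s q0 * (br q1.1 `^ (- (2 * s)) * br q2.1 `^ (- (2 * s))) *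
    (sg k q0 * sg k q1 * sg k q2) `^ (2 * be - 1) <= Kn * total_kernel be e k q0 q1 q2.
  move=> h1 h2 E1 E2.
  have P0 : 0 <= br q1.1 `^ (- (2 * s)) * br q2.1 `^ (- (2 * s)).
    by rewrite mulr_ge0 ?powR_ge0.
  have W : C * (q0.1 ^+ 2 * br q0.1 `^ (2 * s) *
      (br q1.1 `^ (- (2 * s)) * br q2.1 `^ (- (2 * s)))) <= C * sq_mult r q0.1 q1.1 q2.1.
    rewrite ler_wpM2l//; apply: le_trans (sq_mult_reduce h1).
    by rewrite /sq_mult !mulrN opprK !mulrA.
  apply: KN => //.
  - apply: le_trans W.
    apply: (@le_trans _ _ (q0.1 ^+ 2 * (C * br q0.1 `^ (2 * s)) *
       (br q1.1 `^ (- (2 * s)) * br q2.1 `^ (- (2 * s))))).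
      by rewrite ler_wpM2r// ler_wpM2l ?sqr_ge0.
    by rewrite le_eqVlt; apply/orP; left; apply/eqP; ring.
  - move=> X0; have X00 : 0 < `|q0.1| by lra.
    set G := _^-1 + _ in E2 *.
    have G0 : 0 <= G by rewrite addr_ge0 ?invr_ge0// divr_ge0 ?exprn_ge0 ?ltW ?sg_gt0.
    apply: le_trans (ler_wpM2r G0 W).
    apply: (@le_trans _ _ (q0.1 ^+ 2 * (C * br q0.1 `^ (2 * s) * G) *
       (br q1.1 `^ (- (2 * s)) * br q2.1 `^ (- (2 * s))))).
      by rewrite ler_wpM2r// ler_wpM2l ?sqr_ge0// E2.
    by rewrite le_eqVlt; apply/orP; left; apply/eqP; ring.
have [s0|s0] := leP 0 s.
  have [b12 b3] := Hpos s0.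
  have [Kf Kf0 KF] := far_pos e0 eb b36 b12 b3 s0 sm.
  exists (Kn + Kf); first by rewrite addr_ge0.
  move=> q0 q1 q2 h1 h2; have Pt0 := total_kernel_ge0 be e k q0 q1 q2.
  rewrite [(Kn + Kf) * _]mulrDl; have [far|nf] := leP (far_const k * br q0.1 ^+ m) (br q0.2).
    apply: (@le_trans _ _ (Kf * total_kernel be e k q0 q1 q2)); last by rewrite lerDr mulr_ge0.
    apply: KF => //.
    rewrite -[q0.1 ^+ 2]real_normK ?num_real//.
    by rewrite ler_wpM2r ?mulr_ge0 ?powR_ge0// ler_wpM2l ?exprn_ge0// excess_le.
  apply: (@le_trans _ _ (Kn * total_kernel be e k q0 q1 q2)); last by rewrite lerDl mulr_ge0.
  have hc : br q0.2 <= c * br q0.1 ^+ m.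
    apply: le_trans (ltW nf) _; rewrite ler_wpM2r ?exprn_ge0 ?(ltW (br_gt0 _))//.
    have : 0 <= 2 ^+ (2 * m).+1 :> R by rewrite exprn_ge0.
    by rewrite /c; lra.
  have [E1 E2] := excess_near_pos (ltn0Sn _) s0 sm c1 hc.
  apply: near => //.
    by apply: le_trans E1 _; rewrite ler_wpM2r ?powR_ge0.
  move=> X0; apply: le_trans (E2 X0) _; apply: ler_pM.
  - by rewrite mulr_ge0 ?powR_ge0// addr_ge0.
  - by rewrite divr_ge0 ?exprn_ge0 ?ltW ?br_gt0.
  - by rewrite ler_wpM2r ?powR_ge0.
  - by rewrite lerDr invr_ge0.
have rE : s = - r by rewrite /r (max_idPr _) ?opprK// oppr_ge0 ltW.
have [Kf Kf0 KF] := far_neg e0 eb b36 r0 H.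
exists (Kn + Kf); first by rewrite addr_ge0.
move=> q0 q1 q2 h1 h2; have Pt0 := total_kernel_ge0 be e k q0 q1 q2.
rewrite [(Kn + Kf) * _]mulrDl; have [far|nf] := leP (2 ^+ (2 * m).+1 * br q0.2) (br q0.1 ^+ m).
  apply: (@le_trans _ _ (Kf * total_kernel be e k q0 q1 q2)); last by rewrite lerDr mulr_ge0.
  apply: KF => //.
  rewrite -[q0.1 ^+ 2]real_normK ?num_real//.
  have -> : 2 * r = - (2 * s) by rewrite rE; ring.
  rewrite ler_wpM2r ?mulr_ge0 ?powR_ge0// ler_wpM2l ?exprn_ge0//.
  by rewrite mulNr opprK excess_le.
apply: (@le_trans _ _ (Kn * total_kernel be e k q0 q1 q2)); last by rewrite lerDl mulr_ge0.
have hc : br q0.1 ^+ m <= c * br q0.2.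
  apply: le_trans (ltW nf) _; rewrite ler_wpM2r ?(ltW (br_gt0 _))//.
  by have := far_const_ge2 k (R := R); rewrite /c; lra.
have [E1 E2] := excess_near_neg (ltn0Sn _) r0 rm c1 hc.
rewrite -rE in E1 E2.
have sE : - (2 * r) = 2 * s by rewrite rE; ring.
rewrite sE in E1 E2.
apply: near => //.
  by apply: le_trans E1 _; rewrite ler_wpM2r ?powR_ge0.
move=> X0; apply: le_trans (E2 X0) _; rewrite ler_wpM2r//.
  by rewrite addr_ge0 ?invr_ge0// divr_ge0 ?exprn_ge0 ?ltW ?br_gt0.
by rewrite ler_wpM2r ?powR_ge0.
Qed.

End mult.
End excess.

(** * From multiplier estimates to convolution bounds *)

Section beta_facts.
Context {R : realType}.

(** All that the estimates use of [beta].  The last conjunct has a uniform form: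
    for [s >= 0] it follows from the first branch of the definition, and for
    negative [s] from either of the two others. *)
Lemma beta_facts (k : nat) (s : R) : let m := (2 * k.+1).+1 in
  let be := beta k.+1 m s in
  - k.+1%:R + 1 / 4 < s < m%:R ->
  [/\ 0 < be, be <= 1 / 36,
      0 <= s -> 12 * m%:R * be <= 1 /\ 3 * m%:R * be <= m%:R - s &
      8 * (2 * k%:R + 3) * be <= k%:R + 3 / 4 - Num.max 0 (- s)].
Proof.
move=> m be /andP[sl su].
have k0 : 0 <= k%:R :> R by [].
have mE : m%:R = 2 * k%:R + 3 :> R.
  by rewrite /m mulnS !addSn add0n -addn3 natrD natrM.
rewrite -[k.+1%:R]natr1 in sl.
have m3 : 3 <= m%:R :> R by rewrite mE; lra.
have m0 : 0 < m%:R :> R by lra.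
have small (x : R) : m%:R * x <= 1 / 12 -> x <= 1 / 36.
  rewrite -ler_pdivlMl// => h; apply: le_trans h _.
  by rewrite ler_pdivrMl//; lra.
rewrite -mE /be /beta -[k.+1%:R]natr1; have [s0|s0] := leP 0 s.
  have -> : Num.max 0 (- s) = 0 by rewrite (max_idPl _)// oppr_le0.
  have i0 : 0 < 1 / (12 * m%:R) :> R by rewrite divr_gt0// mulr_gt0.
  have i1 : 0 < (m%:R - s) / (3 * m%:R) by rewrite divr_gt0 ?mulr_gt0// subr_gt0.
  set b := Num.min _ _.
  have b1 : m%:R * b <= 1 / 12.
    rewrite -ler_pdivlMl// ge_min; apply/orP; left.
    by rewrite le_eqVlt; apply/orP; left; apply/eqP; field; rewrite gt_eqF.
  have b2 : m%:R * b <= (m%:R - s) / 3.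
    rewrite -ler_pdivlMl// ge_min; apply/orP; right.
    by rewrite le_eqVlt; apply/orP; left; apply/eqP; field; rewrite gt_eqF.
  split; [by rewrite lt_min i0 i1|exact: small| |].
    by move=> _; split; lra.
  by lra.
have -> : Num.max 0 (- s) = - s by rewrite (max_idPr _)// oppr_ge0 ltW.
have [s1|s1] := ltP (- (1 / 2)) s.
  have i1 : 0 < (s + 1 / 2) / (2 * m%:R) by rewrite divr_gt0 ?mulr_gt0//; lra.
  have i0 : 0 < (k%:R + 1 - 3 / 4) / (32 * m%:R) :> R.
    by rewrite divr_gt0 ?mulr_gt0//; lra.
  set b := Num.min _ _.
  have b1 : m%:R * b <= (k%:R + 1 / 4) / 32.
    rewrite -ler_pdivlMl// ge_min; apply/orP; left.
    by rewrite le_eqVlt; apply/orP; left; apply/eqP; field; rewrite gt_eqF.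
  split; [by rewrite lt_min i0 i1| | |].
  - rewrite -(@ler_pM2l _ m%:R)//; apply: le_trans b1 _; rewrite mE; lra.
  - by lra.
  - by lra.
have bE : 1 / (32 * m%:R) * (s - (- (k%:R + 1) + 1 / 4)) =
  (k%:R + 3 / 4 + s) / 32 / m%:R :> R by field; rewrite gt_eqF.
rewrite bE; set b := _ / m%:R.
have b1 : m%:R * b = (k%:R + 3 / 4 + s) / 32 by rewrite /b mulrC divfK// gt_eqF.
split.
- by rewrite /b !divr_gt0//; lra.
- rewrite -(@ler_pM2l _ m%:R)// b1 mE; lra.
- by lra.
- by lra.
Qed.

End beta_facts.

Section bilinear.
Context {R : realType}.
Local Notation mu2 := (leb2 R).

Section weighted.
Variables (be e : R) (k : nat).
Hypotheses (e0 : 0 < e) (be0 : 0 < be).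

(** Adding the mirror image makes the kernel symmetric in the two free
    frequencies, so that the total kernel is the sum over the fixed one. *)
Definition sym_kernel (a p : R * R) : R := pair_kernel be e k a p + pair_kernel be e k a (- (a + p)).

Lemma schur_sym_kernel : exists2 C : R, 0 < C & schur C sym_kernel.
Proof.
have b2 : 0 < 2 * be by rewrite mulr_gt0.
have n2 : 1 <= `|2 : R| by rewrite ger0_norm// ler1n.
have n1 : 1 <= `|1 : R| by rewrite normr1.
pose m := (2 * k.+1).+1.
have P := schurD (schurD (schurD (schurD (schurD (@schur_kder R e k.+1 e0)
  (schur_kaff m (k%:R + 1 / 2) 1 e0 n2)) (schur_kaff m (-1) 0 e0 n1))
  (schur_klow m 0 b2)) (schur_klow m 1 b2)) (@schur_ktime R e k.+1 e0).
have Q := schurD P (schur_mirror P).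
set C := (X in schur X _) in Q.
exists (C + 1).
  by rewrite ltr_wpDl// /C !addr_ge0// !mulr_ge0// ?invr_ge0 ?ltW.
case: Q => mQ Q0 QC; split => // a; apply: le_trans (QC a) _.
by rewrite lee_fin lerDl.
Qed.

Lemma total_kernel_sym_kernel (z q : R * R) : total_kernel be e k (- z) q (z - q) =
  sym_kernel (- z) q + sym_kernel q (z - q) + sym_kernel (z - q) q.
Proof.
rewrite /sym_kernel (_ : - (- z + q) = z - q); last by rewrite opprD opprK.
rewrite (_ : - (q + (z - q)) = - z); last by rewrite addrC subrK.
rewrite (_ : - (z - q + q) = - z); last by rewrite subrK.
by rewrite /total_kernel; ring.
Qed.

Lemma weighted_conv_bound (K : R) (W h : R * R -> R) : 0 <= K ->
  measurable_fun setT h -> measurable_fun setT W ->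
  (forall z, 0 <= h z) -> (forall z, 0 <= W z) ->
  (forall z q, h z ^+ 2 <= W q * W (z - q) * (K * total_kernel be e k (- z) q (z - q))) ->
  exists2 c : R, 0 < c & forall F G : R * R -> R,
  measurable_fun setT F -> measurable_fun setT G ->
  (forall z, 0 <= F z) -> (forall z, 0 <= G z) ->
  forall a b : R, 0 < a -> 0 < b ->
  (\int[mu2]_z (W z * F z ^+ 2)%:E <= a%:E)%E ->
  (\int[mu2]_z (W z * G z ^+ 2)%:E <= b%:E)%E ->
  (\int[mu2]_z (\int[mu2]_q (h z * F q * G (z - q))%:E) ^+ 2 <= (c * a * b)%:E)%E.
Proof.
move=> K0 mh mW h0 W0 hW.
have [C C0 SC] := schur_sym_kernel.
have S : schur ((K + 1) * C) (fun a p => (K + 1) * sym_kernel a p).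
  by apply: schurZ => //; rewrite addr_ge0.
have C1 : 0 < (K + 1) * C by rewrite mulr_gt0// ltr_wpDl.
exists (9 * ((K + 1) * C)); first by rewrite mulr_gt0.
move=> F G mF mG F0 G0 a b a0 b0 Fa Gb.
have H := bilinear_bound C1 a0 b0 S S S mh mF mG mW h0 F0 G0 W0 _ Fa Gb.
apply: H => z q; apply: le_trans (hW z q) _.
rewrite ler_wpM2l ?mulr_ge0// -!mulrDr -total_kernel_sym_kernel ler_wpM2r ?total_kernel_ge0//.
by rewrite lerDl.
Qed.

End weighted.

Lemma measurable_br1 : measurable_fun [set: R * R] (fun q => br q.1).
Proof.
apply: (measurableT_comp (continuous_measurable_fun (@continuous_br _)));
  exact: measurable_fst.
Qed.
Lemma measurable_br2 : measurable_fun [set: R * R] (fun q => br q.2).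
Proof.
apply: (measurableT_comp (continuous_measurable_fun (@continuous_br _)));
  exact: measurable_snd.
Qed.
Lemma measurable_sg k : measurable_fun [set: R * R] (@sg R k).
Proof.
apply: (measurableT_comp (continuous_measurable_fun (@continuous_br _))).
apply: measurable_funB; first exact: measurable_snd.
by apply: measurable_funX; exact: measurable_fst.
Qed.
Lemma measurable_powR_comp (f : R * R -> R) (a : R) :
  measurable_fun setT f -> measurable_fun setT (fun q => f q `^ a).
Proof. by move=> mf; apply: (measurableT_comp (measurable_powR _)). Qed.

Lemma sgN k (q : R * R) : sg k (- q) = sg k q.
Proof. by rewrite /sg /md/= odd_pow -opprD brN. Qed.

Lemma powR_half_sqr (x : R) : 0 <= x -> (x `^ (1 / 2)) ^+ 2 = x.
Proof.
move=> x0; rewrite -powR_mulrn ?powR_ge0// -powRrM (_ : 1 / 2 * 2%:R = 1) ?powRr1//.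
by field.
Qed.

Section weights.
Variables (s be : R) (k : nat).
Let m := (2 * k.+1).+1.
Hypothesis su : s < m%:R.

(** The weights of the norms squared at the endpoint [1 / 2 - be] of the
    exponents of the modulation; larger exponents only enlarge the norms. *)
Definition wX (q : R * R) : R := br q.1 `^ (2 * s) * sg k q `^ (1 - 2 * be).
Definition wA (al : R) (q : R * R) : R :=
  wX q + (if `|q.1| <= 1 then br q.2 `^ (2 * al) else 0).
(** Square roots of the squared multipliers of the output, for the excess and for
    the whole time weight. *)
Definition mult_excess_fun (z : R * R) : R :=
  `|z.1| * (excess m s z * sg k z `^ (2 * be - 1)) `^ (1 / 2).
Definition mult_time_fun (z : R * R) : R :=
  `|z.1| * (br z.2 `^ (2 * s / m%:R) * sg k z `^ (2 * be - 1)) `^ (1 / 2).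

Lemma wX_ge0 q : 0 <= wX q. Proof. by rewrite mulr_ge0 ?powR_ge0. Qed.
Lemma wX_le_wA al q : wX q <= wA al q.
Proof. by rewrite /wA lerDl; case: ifP => // _; exact: powR_ge0. Qed.
Lemma wA_ge0 al q : 0 <= wA al q.
Proof. exact: le_trans (wX_ge0 q) (wX_le_wA al q). Qed.

Lemma measurable_wX : measurable_fun setT wX.
Proof.
by apply: measurable_funM; apply: measurable_powR_comp;
  [exact: measurable_br1|exact: measurable_sg].
Qed.

Lemma measurable_low_ifE (f : R * R -> R) : measurable_fun setT f ->
  measurable_fun setT (fun q : R * R => if `|q.1| <= 1 then f q else 0).
Proof.
move=> mf; apply: measurable_fun_ifT => //.
apply: measurable_fun_ler => //.
by apply: measurableT_comp; [exact: normr_measurable|exact: measurable_fst].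
Qed.

Lemma measurable_wA al : measurable_fun setT (wA al).
Proof.
apply: measurable_funD; first exact: measurable_wX.
by apply: measurable_low_ifE; apply: measurable_powR_comp; exact: measurable_br2.
Qed.

Lemma measurable_mult_time_fun : measurable_fun setT mult_time_fun.
Proof.
apply: measurable_funM.
  by apply: measurableT_comp; [exact: normr_measurable|exact: measurable_fst].
apply: measurable_powR_comp; apply: measurable_funM;
  apply: measurable_powR_comp; [exact: measurable_br2|exact: measurable_sg].
Qed.

Lemma measurable_mult_excess_fun : measurable_fun setT mult_excess_fun.
Proof.
apply: measurable_funM.
  by apply: measurableT_comp; [exact: normr_measurable|exact: measurable_fst].
apply: measurable_powR_comp; apply: measurable_funM; last first.
  by apply: measurable_powR_comp; exact: measurable_sg.
apply: measurable_maxr => //; apply: measurable_funB;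
  apply: measurable_powR_comp; [exact: measurable_br2|exact: measurable_br1].
Qed.

Lemma mult_excess_fun_sqr z :
  mult_excess_fun z ^+ 2 = z.1 ^+ 2 * excess m s z * sg k z `^ (2 * be - 1).
Proof.
rewrite exprMn powR_half_sqr ?mulr_ge0 ?excess_ge0 ?powR_ge0//.
by rewrite real_normK ?num_real// mulrA.
Qed.

Lemma mult_time_fun_sqr z :
  mult_time_fun z ^+ 2 = z.1 ^+ 2 * br z.2 `^ (2 * s / m%:R) * sg k z `^ (2 * be - 1).
Proof.
rewrite exprMn powR_half_sqr ?mulr_ge0 ?powR_ge0//.
by rewrite real_normK ?num_real// mulrA.
Qed.

Lemma wX_inv q : wX q * (br q.1 `^ (- (2 * s)) * sg k q `^ (2 * be - 1)) = 1.
Proof.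
have br0 := br_gt0 q.1; have s0 := sg_gt0 k q.
rewrite /wX mulrACA -!powRDp// subrr powRr0 mul1r.
by rewrite (_ : 1 - 2 * be + (2 * be - 1) = 0) ?powRr0//; ring.
Qed.

(** At low frequencies the modulation and the time frequency are comparable, so
    the low-frequency part of the weight has the decay of [low_decay] to
    within a constant. *)
Lemma wA_inv al e q : e <= 2 * al - 1 -> 0 < e -> e <= 1 ->
  1 <= 4 * 2 ^+ (2 * m) * wA al q * (br q.1 `^ (- (2 * s)) * low_decay be e k q).
Proof.
move=> eal e0 e1.
have br0 := br_gt0 q.1; have s0 := sg_gt0 k q.
have c1 : 1 <= 4 * 2 ^+ (2 * m) :> R.
  have : 1 <= 2 ^+ (2 * m) :> R by rewrite exprn_ege1// ler1n.
  by lra.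
rewrite /low_decay; case: ifPn => q1; last first.
  rewrite /wA (negbTE q1) addr0 -mulrA wX_inv mulr1//.
rewrite /wA q1.
have sL : sg k q <= 2 * br q.2.
  have : `|q.1 ^+ m| <= 1 by rewrite normrX exprn_ile1.
  have := ler_normB q.2 (q.1 ^+ m).
  by have := normr_ge0 q.2; rewrite /sg /br /md -/m; lra.
have A : sg k q `^ (1 + e) <= 4 * br q.2 `^ (2 * al).
  apply: (@le_trans _ _ ((2 * br q.2) `^ (1 + e))).
    by apply: powR_incr => //; lra.
  rewrite powRM ?(ltW (br_gt0 _))//; apply: ler_pM; rewrite ?powR_ge0//.
    apply: (@le_trans _ _ (2 `^ 2%:R)); last by rewrite powR_mulrn// -natrX.
    by rewrite ler_powR ?ler1n//; lra.
  by rewrite ler_powR ?br_ge1//; lra.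
have B : br q.1 `^ (2 * s) <= 2 ^+ (2 * m).
  apply: (@le_trans _ _ (br q.1 `^ (2 * m)%:R)).
    by rewrite ler_powR ?br_ge1// natrM ler_wpM2l// ltW.
  rewrite powR_mulrn ?(ltW br0)// lerXn2r ?nnegrE ?(ltW br0)//.
  by rewrite /br; lra.
have -> : -1 - e = - (1 + e) by rewrite opprD.
rewrite !powRN -invfM ler_pdivlMr ?mulr_gt0 ?powR_gt0// mul1r.
apply: (@le_trans _ _ (2 ^+ (2 * m) * (4 * br q.2 `^ (2 * al)))).
  by apply: ler_pM; rewrite ?powR_ge0.
rewrite [leLHS]mulrA [2 ^+ _ * 4]mulrC ler_wpM2l ?(le_trans ler01 c1)// lerDr.
exact: wX_ge0.
Qed.

End weights.
End bilinear.

Section conv_bounds.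
Context {R : realType}.
Local Notation mu2 := (leb2 R).
Variables (s : R) (k : nat).
Let m := (2 * k.+1).+1.
Let be : R := beta k.+1 m s.
Hypothesis hs : - k.+1%:R + 1 / 4 < s < m%:R.

(** The bounds [a] and [b] are positive reals rather than the integrals
    themselves: the constants in [bilinear_bound] divide by them. *)
Definition conv_bounded (W h : R * R -> R) (c : R) : Prop :=
  forall F G : R * R -> R,
  measurable_fun setT F -> measurable_fun setT G ->
  (forall z, 0 <= F z) -> (forall z, 0 <= G z) ->
  forall a b : R, 0 < a -> 0 < b ->
  (\int[mu2]_z (W z * F z ^+ 2)%:E <= a%:E)%E ->
  (\int[mu2]_z (W z * G z ^+ 2)%:E <= b%:E)%E ->
  (\int[mu2]_z (\int[mu2]_q (h z * F q * G (z - q))%:E) ^+ 2 <= (c * a * b)%:E)%E.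

Let brNE (q : R * R) : br (- q).1 = br q.1 /\ br (- q).2 = br q.2.
Proof. by rewrite /= !brN. Qed.

Let excessN q : excess m s (- q) = excess m s q.
Proof. by rewrite /excess; have [-> ->] := brNE q. Qed.

Let sum0 (z q : R * R) : (- z).1 + q.1 + (z - q).1 = 0 /\ (- z).2 + q.2 + (z - q).2 = 0.
Proof. by split => /=; ring. Qed.

Lemma excess_pointwise (e : R) : 0 < e -> e <= be ->
  exists2 K : R, 0 <= K & forall z q : R * R,
  z.1 ^+ 2 * excess m s z * sg k z `^ (2 * be - 1) <=
  wX s be k q * wX s be k (z - q) * (K * total_kernel be e k (- z) q (z - q)).
Proof.
move=> e0 eb; have [be0 b36 Hpos H] := beta_facts hs.
have [K K0 HK] := mult_excess (ltW e0) eb b36 (proj2 (andP hs)) Hpos H.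
exists K => // z q; have [h1 h2] := sum0 z q.
have := HK _ _ _ h1 h2; rewrite excessN sgN sqrrN => B.
have := ler_wpM2l (mulr_ge0 (wX_ge0 s be k q) (wX_ge0 s be k (z - q))) B.
apply: le_trans; rewrite !powRM ?mulr_ge0 ?(ltW (sg_gt0 _ _))//.
have E1 := wX_inv s be k q; have E2 := wX_inv s be k (z - q).
set w1 := wX s be k q in E1 *; set w2 := wX s be k (z - q) in E2 *.
rewrite le_eqVlt; apply/orP; left; apply/eqP.
transitivity (z.1 ^+ 2 * excess m s z * sg k z `^ (2 * be - 1) *
  (w1 * (br q.1 `^ (- (2 * s)) * sg k q `^ (2 * be - 1))) *
  (w2 * (br (z - q).1 `^ (- (2 * s)) * sg k (z - q) `^ (2 * be - 1)))).
  by rewrite E1 E2 !mulr1.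
by ring.
Qed.

Lemma conv_bound_excess :
  exists2 c : R, 0 < c & conv_bounded (wX s be k) (mult_excess_fun s be k) c.
Proof.
have [be0 b36 _ _] := beta_facts hs.
have [K K0 HK] := excess_pointwise be0 (lexx _).
apply: (@weighted_conv_bound R be be k be0 be0 _ _ _ K0).
- exact: measurable_mult_excess_fun.
- exact: measurable_wX.
- by move=> z; rewrite mulr_ge0 ?powR_ge0.
- by move=> z; exact: wX_ge0.
- by move=> z q; rewrite mult_excess_fun_sqr.
Qed.

(** The time weight is at most the space weight plus the excess; the gain at low
    frequencies serves the first, and [excess_pointwise] bounds the second. *)
Lemma conv_bound_time (al : R) : 1 / 2 < al ->
  exists2 c : R, 0 < c & conv_bounded (wA s be k al) (mult_time_fun s be k) c.
Proof.
move=> al2; have [be0 b36 Hpos H] := beta_facts hs.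
pose e : R := Num.min (2 * al - 1) be.
have e0 : 0 < e by rewrite lt_min be0 andbT; lra.
have eb : e <= be by rewrite ge_min lexx orbT.
have eal : e <= 2 * al - 1 by rewrite ge_min lexx.
have e1 : e <= 1 by apply: le_trans eb _; apply: le_trans b36 _; lra.
have [K K0 HK] := excess_pointwise e0 eb.
have r0 : 0 <= Num.max 0 (- s) by rewrite le_max lexx.
have [L L0 HL] := mult_low_decay (ltW e0) eb b36 r0 H.
pose C : R := 4 * 2 ^+ (2 * m).
have C0 : 0 <= C by rewrite /C mulr_ge0 ?exprn_ge0.
have KL : 0 <= K + C ^+ 2 * L.
  by apply: addr_ge0 => //; apply: mulr_ge0 => //; exact: sqr_ge0.
apply: (@weighted_conv_bound R be e k e0 be0 _ _ _ KL).
- exact: measurable_mult_time_fun.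
- exact: measurable_wA.
- by move=> z; rewrite mulr_ge0 ?powR_ge0.
- by move=> z; exact: wA_ge0.
move=> z q; rewrite mult_time_fun_sqr.
have [h1 h2] := sum0 z q.
have P0 := total_kernel_ge0 be e k (- z) q (z - q).
set P := total_kernel _ _ _ _ _ _ in P0 *.
have w10 := wA_ge0 s be k al q; have w20 := wA_ge0 s be k al (z - q).
apply: (@le_trans _ _ (z.1 ^+ 2 * (br z.1 `^ (2 * s) + excess m s z) *
    sg k z `^ (2 * be - 1))).
  by rewrite ler_wpM2r ?powR_ge0// ler_wpM2l ?sqr_ge0// time_weight_le.
rewrite [(K + _) * P]mulrDl [leRHS]mulrDr [leRHS]addrC.
rewrite [z.1 ^+ 2 * _]mulrDr [leLHS]mulrDl lerD//; last first.
  apply: le_trans (HK z q) _; rewrite -/P ler_wpM2r ?mulr_ge0//.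
  by apply: ler_pM; rewrite ?wX_ge0 ?wX_le_wA.
have B := HL _ _ _ h1 h2; rewrite -/P sgN in B.
have D := sq_mult_reduce s h1.
have EW p : 1 <= C * wA s be k al p * (br p.1 `^ (- (2 * s)) * low_decay be e k p).
  by apply: wA_inv => //; case/andP: hs.
have E1 := EW q; have E2 := EW (z - q).
set l1 := low_decay be e k q in B E1; set l2 := low_decay be e k (z - q) in B E2.
have l10 : 0 <= l1 by exact: powR_ge0.
have l20 : 0 <= l2 by exact: powR_ge0.
set w1 := wA s be k al q in w10 E1 *; set w2 := wA s be k al (z - q) in w20 E2 *.
apply: (@le_trans _ _ (w1 * w2 * (C ^+ 2 * (sq_mult (- s) (- z).1 q.1 (z - q).1 *
   (sg k z `^ (2 * be - 1) * l1 * l2))))); last first.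
  rewrite ler_wpM2l ?mulr_ge0// -[leRHS]mulrA ler_wpM2l ?exprn_ge0//.
  apply: le_trans B; rewrite ler_wpM2r//.
  by rewrite !mulr_ge0 ?powR_ge0.
have T0 : 0 <= z.1 ^+ 2 * br z.1 `^ (2 * s) * sg k z `^ (2 * be - 1).
  by rewrite mulr_ge0 ?powR_ge0// mulr_ge0 ?sqr_ge0 ?powR_ge0.
apply: (@le_trans _ _ (z.1 ^+ 2 * br z.1 `^ (2 * s) * sg k z `^ (2 * be - 1) *
  ((C * w1 * (br q.1 `^ (- (2 * s)) * l1)) *
   (C * w2 * (br (z - q).1 `^ (- (2 * s)) * l2))))).
  have E20 := le_trans ler01 E2.
  by rewrite ler_peMr//; apply: le_trans E2 _; rewrite ler_peMl.
rewrite le_eqVlt; apply/orP; left; apply/eqP.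
rewrite /sq_mult (proj1 (brNE z)) !mulrN opprK sqrrN.
by ring.
Qed.

End conv_bounds.

(** * The convolution of complex-valued functions *)

Section complex_layer.
Context {R : realType}.
Local Notation mu2 := (leb2 R).
Local Notation normc := (@Normc.normc R).
Notation T4 := ((R * R) * (R * R))%type.

Lemma normc_ge0 (w : R[i]) : 0 <= normc w.
Proof. by case: w => a b /=; exact: sqrtr_ge0. Qed.

Lemma norm_re_le (w : R[i]) : `|complex.Re w| <= normc w.
Proof.
by case: w => a b /=; rewrite -sqrtr_sqr ler_wsqrtr// lerDl sqr_ge0.
Qed.

Lemma norm_im_le (w : R[i]) : `|complex.Im w| <= normc w.
Proof.
by case: w => a b /=; rewrite -sqrtr_sqr ler_wsqrtr// lerDr sqr_ge0.
Qed.

Lemma normc_le_re_im (w : R[i]) : normc w <= `|complex.Re w| + `|complex.Im w|.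
Proof.
case: w => a b /=.
rewrite -[leRHS]ger0_norm ?addr_ge0// -sqrtr_sqr ler_wsqrtr//.
rewrite sqrrD !real_normK ?num_real// addrAC lerDl mulrn_wge0// mulr_ge0//.
Qed.

Lemma measurable_normc (U : R * R -> R[i]) : cmeasurable U ->
  measurable_fun setT (fun z => normc (U z)).
Proof.
move=> [mr mi].
rewrite (_ : (fun z => normc (U z)) =
  (fun z => Num.sqrt (complex.Re (U z) ^+ 2 + complex.Im (U z) ^+ 2))); last first.
  by apply/funext => z; case: (U z).
apply: (measurableT_comp (continuous_measurable_fun (@sqrt_continuous R))).
by apply: measurable_funD; exact: measurable_funX.
Qed.

Lemma measurable_conv_re (U V : R * R -> R[i]) : cmeasurable U -> cmeasurable V ->
  measurable_fun [set: T4] (fun x => complex.Re (U x.2 * V (x.1 - x.2))) /\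
  measurable_fun [set: T4] (fun x => complex.Im (U x.2 * V (x.1 - x.2))).
Proof.
move=> [ur ui] [vr vi].
have sd (f : R * R -> R) : measurable_fun setT f ->
    measurable_fun [set: T4] (fun x => f x.2).
  by move=> mf; apply: (measurableT_comp mf); exact: measurable_snd.
have sb (f : R * R -> R) : measurable_fun setT f ->
    measurable_fun [set: T4] (fun x => f (x.1 - x.2)).
  by move=> mf; apply: (measurableT_comp mf); exact: measurable_sub2.
have reM (x y : R[i]) : complex.Re (x * y) =
  complex.Re x * complex.Re y - complex.Im x * complex.Im y by case: x y => ? ? [].
have imM (x y : R[i]) : complex.Im (x * y) =
  complex.Re x * complex.Im y + complex.Im x * complex.Re y by case: x y => ? ? [].
split.
  under eq_fun do rewrite reM.
  by apply: measurable_funB; apply: measurable_funM;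
    [exact: (sd _ ur)|exact: (sb _ vr)|exact: (sd _ ui)|exact: (sb _ vi)].
under eq_fun do rewrite imM.
by apply: measurable_funD; apply: measurable_funM;
  [exact: (sd _ ur)|exact: (sb _ vi)|exact: (sd _ ui)|exact: (sb _ vr)].
Qed.

(** The integral is by definition the difference of those of the positive and
    negative parts, to which Tonelli's theorem applies. *)
Lemma measurable_Rintegral_q (f : T4 -> R) : measurable_fun setT f ->
  measurable_fun setT (fun z => Rintegral mu2 setT (fun q => f (z, q))).
Proof.
move=> mf; apply: (measurableT_comp (f := fine)) => //.
have mE : measurable_fun [set: T4] (fun x => (f x)%:E) by apply/measurable_EFinP.
under eq_fun do rewrite integralE.
apply: emeasurable_funB.
  apply: eq_measurable_fun (measurable_integral_q (measurable_funepos mE)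
    (funepos_ge0 _)) => z _.
  by apply: eq_integral => q _; rewrite !funeposE.
apply: eq_measurable_fun (measurable_integral_q (measurable_funeneg mE)
  (funeneg_ge0 _)) => z _.
by apply: eq_integral => q _; rewrite !funenegE.
Qed.

Section pair.
Variables (U V : R * R -> R[i]).
Hypotheses (mU : cmeasurable U) (mV : cmeasurable V).

Definition conv_abs (z : R * R) : \bar R :=
  (\int[mu2]_q (normc (U q) * normc (V (z - q)))%:E)%E.

Lemma conv_abs_ge0 z : (0 <= conv_abs z)%E.
Proof. by apply: integral_ge0 => q _; rewrite lee_fin mulr_ge0 ?normc_ge0. Qed.

Let mslice (f : T4 -> R) z : measurable_fun setT f ->
  measurable_fun setT (fun q => f (z, q)).
Proof. by move=> mf; exact: (measurableT_comp mf (measurable_pair1 z)). Qed.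

Let mre z : measurable_fun setT (fun q => complex.Re (U q * V (z - q))).
Proof. by have [h _] := measurable_conv_re mU mV; exact: (mslice z h). Qed.
Let mim z : measurable_fun setT (fun q => complex.Im (U q * V (z - q))).
Proof. by have [_ h] := measurable_conv_re mU mV; exact: (mslice z h). Qed.

Lemma measurable_conv_abs_kernel : measurable_fun [set: T4]
  (fun x => normc (U x.2) * normc (V (x.1 - x.2))).
Proof.
apply: measurable_funM.
  by apply: (measurableT_comp (measurable_normc mU)); exact: measurable_snd.
by apply: (measurableT_comp (measurable_normc mV)); exact: measurable_sub2.
Qed.

Let mabs z : measurable_fun setT (fun q => normc (U q) * normc (V (z - q))).
Proof. exact: (mslice z measurable_conv_abs_kernel). Qed.

Lemma integral_part_le (p : R[i] -> R) z : (forall w, `|p w| <= normc w) ->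
  measurable_fun setT (fun q => p (U q * V (z - q))) ->
  (\int[mu2]_q `|(p (U q * V (z - q)))%:E| <= conv_abs z)%E.
Proof.
move=> hp mp; apply: ge0_le_integral => //.
- by apply/measurable_EFinP; apply: measurableT_comp => //; exact: normr_measurable.
- by apply/measurable_EFinP; exact: mabs.
- by move=> q _; rewrite lee_fin -Normc.normcM.
Qed.

Lemma cintegrable_conv z : (conv_abs z < +oo)%E ->
  cintegrable (fun q => U q * V (z - q)).
Proof.
move=> fin; split; apply/integrableP; split.
- by apply/measurable_EFinP; exact: mre.
- by apply: le_lt_trans fin; apply: integral_part_le => //; exact: norm_re_le.
- by apply/measurable_EFinP; exact: mim.
- by apply: le_lt_trans fin; apply: integral_part_le => //; exact: norm_im_le.
Qed.

Lemma normc_cint_le z (t : R) : conv_abs z = t%:E ->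
  normc (cint (fun q => U q * V (z - q))) <= 2 * t.
Proof.
move=> zt.
have part (p : R[i] -> R) : (forall w, `|p w| <= normc w) ->
    measurable_fun setT (fun q => p (U q * V (z - q))) ->
    `|Rintegral mu2 setT (fun q => p (U q * V (z - q)))| <= t.
  move=> hp mp; rewrite /Rintegral.
  have mp' : measurable_fun setT (fun q => (p (U q * V (z - q)))%:E).
    by apply/measurable_EFinP.
  have := le_trans (le_abse_integral mu2 measurableT mp') (integral_part_le hp mp).
  rewrite zt.
  by case: integral => //= r; rewrite lee_fin.
apply: le_trans (normc_le_re_im _) _; rewrite /cint /= mulr_natl mulr2n.
by apply: lerD; apply: part => //; [exact: norm_re_le|exact: norm_im_le].
Qed.

Lemma normc_dx_prod_hat z : normc (dx_prod_hat U V z) =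
  `|z.1| * (2 * pi) ^- 2 * normc (cint (fun q => U q * V (z - q))).
Proof.
rewrite /dx_prod_hat !Normc.normcM /=; congr (_ * _ * _).
  by rewrite expr0n/= add0r sqrtr_sqr.
rewrite expr0n/= addr0 sqrtr_sqr ger0_norm// invr_ge0 exprn_ge0//.
by rewrite mulr_ge0// pi_ge0.
Qed.

Lemma measurable_dx_prod_hat :
  measurable_fun setT (fun z => normc (dx_prod_hat U V z)).
Proof.
under eq_fun do rewrite normc_dx_prod_hat.
have [hr hi] := measurable_conv_re mU mV.
apply: measurable_funM.
  apply: measurable_funM => //.
  by apply: measurableT_comp; [exact: normr_measurable|exact: measurable_fst].
apply: measurable_normc; split.
  exact: (measurable_Rintegral_q hr).
exact: (measurable_Rintegral_q hi).
Qed.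

Lemma conv_abs_scale (h : R * R -> R) z : 0 <= h z ->
  (\int[mu2]_q (h z * normc (U q) * normc (V (z - q)))%:E = (h z)%:E * conv_abs z)%E.
Proof.
move=> h0; under eq_integral do rewrite -mulrA EFinM.
rewrite ge0_integralZl_EFin//.
- by move=> q _; rewrite lee_fin mulr_ge0 ?normc_ge0.
- by apply/measurable_EFinP; exact: mabs.
Qed.

Lemma two_pi_le : (2 * pi) ^- 2 <= 1 / 2 :> R.
Proof.
have p2 := @pi_ge2 R.
have h : 2 <= (2 * pi) ^+ 2 :> R.
  by apply: (@le_trans _ _ (4 ^+ 2)); [lra|rewrite lerXn2r ?nnegrE//; lra].
by rewrite mul1r lef_pV2 ?posrE//; lra.
Qed.

(** Where the absolute integral diverges the right-hand side is infinite, unless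
    [h] vanishes, and then so does the left-hand side. *)
Lemma dx_prod_hat_le (w : R) (h : R * R -> R) z : 0 <= w -> 0 <= h z ->
  w * z.1 ^+ 2 <= h z ^+ 2 ->
  ((w * normc (dx_prod_hat U V z) ^+ 2)%:E <=
   (\int[mu2]_q (h z * normc (U q) * normc (V (z - q)))%:E) ^+ 2)%E.
Proof.
move=> w0 h0 wh; rewrite conv_abs_scale//.
case E : (conv_abs z) (conv_abs_ge0 z) => [t| |] // t0.
  rewrite lee_fin in t0; rewrite expe2 -!EFinM lee_fin -expr2 exprMn.
  apply: (@le_trans _ _ (w * (`|z.1| * t) ^+ 2)); last first.
    by rewrite exprMn real_normK ?num_real// mulrA ler_wpM2r ?sqr_ge0.
  rewrite ler_wpM2l// lerXn2r ?nnegrE ?mulr_ge0 ?normc_ge0//.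
  rewrite normc_dx_prod_hat -mulrA ler_wpM2l//.
  apply: (@le_trans _ _ (1 / 2 * (2 * t))); last by rewrite mulrA divfK// mul1r.
  apply: ler_pM; rewrite ?normc_ge0 ?two_pi_le ?normc_cint_le//.
  by rewrite invr_ge0 exprn_ge0// mulr_ge0// pi_ge0.
have [hz|hz] := eqVneq (h z) 0.
  have wz : w * z.1 ^+ 2 = 0.
    apply/eqP; rewrite eq_le mulr_ge0 ?sqr_ge0// andbT.
    by apply: le_trans wh _; rewrite hz expr0n.
  rewrite normc_dx_prod_hat -mulrA exprMn real_normK ?num_real// mulrA wz mul0r.
  by rewrite hz mul0e expe2 mul0e.
have hp : 0 < h z by rewrite lt_neqAle eq_sym hz.
by rewrite gt0_muley ?lte_fin// expe2 mulyy leey.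
Qed.

End pair.
End complex_layer.

(** * Norms *)

Section norms.
Context {R : realType}.
Local Notation mu2 := (leb2 R).
Local Notation normc := (@Normc.normc R).
Notation T4 := ((R * R) * (R * R))%type.

Lemma sqrteD_le (x y : \bar R) : (0 <= x)%E -> (0 <= y)%E ->
  (sqrte (x + y) <= sqrte x + sqrte y)%E.
Proof.
case: x => [x| |] //; case: y => [y| |] //= x0 y0.
rewrite lee_fin in x0; rewrite lee_fin in y0; rewrite lee_fin.
rewrite -[leRHS]ger0_norm ?addr_ge0 ?sqrtr_ge0// -sqrtr_sqr ler_wsqrtr//.
by rewrite sqrrD !sqr_sqrtr// addrAC lerDl mulrn_wge0// mulr_ge0 ?sqrtr_ge0.
Qed.

(** The squared norms may vanish, so [conv_bounded] is used with them enlarged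
    by [d], and [d] tends to 0. *)
Lemma conv_bounded_sqrt (W h : R * R -> R) (c : R) (U V : R * R -> R[i])
    (A B : \bar R) : 0 < c -> conv_bounded W h c ->
  cmeasurable U -> cmeasurable V ->
  (0 <= A)%E -> (0 <= B)%E -> (A < +oo)%E -> (B < +oo)%E ->
  (\int[mu2]_z (W z * normc (U z) ^+ 2)%:E <= A ^+ 2)%E ->
  (\int[mu2]_z (W z * normc (V z) ^+ 2)%:E <= B ^+ 2)%E ->
  (\int[mu2]_z (\int[mu2]_q (h z * normc (U q) * normc (V (z - q)))%:E) ^+ 2 <=
    (Num.sqrt c)%:E ^+ 2 * A ^+ 2 * B ^+ 2)%E.
Proof.
move=> c0 H mU mV; case: A => [A| |] //; case: B => [B| |] // A0 B0 _ _.
rewrite lee_fin in A0; rewrite lee_fin in B0.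
rewrite !expe2 -!EFinM -!expr2 sqr_sqrtr ?(ltW c0)// => IA IB.
set X := (X in (X <= _)%E).
have X0 : (0 <= X)%E by apply: integral_ge0 => z _; exact: sqre_ge0.
have lim (d : R) : 0 < d -> (X <= (c * (A ^+ 2 + d) * (B ^+ 2 + d))%:E)%E.
  move=> d0; apply: (H _ _ (measurable_normc mU) (measurable_normc mV)
    (fun=> normc_ge0 _) (fun=> normc_ge0 _)).
  - by rewrite ltr_wpDl// sqr_ge0.
  - by rewrite ltr_wpDl// sqr_ge0.
  - by apply: le_trans IA _; rewrite lee_fin lerDl ltW.
  - by apply: le_trans IB _; rewrite lee_fin lerDl ltW.
clearbody X; case: X X0 lim => [x| |] // x0 lim; last by have := lim 1 ltr01.
rewrite lee_fin leNgt; apply/negP => xc.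
have {lim x0}lim (d : R) : 0 < d -> x <= c * (A ^+ 2 + d) * (B ^+ 2 + d).
  by move=> d0; have := lim d d0; rewrite lee_fin.
set a := A ^+ 2 in xc lim; set b := B ^+ 2 in xc lim.
have a0 : 0 <= a := sqr_ge0 _; have b0 : 0 <= b := sqr_ge0 _.
(* For d at most 1 the enlarged bound exceeds c * a * b by at most d * D. *)
pose D := c * (a + b + 1); pose d := Num.min 1 ((x - c * a * b) / (2 * D)).
have D0 : 0 < D by rewrite mulr_gt0// ltr_wpDl// addr_ge0.
have xc' : 0 < x - c * a * b by rewrite subr_gt0.
have d0 : 0 < d by rewrite lt_min ltr01 divr_gt0// mulr_gt0.
have d1 : d <= 1 by rewrite ge_min lexx.
have dD : d * (2 * D) <= x - c * a * b.
  rewrite -ler_pdivlMr; last by rewrite mulr_gt0.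
  by rewrite /d ge_min lexx orbT.
have := lim d d0.
have : 0 <= c * d * (1 - d).
  by rewrite mulr_ge0 ?subr_ge0// mulr_ge0// ltW.
have : 0 < d * D by rewrite mulr_gt0.
by move: dD; rewrite /D; clear -xc; lra.
Qed.

Section weights.
Variables (s : R) (k : nat).
Let m := (2 * k.+1).+1.
Let be : R := beta k.+1 m s.

Let wXb (b : R) (z : R * R) := br z.1 `^ (2 * s) * sg k z `^ (2 * b).

Lemma normX_sqr b U : (normX m s b U ^+ 2 =
  \int[mu2]_z (wXb b z * normc (U z) ^+ 2)%:E)%E.
Proof.
rewrite /normX sqr_sqrte//; apply: integral_ge0 => z _.
by rewrite lee_fin mulr_ge0 ?sqr_ge0// mulr_ge0 ?powR_ge0.
Qed.

Let measurable_wXb b : measurable_fun setT (wXb b).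
Proof.
by apply: measurable_funM; apply: measurable_powR_comp;
  [exact: measurable_br1|exact: measurable_sg].
Qed.

Let mnorm2 (w : R * R -> R) U : measurable_fun setT w -> cmeasurable U ->
  measurable_fun setT (fun z => (w z * normc (U z) ^+ 2)%:E).
Proof.
move=> mw mU; apply/measurable_EFinP; apply: measurable_funM => //.
by apply: measurable_funX; exact: measurable_normc.
Qed.

Let nn (w x : R) : 0 <= w -> (0 <= (w * x ^+ 2)%:E)%E.
Proof. by move=> w0; rewrite lee_fin mulr_ge0// sqr_ge0. Qed.

Lemma integral_wX_le b U : cmeasurable U -> 1 / 2 - be <= b ->
  (\int[mu2]_z (wX s be k z * normc (U z) ^+ 2)%:E <= normX m s b U ^+ 2)%E.
Proof.
move=> mU hb; rewrite normX_sqr; apply: ge0_le_integral => //.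
- by move=> z _; apply: nn; exact: wX_ge0.
- by apply: mnorm2 => //; exact: measurable_wX.
- exact: mnorm2.
- move=> z _; rewrite lee_fin ler_wpM2r ?sqr_ge0// ler_wpM2l ?powR_ge0//.
  by rewrite ler_powR ?sg_ge1//; lra.
Qed.

Lemma integral_wA_le b al U : cmeasurable U -> 1 / 2 - be <= b ->
  (\int[mu2]_z (wA s be k al z * normc (U z) ^+ 2)%:E <= normXa m s b al U ^+ 2)%E.
Proof.
move=> mU hb.
have mlow : measurable_fun setT
    (fun q : R * R => if `|q.1| <= 1 then br q.2 `^ (2 * al) else 0).
  by apply: measurable_low_ifE; apply: measurable_powR_comp; exact: measurable_br2.
have low0 (q : R * R) : 0 <= if `|q.1| <= 1 then br q.2 `^ (2 * al) else 0.
  by case: ifP => // _; exact: powR_ge0.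
have S0 : (0 <= normX m s b U ^+ 2)%E by exact: sqre_ge0.
rewrite /normXa sqr_sqrte; last first.
  by rewrite adde_ge0// integral_ge0// => z _; apply: nn; exact: powR_ge0.
under eq_integral do rewrite /wA mulrDl EFinD.
rewrite ge0_integralD//; last first.
- exact: mnorm2.
- by move=> z _; exact: nn.
- by apply: mnorm2 => //; exact: measurable_wX.
- by move=> z _; apply: nn; exact: wX_ge0.
apply: leeD; first exact: integral_wX_le.
rewrite [leRHS]integral_mkcond le_eqVlt; apply/orP; left; apply/eqP.
apply: eq_integral => z _; rewrite /patch; case: ifPn => [z1|z1].
  by rewrite mem_set//= -ler_norml.
by rewrite memNset ?mul0r//= -ler_norml; apply/negP.
Qed.

Lemma measurable_conv_abs_sqr (h : R * R -> R) U V : measurable_fun setT h -> (forall z, 0 <= h z) ->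
  cmeasurable U -> cmeasurable V -> measurable_fun setT
  (fun z => (\int[mu2]_q (h z * normc (U q) * normc (V (z - q)))%:E) ^+ 2)%E.
Proof.
move=> mh h0 mU mV; under eq_fun do rewrite expe2.
suff S : measurable_fun setT
    (fun z => \int[mu2]_q (h z * normc (U q) * normc (V (z - q)))%:E)%E.
  exact: emeasurable_funM.
under eq_fun do rewrite conv_abs_scale//.
apply: emeasurable_funM; first exact/measurable_EFinP.
apply: (measurable_integral_q
  (f := fun x => (normc (U x.2) * normc (V (x.1 - x.2)))%:E)).
  by apply/measurable_EFinP; exact: measurable_conv_abs_kernel.
by move=> x; rewrite lee_fin mulr_ge0 ?normc_ge0.
Qed.

Lemma integral_dx_prod_hat_le (w h : R * R -> R) U V :
  cmeasurable U -> cmeasurable V ->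
  measurable_fun setT w -> measurable_fun setT h ->
  (forall z, 0 <= w z) -> (forall z, 0 <= h z) ->
  (forall z, w z * z.1 ^+ 2 <= h z ^+ 2) ->
  (\int[mu2]_z (w z * normc (dx_prod_hat U V z) ^+ 2)%:E <=
   \int[mu2]_z (\int[mu2]_q (h z * normc (U q) * normc (V (z - q)))%:E) ^+ 2)%E.
Proof.
move=> mU mV mw mh w0 h0 wh; apply: ge0_le_integral => //.
- by move=> z _; exact: nn.
- apply/measurable_EFinP; apply: measurable_funM => //; apply: measurable_funX.
  exact: measurable_dx_prod_hat.
- exact: measurable_conv_abs_sqr.
- by move=> z _; exact: dx_prod_hat_le.
Qed.

End weights.

Lemma ae_fst_neq0 : {ae mu2, forall z : R * R, z.1 != 0}.
Proof.
exists ([set 0] `*` [set: R]); split.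
- by apply: measurableX => //; exact: measurable_set1.
- rewrite product_measure1E; [|exact: measurable_set1|exact: measurableT].
  by transitivity (0 * lebesgue_measure [set: R])%E; [congr (_ * _)%E; exact: lebesgue_measure_set1|rewrite mul0e].
- by move=> z /= /negP; rewrite negbK => /eqP.
Qed.

(** A finite norm of the output forces the absolute convolution integrals to
    converge almost everywhere, because its multiplier vanishes only on the null
    set where the space frequency is 0. *)
Lemma conv_defined_of_finite (h : R * R -> R) U V :
  cmeasurable U -> cmeasurable V -> measurable_fun setT h ->
  (forall z, 0 <= h z) -> (forall z, z.1 != 0 -> 0 < h z) ->
  (\int[mu2]_z (\int[mu2]_q (h z * normc (U q) * normc (V (z - q)))%:E) ^+ 2
    < +oo)%E ->
  conv_defined U V.
Proof.
move=> mU mV mh h0 hp fin.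
have mS := measurable_conv_abs_sqr mh h0 mU mV.
have S0 z : (0 <= (\int[mu2]_q (h z * normc (U q) * normc (V (z - q)))%:E) ^+ 2)%E.
  exact: sqre_ge0.
have ih : mu2.-integrable setT
    (fun z => (\int[mu2]_q (h z * normc (U q) * normc (V (z - q)))%:E) ^+ 2)%E.
  apply/integrableP; split => //.
  by under eq_integral do rewrite gee0_abs//.
have ae := integrable_ae measurableT ih.
apply: filterS2 ae ae_fst_neq0 => z /= fz z0.
apply: cintegrable_conv => //.
have := fz I; rewrite conv_abs_scale//.
case: (conv_abs U V z) (conv_abs_ge0 U V z) => [t| |] // t0; first by rewrite ltry.
by rewrite gt0_muley ?lte_fin ?hp// expe2 mulyy.
Qed.

End norms.

(** * The theorem *)

Theorem theorem1p4 (R : realType) (j m : nat) (s b : R)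
    (hj : (0 < j)%N) (hm : m = (2 * j + 1)%N)
    (hs : - j%:R + 1 / 4 < s < m%:R)
    (hb : 1 / 2 - beta j m s <= b < 1 / 2) :
  (forall alpha alpha' : R,
     1 / 2 < alpha' -> alpha' <= alpha -> alpha <= 1 / 2 + beta j m s ->
     exists c : R, 0 < c /\
       forall b' : R, 1 / 2 - beta j m s <= b' <= b ->
       forall (f g : tempered_distribution R) (F G : R * R -> R[i]),
         has_fourier f F -> has_fourier g G ->
         (normXa m s b' alpha' F < +oo)%E -> (normXa m s b' alpha' G < +oo)%E ->
         conv_defined F G /\
         (normY m s (- b) (dx_prod_hat F G) <=
            c%:E * normXa m s b' alpha' F * normXa m s b' alpha' G)%E)
  /\
  (exists c : R, 0 < c /\
     forall b' : R, 1 / 2 - beta j m s <= b' <= b ->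
     forall (f g : tempered_distribution R) (F G : R * R -> R[i]),
       has_fourier f F -> has_fourier g G ->
       (normX m s b' F < +oo)%E -> (normX m s b' G < +oo)%E ->
       conv_defined F G ->
       (normX m s (- b) (dx_prod_hat F G) < +oo)%E ->
       (normY m s (- b) (dx_prod_hat F G) <=
          normX m s (- b) (dx_prod_hat F G) +
          c%:E * normX m s b' F * normX m s b' G)%E).
Proof.
case: j hj hm hs hb => // k _; rewrite addn1 => -> hs /andP[hb _].
move: hs hb; set m' := (2 * k.+1).+1 => hs hb.
have [be0 _ _ _] := beta_facts hs.
pose wtime z : R := br z.2 `^ (2 * s / m'%:R) * sg k z `^ (2 * - b).
pose wexc z : R := excess m' s z * sg k z `^ (2 * - b).
pose wspace z : R := br z.1 `^ (2 * s) * sg k z `^ (2 * - b).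
have wtime0 z : 0 <= wtime z by rewrite mulr_ge0 ?powR_ge0.
have wexc0 z : 0 <= wexc z by rewrite mulr_ge0 ?powR_ge0 ?excess_ge0.
have wspace0 z : 0 <= wspace z by rewrite mulr_ge0 ?powR_ge0.
have msg : measurable_fun setT (fun z => sg k z `^ (2 * - b)).
  by apply: measurable_powR_comp; exact: measurable_sg.
have mwtime : measurable_fun setT wtime.
  by apply: measurable_funM => //; apply: measurable_powR_comp; exact: measurable_br2.
have mwspace : measurable_fun setT wspace.
  by apply: measurable_funM => //; apply: measurable_powR_comp; exact: measurable_br1.
have mwexc : measurable_fun setT wexc.
  apply: measurable_funM => //; apply: measurable_maxr => //; apply: measurable_funB;
    apply: measurable_powR_comp; [exact: measurable_br2|exact: measurable_br1].
have sgb z : sg k z `^ (2 * - b) <= sg k z `^ (2 * beta k.+1 m' s - 1).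
  by rewrite ler_powR ?sg_ge1//; lra.
have normYE U : normY m' s (- b) U =
    sqrte (\int[leb2 R]_z (wtime z * Normc.normc (U z) ^+ 2)%:E)%E by [].
have product (A B : \bar R) (c : R) : (0 <= A)%E -> (0 <= B)%E ->
    ((Num.sqrt c)%:E * A * B = sqrte ((Num.sqrt c)%:E ^+ 2 * A ^+ 2 * B ^+ 2))%E.
  move=> A0 B0; set C := (Num.sqrt c)%:E.
  have C0 : (0 <= C)%E by rewrite lee_fin sqrtr_ge0.
  rewrite (@sqrteM _ (C ^+ 2 * A ^+ 2)%E); last by rewrite mule_ge0 ?sqre_ge0.
  by rewrite (@sqrteM _ (C ^+ 2)%E) ?sqre_ge0// !sqrte_sqr !gee0_abs.
have sq3 (A B C : \bar R) : (0 <= A ^+ 2 * B ^+ 2 * C ^+ 2)%E.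
  by apply: mule_ge0; [apply: mule_ge0|]; exact: sqre_ge0.
have finite (A B : \bar R) (c : R) : (0 <= A)%E -> (0 <= B)%E ->
    (A < +oo)%E -> (B < +oo)%E -> ((Num.sqrt c)%:E ^+ 2 * A ^+ 2 * B ^+ 2 < +oo)%E.
  case: A => [A| |] //; case: B => [B| |] // _ _ _ _.
  by rewrite !expe2 -!EFinM ltry.
split.
  move=> al al' al2 _ _; have [c c0 H] := conv_bound_time hs al2.
  exists (Num.sqrt c); split; first by rewrite sqrtr_gt0.
  move=> b' /andP[hb' _] f g F G [mF _] [mG _] fF fG.
  have IF := integral_wA_le al' mF hb'; have IG := integral_wA_le al' mG hb'.
  have B := conv_bounded_sqrt c0 H mF mG (sqrte_ge0 _) (sqrte_ge0 _) fF fG IF IG.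
  have h0 z : 0 <= mult_time_fun s (beta k.+1 m' s) k z.
    by rewrite mulr_ge0 ?powR_ge0.
  have mh := measurable_mult_time_fun s (beta k.+1 m' s) k.
  split.
    apply: (conv_defined_of_finite mF mG mh h0).
      move=> z z0; rewrite mulr_gt0 ?normr_gt0// powR_gt0//.
      by rewrite mulr_gt0 ?powR_gt0 ?br_gt0 ?sg_gt0.
    apply: le_lt_trans B _.
    exact: finite (sqrte_ge0 _) (sqrte_ge0 _) fF fG.
  rewrite product ?sqrte_ge0// normYE lee_sqrt ?sq3//.
  apply: le_trans B; apply: integral_dx_prod_hat_le => // z.
  rewrite mult_time_fun_sqr mulrC mulrA ler_wpM2l//.
  by rewrite mulr_ge0 ?sqr_ge0 ?powR_ge0.
have [c c0 H] := conv_bound_excess hs.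
exists (Num.sqrt c); split; first by rewrite sqrtr_gt0.
move=> b' /andP[hb' _] f g F G [mF _] [mG _] fF fG _ _.
have IF := integral_wX_le mF hb'; have IG := integral_wX_le mG hb'.
have B := conv_bounded_sqrt c0 H mF mG (sqrte_ge0 _) (sqrte_ge0 _) fF fG IF IG.
have mh := measurable_mult_excess_fun s (beta k.+1 m' s) k.
have mD := measurable_dx_prod_hat mF mG.
have mw (w : R * R -> R) : measurable_fun setT w ->
  measurable_fun setT (fun z => (w z * Normc.normc (dx_prod_hat F G z) ^+ 2)%:E).
  by move=> mw; apply/measurable_EFinP; apply: measurable_funM => //; exact: measurable_funX.
have nn (w : R * R -> R) : (forall z, 0 <= w z) ->
  forall z, (0 <= (w z * Normc.normc (dx_prod_hat F G z) ^+ 2)%:E)%E.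
  by move=> w0 z; rewrite lee_fin mulr_ge0 ?sqr_ge0.
rewrite product ?sqrte_ge0// normYE /normX.
set IX := (X in (_ <= sqrte X + _)%E).
have IX0 : (0 <= IX)%E by apply: integral_ge0 => z _; exact: (nn wspace wspace0).
apply: le_trans (sqrteD_le IX0 _); last exact: sq3.
rewrite lee_sqrt; last by rewrite adde_ge0// sq3.
apply: (@le_trans _ _ (IX + \int[leb2 R]_z
    (wexc z * Normc.normc (dx_prod_hat F G z) ^+ 2)%:E)%E).
  rewrite -ge0_integralD//; [|by move=> z _; exact: (nn wspace wspace0)|exact: (mw wspace)|
    by move=> z _; exact: nn|exact: mw].
  apply: ge0_le_integral => //.
  - by move=> z _; exact: nn.
  - exact: mw.
  - by apply: emeasurable_funD; [exact: (mw wspace)|exact: mw].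
  - move=> z _; rewrite -EFinD lee_fin -mulrDl ler_wpM2r ?sqr_ge0//.
    by rewrite -mulrDl ler_wpM2r ?powR_ge0// time_weight_le.
rewrite leeD2l//; apply: le_trans B; apply: integral_dx_prod_hat_le => //.
  by move=> z; rewrite mulr_ge0 ?powR_ge0.
move=> z; rewrite mult_excess_fun_sqr mulrC mulrA ler_wpM2l//.
by rewrite mulr_ge0 ?sqr_ge0 ?excess_ge0.
Qed.
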